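(* For a sub-polynomial $\alpha(x)$ such that $\lim_{x\to+\infty}\frac{\alpha(x)}{x}=+\infty$, the following are equivalent: (i) For every $p\in\mathbb{Q}[x]$ and every $c\in\mathbb{R}$, $$\lim_{x\to+\infty}\frac{|\alpha(x)-c\,p(x)|}{\log x}=+\infty.$$ (ii) For every $A\subseteq\mathbb{N}$ with $\overline{d}(A)>0$, there exist distinct $x,y\in A$ and some $n\in\mathbb{N}$ such that $x+y=\lfloor\alpha(n)\rfloor$.
   Context: $\mathbb{N}=\{1,2,\dots\}$. For $A\subseteq\mathbb{N}$, $\overline{d}(A)=\limsup_{N\to\infty}\frac{|A\cap[1,N]|}{N}$. Let $\mathcal{G}$ be the ring (under pointwise addition and multiplication) of germs at $+\infty$ of continuous real-valued functions defined on half-lines $(a,+\infty)$; two functions have the same germ if they agree for all sufficiently large $x$. A Hardy field is a subfield of $\mathcal{G}$ closed under differentiation (each element is eventually differentiable and its derivative's germ lies in the field). A sub-polynomial is a function $\alpha$ whose germ belongs to some Hardy field and which satisfies $\lim_{x\to+\infty}\alpha(x)/x^l=0$ for some $l>0$. Functions and germs are not distinguished; when values $\alpha(n)$, $n\in\mathbb{N}$, appear, $\alpha$ denotes a fixed real-valued representative defined on $[1,+\infty)$. *)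

(* Defs.v *)
From mathcomp Require Import all_boot all_order all_algebra.
From mathcomp Require Import all_classical all_reals all_analysis.
Set Implicit Arguments.
Unset Strict Implicit.
Unset Printing Implicit Defensive.
Import Order.TTheory GRing.Theory Num.Theory.
Import numFieldTopology.Exports numFieldNormedType.Exports.
Local Open Scope classical_set_scope.
Local Open Scope ring_scope.

(* A germ at +oo is represented by any total function agreeing with it
   eventually; a set of germs is then a set of functions R -> R that is
   saturated under [eq_germ]. *)
Definition eq_germ (R : realType) (f g : R -> R) : Prop :=
  \forall x \near +oo, f x = g x.

Record hardy_field (R : realType) (H : set (R -> R)) : Prop := HardyField {
  hardy_germ : forall f g, eq_germ f g -> H f -> H g;
  hardy_continuous : forall f, H f ->
    \forall x \near +oo, {for x, continuous f};
  hardy1 : H (fun=> 1);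
  hardyB : forall f g, H f -> H g -> H (fun x => f x - g x);
  hardyM : forall f g, H f -> H g -> H (fun x => f x * g x);
  (* the inverse is taken in the ring of germs *)
  hardyV : forall f, H f -> ~ eq_germ f (fun=> 0) ->
    exists2 g, H g & eq_germ (fun x => f x * g x) (fun=> 1);
  (* [derive1 f] is total: its germ is meaningful thanks to eventual derivability *)
  hardy_derivable : forall f, H f -> \forall x \near +oo, derivable f x 1;
  hardy_derive : forall f, H f -> H (derive1 f)
}.

Definition sub_polynomial (R : realType) (f : R -> R) : Prop :=
  (exists2 H : set (R -> R), hardy_field H & H f) /\
  (exists2 l : R, 0 < l & f x / (x `^ l) @[x --> +oo] --> (0 : R)).

Definition upper_density (R : realType) (A : set nat) : \bar R :=
  limn_esup (fun N : nat =>
    ((\sum_(1 <= k < N.+1) (k \in A))%N%:R / N%:R)%:E : \bar R).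

(* Main.v *)
(* Suppose that (i) fails for some p and c, and put g = alpha - c p.  Then x g'(x) is bounded, so
   alpha = kappa P + g where P is an integer polynomial of degree at least 2 and g has bounded
   oscillation on [m, 8 m].  If a prime l divides a value of P', then P is not injective modulo
   l ^ 2, hence misses a residue class; combining many primes, P misses a long window of
   consecutive residues modulo some q.  For infinitely many scales m the value of g near m is
   roughly the same modulo kappa q, and for a suitable b the integers floor (kappa (b + q k)) lying
   at these scales form a set of positive upper density whose sums would force P into the missed
   window.

   Suppose that (i) holds.  Van der Corput's inequality (when a derivative of th alpha has a
   favourable size) and Weyl's method (when th alpha is close to a polynomial with an irrational
   coefficient) show that, uniformly for |th| <= T, the sums of e(th alpha(n)) over n < M and of
   e(th alpha(k / L)) / L over k < L M differ by at most eps M for M, and then L, large.  If A has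
   no solution, summing a Fejer kernel of width 1 / T at alpha(n) - 1/2 - x - x' over x, x' in
   A up to N and n < M, with alpha(M) about 2 N, gives only tails and a few diagonal terms,
   whereas the same sum with k / L in place of n sees every crossing of x + x' + 1/2 by alpha.
   By Parseval's identity the two sums are too close to each other for this to be possible. *)
Require Import Defs.
From mathcomp Require Import all_boot all_order all_algebra.
From mathcomp Require Import all_classical all_reals all_analysis.
From mathcomp Require Import complex ring lra zify.
Set Implicit Arguments.
Unset Strict Implicit.
Unset Printing Implicit Defensive.
Import Order.TTheory GRing.Theory Num.Theory.
Import numFieldTopology.Exports numFieldNormedType.Exports.
Import ComplexField.Normc.
Local Open Scope classical_set_scope.
Local Open Scope ring_scope.
Local Open Scope complex_scope.

(** * Exponential sums *)

(** The field [H] need not contain [x] or the real constants, while the argument needs eventual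
    signs of combinations such as [alpha x - c * p.[x]] or [x * alpha' x - alpha x]. Instead of
    enlarging [H], signs are proved for its whole span over the real polynomials, [hardy_poly]. The
    obstacle in (i) implies (ii) is that the sums of e(th alpha(n)) over n < M are not uniformly
    small for |th| <= T: when th is of order 1 / alpha(M), nothing oscillates. Smallness is
    therefore replaced by agreement with a sampling at step 1 / L, which plays the part of an
    integral; at small frequencies the two agree because th alpha hardly moves between consecutive
    integers. Equal elements x = x' are kept in the sum over pairs, since they give at most one
    large kernel value for each n. The contradiction comes from T: in units of L M Q^2 |s|, fine
    sampling sees at least a constant times T, integer sampling a bounded amount. In the converse,
    the missed window has to absorb the oscillation of g and the rounding of three integer parts;
    this fixes its length G. *)

Section ExpSums.
Variable R : realType.
Implicit Types (t x y : R) (z : R[i]).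

Lemma normcD_le z1 z2 : normc (z1 + z2) <= normc z1 + normc z2.
Proof. exact: le_normcD. Qed.

Lemma normc_opp z : normc (- z) = normc z.
Proof. exact: normcN. Qed.

Lemma normcB_le z1 z2 : normc (z1 - z2) <= normc z1 + normc z2.
Proof. by rewrite (le_trans (normcD_le _ _))// normc_opp. Qed.

Lemma normc_ge0 z : 0 <= normc z.
Proof. by case: z => a b /=; rewrite sqrtr_ge0. Qed.

Lemma normc_conj z : normc z^* = normc z.
Proof. by case: z => a b /=; rewrite sqrrN. Qed.

Lemma normc_sqr z : normc z ^+ 2 = complex.Re z ^+ 2 + complex.Im z ^+ 2.
Proof. by case: z => a b /=; rewrite sqr_sqrtr// addr_ge0 ?sqr_ge0. Qed.

Lemma normc_ge_ReIm z : `|complex.Re z| <= normc z /\ `|complex.Im z| <= normc z.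
Proof.
by split; rewrite -ler_sqr ?nnegrE ?normc_ge0// normc_sqr real_normK ?num_real//
  ?lerDl ?lerDr sqr_ge0.
Qed.

Lemma normc_le_ReIm z : normc z <= `|complex.Re z| + `|complex.Im z|.
Proof.
rewrite -ler_sqr ?nnegrE ?normc_ge0 ?addr_ge0// normc_sqr.
by rewrite sqrrD !real_normK ?num_real// -addrA lerD2l lerDr mulrn_wge0// mulr_ge0.
Qed.

Lemma normc_real t : normc t%:C = `|t|.
Proof. by rewrite /= expr0n addr0 sqrtr_sqr. Qed.

Lemma normc_sqrE z : (normc z ^+ 2)%:C = z * z^*.
Proof.
rewrite normc_sqr; case: z => a b; apply/eqP; rewrite eq_complex /=.
by apply/andP; split; apply/eqP; ring.
Qed.

Lemma normc_sum (I : Type) (r : seq I) (P : pred I) (F : I -> R[i]) :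
  normc (\sum_(i <- r | P i) F i) <= \sum_(i <- r | P i) normc (F i).
Proof.
elim/big_rec2: _ => [|i y1 y2 _ h]; first by rewrite normc0.
by rewrite (le_trans (normcD_le _ _))// lerD2l.
Qed.

Definition expi t : R[i] := cos (2 * pi * t) +i* sin (2 * pi * t).

Lemma expiD x y : expi (x + y) = expi x * expi y.
Proof.
apply/eqP; rewrite eq_complex /= !mulrDr cosD sinD.
by apply/andP; split; apply/eqP; ring.
Qed.

Lemma expiN x : expi (- x) = (expi x)^*.
Proof. by rewrite /expi mulrN cosN sinN. Qed.

Lemma expi0 : expi 0 = 1.
Proof. by rewrite /expi mulr0 cos0 sin0. Qed.

Lemma expiB x y : expi (x - y) = expi x * (expi y)^*.
Proof. by rewrite expiD expiN. Qed.

Lemma normc_expi x : normc (expi x) = 1.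
Proof. by rewrite /= cos2Dsin2 sqrtr1. Qed.

Lemma expi1 : expi 1 = 1.
Proof. by rewrite /expi mulr1 (mulr_natl pi 2) cos2pi sin2pi. Qed.

Lemma expi_nat (n : nat) : expi n%:R = 1.
Proof. by elim: n => [|n IH]; rewrite ?expi0// -natr1 expiD IH expi1 mulr1. Qed.

Lemma expi_int (m : int) : expi m%:~R = 1.
Proof.
case: m => n; first exact: expi_nat.
by rewrite NegzE mulrNz expiN -[_%:~R]/(n.+1%:R) expi_nat conjc1.
Qed.

Lemma expiD_int t (m : int) : expi (t + m%:~R) = expi t.
Proof. by rewrite expiD expi_int mulr1. Qed.

Lemma cos_lip x y : `|cos x - cos y| <= `|x - y|.
Proof.
wlog xy : x y / x <= y => [h|].
  by case: (leP x y) => [/h//|/ltW/h]; rewrite distrC [in leRHS]distrC.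
have [c _ E] := @MVT_segment R cos (fun x => - sin x) x y xy
  (fun x _ => is_derive_cos x) (continuous_subspaceT (@continuous_cos R)).
rewrite distrC E normrM normrN [in leRHS]distrC ler_piMl//.
by rewrite ler_norml sin_geN1 sin_le1.
Qed.

Lemma sin_lip x y : `|sin x - sin y| <= `|x - y|.
Proof.
wlog xy : x y / x <= y => [h|].
  by case: (leP x y) => [/h//|/ltW/h]; rewrite distrC [in leRHS]distrC.
have [c _ E] := @MVT_segment R sin (fun x => cos x) x y xy
  (fun x _ => is_derive_sin x) (continuous_subspaceT (@continuous_sin R)).
rewrite distrC E normrM [in leRHS]distrC ler_piMl//.
by rewrite ler_norml cos_geN1 cos_le1.
Qed.

Lemma expi_lip x y : normc (expi x - expi y) <= 4 * pi * `|x - y|.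
Proof.
rewrite (le_trans (normc_le_ReIm _))//=.
rewrite (le_trans (lerD (cos_lip _ _) (sin_lip _ _)))//.
rewrite -mulrBr normrM (@ger0_norm _ (2 * pi)) ?mulr_ge0 ?pi_ge0//.
by rewrite -mulrDl le_eqVlt; apply/orP; left; apply/eqP; ring.
Qed.

(** By the mean value theorem the imaginary part of [expi t] is [cos c * (2 * pi * t)], and [cos c]
    exceeds 1/2 near 0. The first bound keeps denominators of geometric sums away from 0; the second
    gives the Fejer kernel its large values near 0. *)
Lemma expi_small : exists2 t0 : R, 0 < t0 &
  forall t, `|t| <= t0 -> `|t| <= normc (expi t - 1) /\ 1 / 2 <= complex.Re (expi t).
Proof.
have half : 0 < (1 / 2 : R) by lra.
have : \forall x \near (0 : R), 1 / 2 < cos x.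
  have /cvgr_gt := @continuous_cos R 0; apply; rewrite cos0; lra.
case/nbhs_ballP => r /= r0 hr.
have pi0 := pi_gt0 R.
exists (r / 2 / (2 * pi)); first by rewrite !divr_gt0// mulr_gt0.
move=> t ht.
have ht2 : `|2 * pi * t| <= r / 2.
  rewrite normrM gtr0_norm ?mulr_gt0// mulrC -ler_pdivlMr ?mulr_gt0//.
have cosge y : `|y| <= r / 2 -> 1 / 2 < cos y.
  move=> hy; apply: hr; rewrite /ball /= sub0r normrN; lra.
split; last by rewrite /= ltW// cosge.
have [_] := normc_ge_ReIm (expi t - 1); apply: le_trans.
rewrite /= subr0.
wlog t0 : t ht ht2 / 0 <= t => [h|].
  case: (leP 0 t) => [/h|t0]; first exact.
  have := h (- t); rewrite mulrN sinN !normrN; apply => //.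
  by rewrite oppr_ge0 ltW.
have le0 : 0 <= 2 * pi * t by rewrite !mulr_ge0// ltW.
have [c + E] := @MVT_segment R sin (fun x => cos x) 0 (2 * pi * t) le0
  (fun x _ => is_derive_sin x) (continuous_subspaceT (@continuous_sin R)).
rewrite in_itv /= => /andP[c0 ct].
move: E; rewrite sin0 !subr0 => ->.
have cc : 1 / 2 < cos c.
  apply: cosge; rewrite ger0_norm// (le_trans ct)//.
  by rewrite (le_trans (ler_norm _))//.
have cc0 : 0 <= cos c by lra.
rewrite ger0_norm// ger0_norm ?mulr_ge0 ?(ltW pi0)//.
have p2 : 2 <= (pi : R) by exact: pi_ge2.
have : t <= pi * t by rewrite ler_peMl//; lra.
have : pi * t <= cos c * (2 * pi * t).
  have -> : pi * t = (1/2) * (2 * pi * t) by field.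
  by rewrite ler_wpM2r//; lra.
lra.
Qed.

Lemma expi_eq1 t : expi t = 1 -> exists m : int, t = m%:~R.
Proof.
move=> h.
have [E|] := eqVneq t (Num.floor t)%:~R; first by exists (Num.floor t).
move=> nE; exfalso.
pose s := t - (Num.floor t)%:~R.
have es : expi s = 1.
  by have := expiD_int s (Num.floor t); rewrite /s subrK h => <-.
have /andP[fl fg] := floor_itv t.
have s0 : 0 < s by rewrite subr_gt0 lt_neqAle eq_sym nE.
have s1 : s < 1 by move: fg; rewrite intrD ltrBlDl addrC.
have : 0 < sin (pi * s).
  apply: sin_gt0_pi; rewrite mulr_gt0 ?pi_gt0//= -[ltRHS]mulr1 ltr_pM2l ?pi_gt0//.
move=> sp.
have : cos (2 * pi * s) = 1 by case: es.
rewrite -mulrA mulr_natl cos_mulr2n.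
have := cos2Dsin2 (pi * s); have : 0 < sin (pi * s) ^+ 2 by rewrite exprn_gt0.
lra.
Qed.

Lemma sqr_sum_le (n : nat) (x : nat -> R) :
  (\sum_(0 <= i < n) x i) ^+ 2 <= n%:R * \sum_(0 <= i < n) x i ^+ 2.
Proof.
elim: n => [|n IH]; first by rewrite !big_geq// expr0n mul0r.
rewrite !big_nat_recr//=; set S := \sum_(_ <= _ < _) _ in IH *.
set Q := \sum_(_ <= _ < _) _ in IH *.
have Q0 : 0 <= Q by rewrite sumr_ge0// => i _; rewrite sqr_ge0.
have [n0|n0] := posnP n.
  by rewrite /Q /S n0 !big_geq// mul1r !add0r.
have n0' : 0 < n%:R :> R by rewrite ltr0n.
rewrite -natr1; have h := sqr_ge0 (S - n%:R * x n).
have {}h : 2 * n%:R * S * x n <= n%:R * Q + n%:R ^+ 2 * x n ^+ 2 by nra.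
have : 2 * S * x n <= Q + n%:R * x n ^+ 2.
  by rewrite -(ler_pM2l n0'); lra.
lra.
Qed.

(** A lag [k >= 1] is the distance from [h] to at most two indices, one on each side. *)
Lemma sum_absdiff_le (F : nat -> R) (H h : nat) : (forall k, 0 <= F k) -> (h < H)%N ->
  \sum_(0 <= i < H) F `|(h%:Z - i%:Z)|%N <= F 0%N + 2 * \sum_(1 <= k < H) F k.
Proof.
move=> F0 hH.
rewrite (@big_cat_nat _ _ _ h.+1)//= big_nat_recr//= subrr.
have E1 : \sum_(0 <= i < h) F `|(h%:Z - i%:Z)|%N = \sum_(1 <= k < h.+1) F k.
  rewrite big_nat_rev /= add0n big_add1 /=; apply: eq_big_nat => i /andP[_ ih].
  by congr F; lia.
have E2 : \sum_(h.+1 <= i < H) F `|(h%:Z - i%:Z)|%N = \sum_(1 <= k < H - h) F k.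
  rewrite -{1}(add0n h.+1) big_addn big_add1 /= subnS; apply: eq_big_nat => i /andP[_ ih].
  by congr F; lia.
have mono n : (n <= H)%N -> \sum_(1 <= k < n) F k <= \sum_(1 <= k < H) F k.
  move=> nH; have [n1|n1] := leqP 1 n.
    by rewrite [leRHS](@big_cat_nat _ _ _ n)//= lerDl sumr_ge0.
  by rewrite big_geq// 1?ltnW// sumr_ge0.
rewrite E1 E2; have := mono h.+1 hH; have := mono (H - h)%N (leq_subr _ _); lra.
Qed.

Lemma normc_sqr_sumE (n : nat) (a : nat -> R[i]) :
  (normc (\sum_(0 <= h < n) a h) ^+ 2)%:C =
  \sum_(0 <= h < n) \sum_(0 <= k < n) a h * (a k)^*.
Proof.
rewrite normc_sqrE rmorph_sum /= mulr_suml; apply: eq_bigr => h _.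
by rewrite mulr_sumr.
Qed.

(** The sum is averaged over [H] shifts of [u], Cauchy-Schwarz is applied over the [N + H]
    positions, and the opened square contains only correlations of [u], which depend on the
    difference of two shifts. The factor 2 comes from [N + H <= 2 * N]. *)
Lemma vdC_inequality (N H : nat) (u : nat -> R[i]) :
  (0 < H)%N -> (H <= N)%N -> (forall n, normc (u n) <= 1) ->
  normc (\sum_(0 <= n < N) u n) ^+ 2 <=
  2 * N%:R / H%:R *
    (N%:R + 2 * \sum_(1 <= h < H) normc (\sum_(0 <= n < N - h) u (n + h)%N * (u n)^*)).
Proof.
move=> H0 HN u1.
(* Padding by 0 gives all shifts the common range [[0, N + H)], so that the sums over positions and
   over shifts can be exchanged. *)
pose v m h : R[i] := if (h <= m < N + h)%N then u (m - h)%N else 0.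
pose G k := normc (\sum_(0 <= n < N - k) u (n + k)%N * (u n)^*).
have S1 h : (h < H)%N ->
    \sum_(0 <= m < N + H) v m h = \sum_(0 <= n < N) u n.
  move=> hH; rewrite (@big_cat_nat _ _ _ h)//=; last lia.
  rewrite big1_seq ?add0r; last first.
    by move=> m; rewrite mem_index_iota /v => /andP[_ ?]; rewrite ifF//; lia.
  rewrite (@big_cat_nat _ _ _ (N + h))//=; [|lia|lia].
  rewrite [X in _ + X]big1_seq ?addr0; last first.
    by move=> m; rewrite mem_index_iota /v => /andP[_ ?]; rewrite ifF//; lia.
  rewrite -{1}(add0n h) big_addn addnK; apply: eq_big_nat => i iN.
  by rewrite /v ifT ?addnK//; lia.
have S2 h k : (h <= k)%N -> (k < H)%N ->
    \sum_(0 <= m < N + H) v m h * (v m k)^* =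
    \sum_(0 <= n < N - (k - h)) u (n + (k - h))%N * (u n)^*.
  move=> hk kH; rewrite (@big_cat_nat _ _ _ k)//=; last lia.
  rewrite big1_seq ?add0r; last first.
    move=> m; rewrite mem_index_iota /v => /andP[_ ?].
    by rewrite [X in _ * X^*]ifF ?rmorph0 ?mulr0//; lia.
  have [le|lt] := leqP k (N + h); last first.
    rewrite big1_seq.
      by rewrite big_geq//; lia.
    move=> m; rewrite mem_index_iota /v => /andP[_ ?].
    by rewrite ifF ?mul0r//; lia.
  rewrite (@big_cat_nat _ _ _ (N + h))//=; last lia.
  rewrite [X in _ + X]big1_seq ?addr0; last first.
    by move=> m; rewrite mem_index_iota /v => /andP[_ ?]; rewrite ifF ?mul0r//; lia.
  rewrite -{1}(add0n k) big_addn.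
  have -> : (N + h - k = N - (k - h))%N by lia.
  apply: eq_big_nat => i iN.
  by rewrite /v !ifT; [congr (u _ * (u _)^*)| |]; lia.
have S2n h k : (h < H)%N -> (k < H)%N ->
    normc (\sum_(0 <= m < N + H) v m h * (v m k)^*) = G `|(h%:Z - k%:Z)|%N.
  move=> hH kH; have [hk|/ltnW kh] := leqP h k.
    by rewrite S2// /G; have -> : `|(h%:Z - k%:Z)|%N = (k - h)%N by lia.
  rewrite -normc_conj rmorph_sum /=.
  under eq_bigr do rewrite rmorphM /= conjcK mulrC.
  by rewrite S2// /G; have -> : `|(h%:Z - k%:Z)|%N = (h - k)%N by lia.
have H0' : 0 < H%:R :> R by rewrite ltr0n.
have G0 : G 0%N <= N%:R.
  rewrite /G subn0 (le_trans (normc_sum _ _ _))//.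
  apply: (@le_trans _ _ (\sum_(0 <= n < N) 1)); last by rewrite sumr_const_nat subn0.
  apply: ler_sum => i _.
  by rewrite normcM normc_conj mulr_ile1// ?normc_ge0.
set S := \sum_(0 <= n < N) u n.
have SH : (H%:R * normc S) ^+ 2 <=
   (N + H)%:R * \sum_(0 <= m < N + H) normc (\sum_(0 <= h < H) v m h) ^+ 2.
  apply: le_trans (sqr_sum_le _ _).
  rewrite ler_sqr ?nnegrE ?mulr_ge0 ?normc_ge0 ?sumr_ge0//; last first.
    by move=> *; exact: normc_ge0.
  apply: le_trans (normc_sum _ _ _).
  rewrite exchange_big_nat /=.
  have -> : \sum_(0 <= j < H) \sum_(0 <= i < N + H) v i j = H%:R%:C * S.
    rewrite (eq_big_nat _ _ (F2 := fun=> S)); last by move=> j /andP[_ jH]; rewrite S1.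
    by rewrite sumr_const_nat subn0 rmorph_nat mulr_natl.
  by rewrite normcM normc_real ger0_norm// ltW.
have SQ : \sum_(0 <= m < N + H) normc (\sum_(0 <= h < H) v m h) ^+ 2 <=
    H%:R * (G 0%N + 2 * \sum_(1 <= h < H) G h).
  rewrite (_ : \sum_(0 <= m < N + H) _ = normc (\sum_(0 <= h < H)
     \sum_(0 <= k < H) \sum_(0 <= m < N + H) v m h * (v m k)^*)); last first.
    rewrite -[LHS]ger0_norm; last by rewrite sumr_ge0// => *; rewrite sqr_ge0.
    rewrite -normc_real rmorph_sum /=; congr normc.
    under eq_bigr do rewrite normc_sqr_sumE.
    rewrite exchange_big_nat /=; apply: eq_bigr => h _.
    by rewrite exchange_big_nat.
  rewrite (le_trans (normc_sum _ _ _))//.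
  have -> : H%:R * (G 0%N + 2 * \sum_(1 <= h < H) G h) =
      \sum_(0 <= h < H) (G 0%N + 2 * \sum_(1 <= h < H) G h).
    by rewrite sumr_const_nat subn0 mulr_natl.
  apply: ler_sum_nat => h /andP[_ hH].
  rewrite (le_trans (normc_sum _ _ _))//.
  apply: le_trans (sum_absdiff_le _ hH); last by move=> k; exact: normc_ge0.
  apply: ler_sum_nat => k /andP[_ kH].
  by rewrite S2n.
set B := \sum_(1 <= h < H) _.
have B0 : 0 <= B by rewrite /B sumr_ge0// => h _; exact: normc_ge0.
have NH : (N + H)%:R <= 2 * N%:R :> R by rewrite -natrM ler_nat; lia.
rewrite -(@ler_pM2l _ (H%:R ^+ 2)) ?exprn_gt0// -exprMn.
apply: (le_trans SH).
apply: (@le_trans _ _ (2 * N%:R * (H%:R * (N%:R + 2 * B)))).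
  apply: ler_pM => //; first by rewrite sumr_ge0// => m _; rewrite sqr_ge0.
  by apply: (le_trans SQ); rewrite ler_pM2l// lerD2r.
by rewrite le_eqVlt; apply/orP; left; apply/eqP; field; rewrite gt_eqF.
Qed.

End ExpSums.

(** * Finite differences and a Kusmin-Landau estimate *)

Section Differences.
Variable R : realType.
Implicit Types (g : nat -> R) (A lam rho ep : R).

(** Blocks of length [P] are removed from the right end until fewer than [P] terms are left; these
    are counted trivially. *)
Lemma block_sum_le (N P : nat) ep (u : nat -> R[i]) :
  (0 < P)%N -> 0 <= ep -> (forall n, normc (u n) <= 1) ->
  (forall n0, (n0 + P <= N)%N -> normc (\sum_(0 <= n < P) u (n0 + n)%N) <= ep * P%:R) ->
  normc (\sum_(0 <= n < N) u n) <= ep * N%:R + P%:R.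
Proof.
move=> P0 ep0 u1; elim/ltn_ind: N => N IH h.
have triv n : normc (\sum_(0 <= i < n) u i) <= n%:R.
  rewrite (le_trans (normc_sum _ _ _))//.
  apply: (@le_trans _ _ (\sum_(0 <= i < n) 1)); last by rewrite sumr_const_nat subn0.
  exact: ler_sum.
have [NP|PN] := ltnP N P.
  by rewrite (le_trans (triv _))// ler_wpDl// ?mulr_ge0// ler_nat ltnW.
rewrite (@big_cat_nat _ _ _ (N - P))//= ?leq_subr//.
rewrite (le_trans (normcD_le _ _))//.
have h1 : normc (\sum_(0 <= i < N - P) u i) <= ep * (N - P)%:R + P%:R.
  by apply: IH => [|n0 hn0]; [lia|apply: h; lia].
have h2 : normc (\sum_(N - P <= i < N) u i) <= ep * P%:R.
  have := h (N - P)%N; rewrite subnK// leqnn => /(_ isT).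
  rewrite -{2}(add0n (N - P)%N) big_addn subKn//.
  by under [in X in _ -> X]eq_bigr do rewrite addnC.
by move: h1; rewrite natrB// mulrBr; lra.
Qed.

Definition dif g (n : nat) : R := g n.+1 - g n.

Lemma iter_dif_shift k g m : iter k dif (fun n => g (m + n)%N) = fun n => iter k dif g (m + n)%N.
Proof. by elim: k => //= k ->; apply/funext => n; rewrite /dif addnS. Qed.

Lemma iter_dif_sub k g h :
  iter k dif (fun n => g (n + h)%N - g n) = fun n => iter k dif g (n + h)%N - iter k dif g n.
Proof. by elim: k => //= k ->; apply/funext => n; rewrite /dif addSn; ring. Qed.

(** Differencing at lag [h] trades one order of difference for a sum of [h] terms; this is how Van
    der Corput's inequality lowers the order in both families of tests below. *)
Lemma iter_dif_sub_sum k g h n :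
  iter k dif (fun n => g (n + h)%N - g n) n = \sum_(0 <= i < h) iter k.+1 dif g (n + i)%N.
Proof.
rewrite iter_dif_sub -[X in _ - iter _ _ _ X]addn0.
rewrite -(telescope_sumr (fun i => iter k dif g (n + i)%N))//.
by apply: eq_bigr => i _; rewrite /= /dif addnS.
Qed.

Lemma abel_sum (N : nat) (u c : nat -> R[i]) :
  (forall n, (n <= N)%N -> u n = (u n.+1 - u n) * c n) ->
  \sum_(0 <= n < N.+1) u n =
  u N.+1 * c N - u 0%N * c 0%N - \sum_(0 <= n < N) u n.+1 * (c n.+1 - c n).
Proof.
elim: N => [|N IH] h.
  by rewrite big_nat1 [in RHS]big_geq// subr0 -mulrBl; exact: h.
rewrite big_nat_recr//= IH; last by move=> n ?; apply: h; lia.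
rewrite [in RHS]big_nat_recr//= [X in _ + X = _](h N.+1)//; ring.
Qed.

(** With [c n] the inverse of [expi (dif g n) - 1], the sum telescopes up to the variation of [c].
    Here [|c| <= 1 / lam], and the variation of [c] is at most [4 * pi * A / lam]. The bound on
    second differences takes the place of the usual monotonicity of the first ones. *)
Lemma slow_exp_sum : exists2 t0 : R, 0 < t0 &
  forall A lam (N : nat) g, 0 <= A -> 0 < lam -> A * lam <= t0 ->
  (forall n, (n < N)%N -> lam <= dif g n <= A * lam) ->
  \sum_(0 <= n < N) `|dif (dif g) n| <= A * lam ->
  normc (\sum_(0 <= n < N) expi (g n)) <= (2 + 4 * pi * A) / lam.
Proof.
have [t0 t00 ht0] := expi_small R; exists t0 => // A lam N g A0 lam0 Alam hd hdd.
have pi0 := pi_gt0 R.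
have C0 : 0 <= (2 + 4 * pi * A) / lam.
  by rewrite divr_ge0 ?addr_ge0 ?mulr_ge0// ltW.
case: N hd hdd => [|N] hd hdd; first by rewrite big_geq// normc0.
pose c n := (expi (dif g n) - 1)^-1.
have ge n : (n <= N)%N -> lam <= normc (expi (dif g n) - 1).
  move=> nN; have /andP[d1 d2] := hd n nN.
  have d0 : 0 <= dif g n by lra.
  have [] := ht0 (dif g n); last by rewrite ger0_norm//; lra.
  by rewrite ger0_norm//; lra.
have nz n : (n <= N)%N -> expi (dif g n) - 1 != 0.
  by move=> /ge; apply: contraTneq => ->; rewrite normc0 -ltNge.
have cle n : (n <= N)%N -> normc (c n) <= lam^-1.
  move=> nN; rewrite /c normcV lef_pV2 ?posrE//; first exact: ge.
  exact: lt_le_trans (ge _ nN).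
rewrite (@abel_sum N (fun n => expi (g n)) c); last first.
  move=> n nN; rewrite /c; have := nz n nN.
  have -> : expi (g n.+1) = expi (dif g n) * expi (g n) by rewrite -expiD /dif subrK.
  by move=> ?; rewrite -[X in _ - X]mul1r -mulrBl mulrAC mulfV// mul1r.
have b1 : normc (expi (g N.+1) * c N) <= lam^-1 by rewrite normcM normc_expi mul1r cle.
have b2 : normc (expi (g 0%N) * c 0%N) <= lam^-1 by rewrite normcM normc_expi mul1r cle.
have b3 : normc (\sum_(0 <= n < N) expi (g n.+1) * (c n.+1 - c n)) <= 4 * pi * A / lam.
  rewrite (le_trans (normc_sum _ _ _))//.
  apply: (@le_trans _ _ (\sum_(0 <= n < N) 4 * pi / lam ^+ 2 * `|dif (dif g) n|)).
    apply: ler_sum_nat => n /andP[_ nN].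
    rewrite normcM normc_expi mul1r.
    have nz1 := nz n.+1 nN; have nz0 := nz n (ltnW nN).
    have -> : c n.+1 - c n = (expi (dif g n) - expi (dif g n.+1)) * (c n.+1 * c n).
      by rewrite /c; field; rewrite nz0 nz1.
    rewrite normcM mulrAC ler_pM ?normc_ge0//.
      by rewrite (le_trans (expi_lip _ _))// distrC.
    by rewrite normcM expr2 invfM ler_pM ?normc_ge0// cle// ltnW.
  rewrite -mulr_sumr.
  apply: (@le_trans _ _ (4 * pi / lam ^+ 2 * (A * lam))).
    rewrite ler_wpM2l//; first by rewrite divr_ge0 ?mulr_ge0 ?exprn_ge0// ltW.
    by rewrite (le_trans _ hdd)// [leRHS]big_nat_recr//= lerDl.
  by rewrite le_eqVlt; apply/orP; left; apply/eqP; field; rewrite gt_eqF.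
apply: le_trans (normcB_le _ _) _.
have := normcB_le (expi (g N.+1) * c N) (expi (g 0%N) * c 0%N).
by rewrite mulrDl; lra.
Qed.

End Differences.

(** * Van der Corput's derivative tests *)

Section VanDerCorput.
Variable R : realType.
Implicit Types (g : nat -> R) (A lam rho ep : R).

Lemma normc_sum_expi_le g (N : nat) : normc (\sum_(0 <= n < N) expi (g n)) <= N%:R.
Proof.
rewrite (le_trans (normc_sum _ _ _))//.
apply: (@le_trans _ _ (\sum_(0 <= i < N) 1)); last by rewrite sumr_const_nat subn0.
by apply: ler_sum => i _; rewrite normc_expi.
Qed.

Lemma sum_window_le (F : nat -> R) (a b N : nat) : (forall n, 0 <= F n) -> (a + b <= N)%N ->
  \sum_(0 <= n < b) F (a + n)%N <= \sum_(0 <= n < N) F n.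
Proof.
move=> F0 abN; rewrite [leRHS](@big_cat_nat _ _ _ a)//=; last lia.
rewrite [X in _ + X](@big_cat_nat _ _ _ (a + b))//=; [|lia].
rewrite (_ : \sum_(a <= i < a + b) F i = \sum_(0 <= n < b) F (a + n)%N); last first.
  by rewrite -{1}[a]add0n big_addn addKn; apply: eq_bigr => i _; rewrite addnC.
have : 0 <= \sum_(0 <= i < a) F i by rewrite sumr_ge0.
have : 0 <= \sum_(a + b <= i < N) F i by rewrite sumr_ge0.
lra.
Qed.

Lemma sum_indic_le (c : R) (h0 P : nat) : 0 <= c ->
  \sum_(0 <= i < P) (if (i < h0)%N then c else 0) <= h0%:R * c.
Proof.
move=> c0; elim: P => [|P IH]; first by rewrite big_geq// mulr_ge0.
have [hP|Ph] := leqP h0 P; first by rewrite big_nat_recr//= ltnNge hP /= addr0.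
apply: (@le_trans _ _ (\sum_(0 <= i < P.+1) c)).
  by apply: ler_sum => i _; case: ifP.
by rewrite sumr_const_nat subn0 -[leLHS]mulr_natl ler_wpM2r// ler_nat.
Qed.

(** The test for derivatives of order [k.+1], without an explicit rate: the difference of that order
    is small, while [lam * N%:R ^+ k.+1], the oscillation it causes over the whole range, is large.
    [rho] depends on [ep] and [A] only, and a bound on the variation replaces monotonicity. *)
Definition deriv_test (k : nat) := forall ep A, 0 < ep -> 1 <= A ->
  exists2 rho, 0 < rho & forall lam (N : nat) g, 0 < lam -> lam <= rho ->
  1 <= rho * (lam * N%:R ^+ k.+1) ->
  (forall n, (n < N)%N -> lam <= iter k.+1 (@dif R) g n <= A * lam) ->
  \sum_(0 <= n < N) `|iter k.+2 (@dif R) g n| <= A * lam ->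
  normc (\sum_(0 <= n < N) expi (g n)) <= ep * N%:R.

Lemma deriv_test0 : deriv_test 0.
Proof.
move=> ep A ep0 A1; have [t0 t00 ht0] := slow_exp_sum R.
have A0 : 0 < A by lra.
have C0 : 0 < 2 + 4 * pi * A :> R by rewrite addr_gt0// !mulr_gt0// pi_gt0.
exists (Num.min (t0 / A) (ep / (2 + 4 * pi * A))) => [|lam N g lam0].
  by rewrite lt_min !divr_gt0.
set rho := Num.min _ _; rewrite expr1 => lrho hN hd hdd.
have r1 : rho <= t0 / A by rewrite ge_min lexx.
have r2 : rho <= ep / (2 + 4 * pi * A) by rewrite ge_min lexx orbT.
have := ht0 A lam N g (ltW A0) lam0.
move=> /(_ _ hd hdd) H; apply: le_trans (H _) _.
  by rewrite mulrC -ler_pdivlMr//; lra.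
rewrite ler_pdivrMr//.
have lN0 : 0 <= lam * N%:R by rewrite mulr_ge0// ltW.
have : rho * (lam * N%:R) * (2 + 4 * pi * A) <= ep * (lam * N%:R).
  by rewrite mulrAC ler_wpM2r// -ler_pdivlMr.
have : (2 + 4 * pi * A) <= rho * (lam * N%:R) * (2 + 4 * pi * A).
  by rewrite ler_peMl// ltW.
lra.
Qed.

(** Van der Corput's inequality is applied on blocks of length [P] with all lags below [P]. At lag
    [h] the differenced phase satisfies the test of lower order with [h%:R * lam] in place of [lam].
    Lags below [e1 * P], and lags leaving at most [e1 * P] terms, are counted trivially. *)
Lemma deriv_testS k : deriv_test k -> deriv_test k.+1.
Proof.
move=> IH ep0 A ep00 A1.
pose ep := Num.min ep0 1.
have ep_gt0 : 0 < ep by rewrite lt_min ep00 ltr01.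
have ep_le : ep <= ep0 by rewrite ge_min lexx.
have ep_le1 : ep <= 1 by rewrite ge_min lexx orbT.
have [e1 [e10 e1E]] : exists e1, 0 < e1 /\ e1 = ep ^+ 2 / 64.
  by exists (ep ^+ 2 / 64); rewrite divr_gt0 ?exprn_gt0.
have [rho1 rho10 hrho1] := IH e1 A e10 A1.
pose W : R := Num.max 2 (96 / ep ^+ 2).
have W2 : 2 <= W by rewrite le_max lexx.
have W96 : 96 / ep ^+ 2 <= W by rewrite le_max lexx orbT.
pose V := 4 * W / ep.
have V1 : 1 <= V by rewrite ler_pdivlMr//; lra.
have [eta [eta0 eta_rho eta_ep]] : exists eta : R,
    [/\ 0 < eta, eta <= rho1 / 2 & eta <= ep / 4 / 2].
  exists (Num.min (rho1 / 2) (ep / 4 / 2)).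
  by rewrite lt_min !ge_min !lexx orbT !divr_gt0.
pose r1 : R := (1 / 2).
pose r2 := rho1 / W.
pose r3 := 1 / (2 * V ^+ k.+2).
pose r4 := rho1 * (e1 * eta) ^+ k.+2.
have Vk : 1 <= V ^+ k.+2 by rewrite exprn_ege1.
pose rho := Num.min (Num.min r1 r2) (Num.min r3 r4).
have rho_gt0 : 0 < rho.
  have W0 : 0 < W by lra.
  have V0 : 0 < V by lra.
  have h1 : 0 < r1 by rewrite /r1; lra.
  have h2 : 0 < r2 by rewrite divr_gt0.
  have h3 : 0 < r3 by rewrite divr_gt0// mulr_gt0// exprn_gt0.
  have h4 : 0 < r4 by apply: mulr_gt0 => //; apply: exprn_gt0; exact: mulr_gt0.
  by rewrite !lt_min h1 h2 h3 h4.
have l1 : rho <= 1 / 2 by rewrite !ge_min lexx.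
have l2 : rho <= rho1 / W by rewrite !ge_min lexx !orbT.
have l3 : rho <= r3 by rewrite !ge_min lexx !orbT.
have l4 : rho <= r4 by rewrite !ge_min lexx !orbT.
exists rho => // lam N g lam0 lrho hN hd hdd.
have rlam0 : 0 < rho * lam by rewrite mulr_gt0.
have lam_ge0 := ltW lam0.
have eta_ge0 := ltW eta0.
have NV : V <= N%:R.
  rewrite leNgt; apply/negP => NV.
  have : N%:R ^+ k.+2 <= V ^+ k.+2 by rewrite ler_pXn2r ?nnegrE//; clear -NV V1; lra.
  have l3' : rho * V ^+ k.+2 <= 1 / 2.
    rewrite -ler_pdivlMr; last by rewrite (lt_le_trans ltr01).
    by rewrite (le_trans l3)// /r3 le_eqVlt; apply/orP; left; apply/eqP; field; rewrite gt_eqF// (lt_le_trans ltr01).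
  move: l3' hN; set X := V ^+ _; set Y := N%:R ^+ _ => l3' hN YX.
  have : rho * (lam * Y) <= lam * (1 / 2).
    rewrite mulrCA ler_pM2l//; apply: le_trans l3'; rewrite ler_pM2l//.
  by clear -hN lrho l1; lra.
(* A block must be so short that every lag [h < P] keeps [h * lam <= rho1], and it must be a small
   fraction of the range, so that the leftover block is negligible. *)
pose x := Num.min (rho1 / lam) (ep * N%:R / 4).
have xW : W <= x.
  rewrite le_min; apply/andP; split.
    rewrite ler_pdivlMr// mulrC -ler_pdivlMr//; clear -W2 lrho l2; lra.
  by move: NV; rewrite /V ler_pdivrMr//; clear; lra.
have x0 : 0 <= x by rewrite (le_trans _ xW)// (le_trans _ W2).
pose P := Num.truncn x.
have /andP[P1 P2] := truncn_itv x0.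
rewrite -/P in P1 P2; rewrite -natr1 in P2.
have Pgt : x / 2 <= P%:R by clear -P1 P2 xW W2; lra.
have P0 : (0 < P)%N by rewrite -(ltr_nat R); clear -Pgt xW W2; lra.
have P0' : 0 < P%:R :> R by rewrite ltr0n.
have P48 : 48 / ep ^+ 2 <= P%:R.
  have -> : 48 / ep ^+ 2 = (96 / ep ^+ 2) / 2 by field; rewrite gt_eqF.
  by clear -W96 xW Pgt; lra.
have Prho : P%:R * lam <= rho1.
  by rewrite -ler_pdivlMr// (le_trans P1)// ge_min lexx.
have PN : P%:R <= ep * N%:R / 4 by rewrite (le_trans P1)// ge_min lexx orbT.
(* According to which bound determines [P], it is at least [eta / lam] or [eta * N]. The first case
   rests on [lam <= rho], the second on the hypothesis about [N]. *)
have lamP : (e1 * eta) ^+ k.+2 / rho <= lam * (e1 * P%:R) ^+ k.+2.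
  suff le : eta ^+ k.+2 <= lam * (P%:R ^+ k.+2 * rho).
    rewrite ler_pdivrMr// [(e1 * eta) ^+ _]exprMn [(e1 * P%:R) ^+ _]exprMn.
    have : 0 < e1 ^+ k.+2 by rewrite exprn_gt0.
    move: le; set a := e1 ^+ _; set b := eta ^+ _; set c := P%:R ^+ _ => le a0.
    rewrite (_ : lam * (a * c) * rho = a * (lam * (c * rho))); last by ring.
    by rewrite ler_pM2l.
  have [le|le] := leP (rho1 / lam) (ep * N%:R / 4).
    have Pe : eta / lam <= P%:R.
      apply: le_trans Pgt; rewrite /x min_l// mulrAC ler_pM2r ?invr_gt0//.
    apply: (@le_trans _ _ (lam * ((eta / lam) ^+ k.+2 * rho))); last first.
      by rewrite ler_pM2l// ler_pM2r//; apply: lerXn2r; rewrite ?nnegrE ?divr_ge0//.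
    have -> : lam * ((eta / lam) ^+ k.+2 * rho) = eta ^+ k.+2 * (rho / lam * (lam^-1) ^+ k).
      by rewrite !exprS exprMn; field; rewrite gt_eqF.
    have i1 : 1 <= rho / lam by rewrite ler_pdivlMr// mul1r.
    have i2 : 1 <= lam^-1 by rewrite invf_ge1// (le_trans lrho)// (le_trans l1)//; clear; lra.
    by rewrite ler_peMr ?exprn_ge0// mulr_ege1// exprn_ege1.
  have Pe : eta * N%:R <= P%:R.
    apply: le_trans Pgt; rewrite /x min_r; last exact: ltW.
    rewrite (_ : ep * N%:R / 4 / 2 = ep / 4 / 2 * N%:R); last by field.
    by rewrite ler_wpM2r.
  apply: (@le_trans _ _ (lam * ((eta * N%:R) ^+ k.+2 * rho))); last first.
    by rewrite ler_pM2l// ler_pM2r//; apply: lerXn2r; rewrite ?nnegrE ?mulr_ge0//.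
  rewrite exprMn; move: hN; set n' := N%:R ^+ _ => hN.
  have -> : lam * (eta ^+ k.+2 * n' * rho) = eta ^+ k.+2 * (rho * (lam * n')).
    by ring.
  by rewrite ler_peMr ?exprn_ge0.
have key : 1 <= rho1 * (lam * (e1 * P%:R) ^+ k.+2).
  rewrite -ler_pdivrMl// mulr1; apply: le_trans lamP.
  rewrite ler_pdivlMr// mulrC ler_pdivrMr// mulrC; exact: l4.
have block n0 : (n0 + P <= N)%N ->
    normc (\sum_(0 <= n < P) expi (g (n0 + n)%N)) <= ep / 2 * P%:R.
  move=> n0P; pose f n := g (n0 + n)%N.
  change (normc (\sum_(0 <= n < P) expi (f n)) <= ep / 2 * P%:R).
  have gam h : (0 < h < P)%N ->
     normc (\sum_(0 <= n < P - h) expi (f (n + h)%N) * (expi (f n))^*) <=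
       (if (h%:R < e1 * P%:R) then P%:R else e1 * P%:R).
    move=> /andP[h0 hP].
    under eq_bigr do rewrite -expiB.
    have triv : normc (\sum_(0 <= n < P - h) expi (f (n + h)%N - f n)) <= (P - h)%:R.
      exact: (normc_sum_expi_le (fun n => f (n + h)%N - f n)).
    case: ifPn => [hc|]; first by rewrite (le_trans triv)// ler_nat leq_subr.
    rewrite -leNgt => hc.
    case: (boolP ((P - h)%:R <= e1 * P%:R)) => [hc2|]; first exact: le_trans triv _.
    rewrite -ltNge => hc2.
    have h0' : 0 < h%:R :> R by rewrite ltr0n.
    have hr1 : h%:R <= P%:R :> R by rewrite ler_nat ltnW.
    apply: (@le_trans _ _ (e1 * (P - h)%:R)); last first.
      by rewrite ler_pM2l// ler_nat leq_subr.
    apply: (hrho1 (h%:R * lam) (P - h)%N (fun n => f (n + h)%N - f n)).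
    - by rewrite mulr_gt0.
    - by apply: le_trans Prho; rewrite ler_pM2r.
    - apply: (le_trans key); rewrite ler_pM2l// exprS.
      have -> : lam * (e1 * P%:R * (e1 * P%:R) ^+ k.+1) = (e1 * P%:R) * lam * (e1 * P%:R) ^+ k.+1.
        by ring.
      have eP : 0 <= e1 * P%:R by rewrite mulr_ge0// ltW.
      apply: ler_pM; rewrite ?mulr_ge0 ?exprn_ge0 ?(ltW lam0) ?(ltW e10)//.
        by rewrite ler_pM2r.
      by rewrite ler_pXn2r ?nnegrE// ltW.
    - move=> n nP; rewrite iter_dif_sub_sum.
      have hi i : (0 <= i < h)%N -> lam <= iter k.+2 (@dif R) f (n + i) <= A * lam.
        move=> ih.
        have -> : iter k.+2 (@dif R) f (n + i)%N = iter k.+2 (@dif R) g (n0 + (n + i))%N.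
          by rewrite /f iter_dif_shift.
        apply: hd.
        by clear -ih nP n0P; lia.
      have c (a : R) : \sum_(0 <= i < h) a = h%:R * a.
        by rewrite sumr_const_nat subn0 mulr_natl.
      apply/andP; split.
        rewrite -c; apply: ler_sum_nat => i /hi/andP[]//.
      rewrite mulrCA -c; apply: ler_sum_nat => i /hi/andP[]//.
    - have E n : `|iter k.+2 (@dif R) (fun n => f (n + h)%N - f n) n| <=
          \sum_(0 <= i < h) `|iter k.+3 (@dif R) f (n + i)|.
        by rewrite iter_dif_sub_sum; exact: ler_norm_sum.
      rewrite (le_trans (ler_sum _ (fun n _ => E n)))//.
      rewrite exchange_big_nat /= mulrCA mulr_natl -[h in leRHS](subn0 h) -sumr_const_nat.
      apply: ler_sum_nat => i /andP[_ ih].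
      apply: le_trans hdd; rewrite /f.
      under eq_bigr => n _ do rewrite -/(iter k.+3 (@dif R) f) /f iter_dif_shift addnCA addnA.
      under eq_bigr => n _ do rewrite (addnC n n0) -addnA (addnC n i) addnA.
      apply: (sum_window_le (F := fun n => `|iter k.+3 (@dif R) g n|) (a := (n0 + i)%N)) => //.
      by clear -n0P ih hP; lia.
  have := vdC_inequality P0 (leqnn P) (fun n => eq_ind_r (fun x => x <= 1) (lexx 1) (normc_expi (f n))).
  set G := fun h => _; set S := \sum_(1 <= h < P) _ => hS.
  have SG : S <= 2 * e1 * P%:R ^+ 2 + P%:R.
    pose h0 := (Num.truncn (e1 * P%:R)).+1.
    have eP0 : 0 <= e1 * P%:R by rewrite mulr_ge0// ltW.
    have /andP[t1 t2] := truncn_itv eP0.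
    apply: (@le_trans _ _ (\sum_(0 <= h < P) ((if (h < h0)%N then P%:R else 0) + e1 * P%:R))).
      rewrite [leRHS]big_ltn// -[leLHS]add0r lerD//.
        by rewrite addr_ge0// ltr0Sn.
      apply: ler_sum_nat => h /gam hh.
      apply: (le_trans hh); case: ifPn => hc.
        rewrite ifT ?lerDl// -(ltr_nat R); apply: lt_trans hc _; exact: t2.
      by rewrite lerDr; case: ifP.
    rewrite big_split /= sumr_const_nat subn0 -[X in _ + X <= _]mulr_natr.
    have : \sum_(0 <= i < P) (if (i < h0)%N then P%:R else 0) <= h0%:R * P%:R :> R.
      exact: sum_indic_le.
    rewrite /h0 -natr1; move: t1 P0'; clear; set z := (_ : nat)%:R.
    by set p : R := P%:R => t1 p0; have := ler_wpM2r (ltW p0) t1; lra.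
  rewrite -ler_sqr ?nnegrE ?normc_ge0 ?mulr_ge0 ?divr_ge0//; last exact: ltW.
  rewrite (le_trans hS)// mulfK ?gt_eqF//.
  have PP : 48 * P%:R <= ep ^+ 2 * P%:R ^+ 2.
    move: P48; rewrite ler_pdivrMr ?exprn_gt0// => P48.
    have := ler_wpM2r (ltW P0') P48.
    by rewrite (_ : P%:R * ep ^+ 2 * P%:R = ep ^+ 2 * P%:R ^+ 2)//; ring.
  have -> : (ep / 2 * P%:R) ^+ 2 = ep ^+ 2 * P%:R ^+ 2 / 4 by field.
  have E1 : e1 * P%:R ^+ 2 = ep ^+ 2 * P%:R ^+ 2 / 64 by rewrite e1E; field.
  by rewrite -mulrA E1 in SG; clear -SG PP; lra.
have := @block_sum_le R N P (ep / 2) (fun n => expi (g n)) P0.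
move=> /(_ _ _ block) H.
have {H} := H (divr_ge0 (ltW ep_gt0) (ler0n _ 2)) (fun n => eq_ind_r (fun x => x <= 1) (lexx 1) (normc_expi (g n))).
move=> h; apply: (le_trans h).
have : ep * N%:R <= ep0 * N%:R by rewrite ler_wpM2r.
have : 0 <= ep * N%:R by rewrite mulr_ge0// ltW.
by clear -PN; lra.
Qed.

Lemma deriv_testP k : deriv_test k.
Proof. by elim: k => [|k IH]; [exact: deriv_test0|exact: deriv_testS]. Qed.

End VanDerCorput.

(** * Weyl sums with an irrational top difference *)

Section Weyl.
Variable R : realType.
Implicit Types (g : nat -> R) (ep nu zeta : R).

(** Stated through multiples because differencing at lag [h] replaces [nu] by [h%:R * nu]. *)
Definition irrational_number nu :=
  forall (h : nat) (m : int), (0 < h)%N -> h%:R * nu <> m%:~R.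

Lemma irrational_numberM nu (h : nat) : (0 < h)%N -> irrational_number nu ->
  irrational_number (h%:R * nu).
Proof. by move=> h0 irr k m k0; rewrite mulrA -natrM; apply: irr; rewrite muln_gt0 k0. Qed.

Lemma normc_expi_le1 (x : R) : normc (expi x) <= 1.
Proof. by rewrite normc_expi. Qed.

(** A stable form of Weyl's theorem: [g] is not a polynomial, only its difference of order [r.+1] is
    close to [nu], and neither [N0] nor [zeta] depends on [g]. This uniformity allows the frequency
    to vary later on. *)
Definition weyl_sum (r : nat) := forall ep nu, 0 < ep -> irrational_number nu ->
  exists (N0 : nat) zeta, 0 < zeta /\ forall (N : nat) g, (N0 <= N)%N ->
  (forall n, (n < N)%N -> `|iter r.+1 (@dif R) g n - nu| <= zeta) ->
  normc (\sum_(0 <= n < N) expi (g n)) <= ep * N%:R.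

Lemma near_linear (N : nat) g nu zeta :
  (forall n, (n < N)%N -> `|dif g n - nu| <= zeta) ->
  forall n, (n <= N)%N -> `|g n - (g 0%N + n%:R * nu)| <= n%:R * zeta.
Proof.
move=> hg; elim=> [|n IH] nN; first by rewrite !mul0r addr0 subrr normr0.
have h1 := hg n nN; have h2 := IH (ltnW nN); rewrite -natr1.
have -> : g n.+1 - (g 0%N + (n%:R + 1) * nu) =
  (dif g n - nu) + (g n - (g 0%N + n%:R * nu)) by rewrite /dif; ring.
by rewrite (le_trans (ler_normD _ _))//; lra.
Qed.

Lemma geometric_sum (N : nat) x nu : expi nu != 1 ->
  normc (\sum_(0 <= n < N) expi (x + n%:R * nu)) <= 2 / normc (expi nu - 1).
Proof.
move=> nu1; have k0 : 0 < normc (expi nu - 1).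
  rewrite lt_neqAle normc_ge0 andbT eq_sym; apply: contra nu1 => /eqP/eq0_normc/eqP.
  by rewrite subr_eq0.
have E n : expi (x + n%:R * nu) * (expi nu - 1) =
    expi (x + n.+1%:R * nu) - expi (x + n%:R * nu).
  by rewrite mulrBr mulr1 -expiD -natr1 mulrDl mul1r addrA.
rewrite ler_pdivlMr// -normcM mulr_suml.
rewrite (eq_bigr _ (fun n _ => E n)) telescope_sumr//.
by rewrite (le_trans (normcB_le _ _))// !normc_expi; lra.
Qed.

(** On blocks of fixed length [g] stays close to an arithmetic progression of ratio [nu], whose
    exponential sum is a geometric series, bounded independently of its length. The block length is
    fixed by [ep] and [nu], and [zeta] is chosen after it. *)
Lemma weyl_sum0 : weyl_sum 0.
Proof.
move=> ep nu ep0 irr; have pi0 := pi_gt0 R.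
have nu1 : expi nu != 1.
  by apply/eqP => /expi_eq1[m E]; apply: (irr 1%N m) => //; rewrite mul1r.
have geo := fun N x => geometric_sum N x nu1.
have k0 : 0 < normc (expi nu - 1).
  rewrite lt_neqAle normc_ge0 andbT eq_sym; apply: contra nu1 => /eqP/eq0_normc/eqP.
  by rewrite subr_eq0.
move: (normc (expi nu - 1)) k0 geo => k k0 geo.
have [P Pge] : exists P : nat, 8 / (k * ep) <= P.+1%:R.
  by exists (Num.truncn (8 / (k * ep))); rewrite ltW// truncnS_gt.
have P0 : 0 < P.+1%:R :> R by rewrite ltr0n.
have [zeta [z0 zE]] : exists zeta, 0 < zeta /\ zeta = ep / (16 * pi * P.+1%:R).
  by exists (ep / (16 * pi * P.+1%:R)); rewrite divr_gt0 ?mulr_gt0.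
exists (Num.truncn (2 * P.+1%:R / ep)).+1, zeta; split=> // N g NN0 hg.
have NP : 2 * P.+1%:R / ep <= N%:R.
  apply: (@le_trans _ _ (Num.truncn (2 * P.+1%:R / ep)).+1%:R).
    by rewrite ltW// truncnS_gt.
  by rewrite ler_nat.
have block n0 : (n0 + P.+1 <= N)%N ->
   normc (\sum_(0 <= n < P.+1) expi (g (n0 + n)%N)) <= ep / 2 * P.+1%:R.
  move=> n0P.
  have close n : (n <= P.+1)%N -> `|g (n0 + n)%N - (g n0 + n%:R * nu)| <= n%:R * zeta.
    move=> nP; have := @near_linear P.+1 (fun n => g (n0 + n)%N) nu zeta _ n nP.
    rewrite addn0; apply => m mP; rewrite /dif addnS.
    by apply: hg; clear -n0P mP; lia.
  have diff : normc (\sum_(0 <= n < P.+1) expi (g (n0 + n)%N) -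
       \sum_(0 <= n < P.+1) expi (g n0 + n%:R * nu)) <= ep / 4 * P.+1%:R.
    rewrite -sumrB (le_trans (normc_sum _ _ _))//.
    rewrite (_ : ep / 4 * P.+1%:R = \sum_(0 <= n < P.+1) ep / 4); last first.
      by rewrite sumr_const_nat subn0 mulr_natr.
    apply: ler_sum_nat => n /andP[_ nP].
    rewrite (le_trans (expi_lip _ _))//.
    apply: (@le_trans _ _ (4 * pi * (P.+1%:R * zeta))).
      rewrite ler_pM2l ?mulr_gt0// (le_trans (close _ (ltnW nP)))//.
      by rewrite ler_pM2r// ler_nat ltnW.
    rewrite le_eqVlt; apply/orP; left; apply/eqP; rewrite zE.
    move: (pi : R) pi0 (P.+1%:R : R) P0; clear => q q0 p p0.
    by field; rewrite !gt_eqF.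
  have k4 : 2 / k <= ep / 4 * P.+1%:R.
    have -> : 2 / k = ep / 4 * (8 / (k * ep)) by field; rewrite !gt_eqF.
    by rewrite ler_pM2l// divr_gt0.
  rewrite -[X in normc X](subrK (\sum_(0 <= n < P.+1) expi (g n0 + n%:R * nu))).
  have := geo P.+1 (g n0); move: diff k4; clear.
  set A := \sum_(0 <= n < P.+1) expi (g n0 + n%:R * nu); set B := _ - A => diff k4 hA.
  by rewrite (le_trans (normcD_le B A))//; lra.
have ep2 : 0 <= ep / 2 by rewrite divr_ge0// ltW.
have h := block_sum_le (ltn0Sn P) ep2 (fun n => normc_expi_le1 (g n)) block.
rewrite (le_trans h)//.
by move: NP; rewrite ler_pdivrMr//; clear; lra.
Qed.

(** Van der Corput's inequality is used with a number of shifts depending on [ep] only. At lag [h]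
    the difference of one order less is close to [h%:R * nu], again irrational; as only finitely
    many lags occur, common [N0] and [zeta] exist for them. *)
Lemma weyl_sumS r : weyl_sum r -> weyl_sum r.+1.
Proof.
move=> IH ep nu ep0 irr.
have e20 : 0 < ep ^+ 2 / 8 by rewrite divr_gt0 ?exprn_gt0.
pose good h N0 zeta := forall (N : nat) g, (N0 <= N)%N ->
  (forall n, (n < N)%N -> `|iter r.+1 (@dif R) g n - h%:R * nu| <= zeta) ->
  normc (\sum_(0 <= n < N) expi (g n)) <= ep ^+ 2 / 8 * N%:R.
have fin H : exists (N0 : nat) zeta, 0 < zeta /\ forall h, (0 < h < H)%N -> good h N0 zeta.
  elim: H => [|H [N1 [z1 [z10 h1]]]]; first by exists 0%N, 1; split=> // h; rewrite ltn0 andbF.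
  have [H0|H0] := posnP H.
    by exists 0%N, 1; split=> // h; rewrite H0; case: h.
  have [N2 [z2 [z20 h2]]] := IH _ _ e20 (irrational_numberM H0 irr).
  exists (maxn N1 N2), (Num.min z1 z2); split; first by rewrite lt_min z10.
  move=> h /andP[h0]; rewrite ltnS leq_eqVlt => /orP[/eqP ->|hH] N g; rewrite geq_max => /andP[g1 g2] hg.
    by apply: h2 => // n /hg; rewrite le_min => /andP[].
  by apply: (h1 h _ N) => //; rewrite ?h0 ?hH// => n /hg; rewrite le_min => /andP[].
have [H HH] : exists H : nat, 4 / ep ^+ 2 <= H.+1%:R.
  by exists (Num.truncn (4 / ep ^+ 2)); rewrite ltW// truncnS_gt.
have H0 : 0 < H.+1%:R :> R by rewrite ltr0n.
have [N1 [z1 [z10 h1]]] := fin H.+1.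
exists (N1 + H.+1)%N, (z1 / H.+1%:R); split; first by rewrite divr_gt0.
move=> N g NN hg.
have HN : (H.+1 <= N)%N by apply: leq_trans NN; rewrite leq_addl.
have := vdC_inequality (ltn0Sn H) HN (fun n => normc_expi_le1 (g n)).
set S := \sum_(1 <= h < H.+1) _ => hS.
have SS : S <= H.+1%:R * (ep ^+ 2 / 8 * N%:R).
  apply: (@le_trans _ _ (\sum_(0 <= h < H.+1) (ep ^+ 2 / 8 * N%:R))); last first.
    by rewrite sumr_const_nat subn0 mulr_natl.
  rewrite [leRHS]big_ltn// -[leLHS]add0r lerD//; first by rewrite mulr_ge0// ltW.
  apply: ler_sum_nat => h /andP[h0 hH].
  under eq_bigr do rewrite -expiB.
  apply: (@le_trans _ _ (ep ^+ 2 / 8 * (N - h)%:R)); last first.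
    by rewrite ler_pM2l// ler_nat leq_subr.
  apply: (h1 h _ _ (fun n => g (n + h)%N - g n)); first by rewrite h0.
    by clear -NN hH; lia.
  move=> n nN; rewrite iter_dif_sub_sum.
  have -> : h%:R * nu = \sum_(0 <= i < h) nu by rewrite sumr_const_nat subn0 mulr_natl.
  rewrite -sumrB (le_trans (ler_norm_sum _ _ _))//.
  apply: (@le_trans _ _ (\sum_(0 <= i < h) (z1 / H.+1%:R))).
    by apply: ler_sum_nat => i /andP[_ ih]; apply: hg; clear -nN ih; lia.
  rewrite sumr_const_nat subn0 -[leLHS]mulr_natl mulrCA ler_piMr ?(ltW z10)//.
  by rewrite ler_pdivrMr// mul1r ler_nat ltnW.
have N0 : 0 < N%:R :> R by rewrite ltr0n; exact: leq_trans HN.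
rewrite -ler_sqr ?nnegrE ?normc_ge0 ?mulr_ge0//; last exact: ltW.
rewrite (le_trans hS)//.
have e2 : 0 < ep ^+ 2 by rewrite exprn_gt0.
have E1 : 2 * N%:R / H.+1%:R * N%:R <= ep ^+ 2 * N%:R ^+ 2 / 2.
  have -> : 2 * N%:R / H.+1%:R * N%:R = (N%:R ^+ 2 / 2) * (4 / H.+1%:R) :> R.
    by field; rewrite ?nat1r ?natr1 pnatr_eq0.
  have -> : ep ^+ 2 * N%:R ^+ 2 / 2 = (N%:R ^+ 2 / 2) * ep ^+ 2 by field.
  by rewrite ler_pM2l ?divr_gt0 ?exprn_gt0// ler_pdivrMr// mulrC -ler_pdivrMr.
have E2 : 2 * N%:R / H.+1%:R * (2 * S) <= ep ^+ 2 * N%:R ^+ 2 / 2.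
  have -> : 2 * N%:R / H.+1%:R * (2 * S) = 4 * N%:R / H.+1%:R * S by ring.
  have -> : ep ^+ 2 * N%:R ^+ 2 / 2 = 4 * N%:R / H.+1%:R * (H.+1%:R * (ep ^+ 2 / 8 * N%:R)).
    by field; rewrite ?nat1r ?natr1 pnatr_eq0.
  by rewrite ler_pM2l// divr_gt0// mulr_gt0.
rewrite mulrDr (le_trans (lerD E1 E2))// exprMn le_eqVlt; apply/orP; left; apply/eqP.
by field.
Qed.

Lemma weyl_sumP r : weyl_sum r.
Proof. by elim: r => [|r IH]; [exact: weyl_sum0|exact: weyl_sumS]. Qed.

End Weyl.

(** * Differentiable germs at infinity *)

Section NearInfinity.
Variable R : realType.
Implicit Types (f g h F G : R -> R).

Lemma near_pinftyP (P : R -> Prop) :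
  (\forall x \near +oo, P x) <-> exists a, forall x, a < x -> P x.
Proof.
split=> [[a [_ h]]|[a h]]; first by exists a.
by exists a; split=> //; exact: num_real.
Qed.

Lemma near_pinfty_pos (P : R -> Prop) (b : R) :
  (\forall x \near +oo, P x) -> exists2 a, b < a & forall x, a < x -> P x.
Proof.
move=> /near_pinftyP[a h]; exists (Num.max a b + 1).
  by rewrite ltr_pwDr// le_max lexx orbT.
by move=> x hx; apply: h; rewrite (le_lt_trans _ hx)// ler_wpDr// le_max lexx.
Qed.

Lemma near_pinfty_near f g : (\forall x \near +oo, f x = g x) ->
  \forall x \near +oo, \forall y \near x, f y = g y.
Proof.
move=> /near_pinftyP[a h]; apply/near_pinftyP; exists a => x ax.
by near=> y; apply: h; near: y; exact: lt_nbhsr.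
Unshelve. all: by end_near. Qed.

Definition near_derive f F := \forall x \near +oo, is_derive (x : R) (1 : R) f (F x).

Lemma near_is_derive_eq f g F G : (\forall x \near +oo, f x = g x) ->
  (\forall x \near +oo, F x = G x) ->
  near_derive f F -> near_derive g G.
Proof.
move=> /near_pinfty_near; apply: filterS3 => x fg FG; rewrite FG.
exact: near_eq_is_derive.
Qed.

Lemma is_derive_add f g (x a b : R) : is_derive x 1 f a -> is_derive x 1 g b ->
  is_derive x 1 (fun x => f x + g x) (a + b).
Proof. exact: is_deriveD. Qed.

Lemma is_derive_mul f g (x a b : R) : is_derive x 1 f a -> is_derive x 1 g b ->
  is_derive x 1 (fun x => f x * g x) (a * g x + f x * b).
Proof.
move=> hf hg; apply: (is_derive_eq (is_deriveM hf hg)).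
by rewrite addrC /GRing.scale /= mulrC.
Qed.

Lemma is_derive_const (c x : R) : is_derive x 1 (fun _ : R => c) (0 : R).
Proof. exact: is_derive_cst. Qed.

Lemma is_derive_scale (c : R) f (x a : R) : is_derive x 1 f a ->
  is_derive x 1 (fun x => c * f x) (c * a).
Proof.
move=> h; apply: (is_derive_eq (is_derive_mul (is_derive_const c x) h)).
by rewrite mul0r add0r.
Qed.

Lemma is_derive_exprn (n : nat) (x : R) :
  is_derive x 1 (fun x : R => x ^+ n) (n%:R * x ^+ n.-1).
Proof.
elim: n => [|n IH].
  by rewrite mul0r; apply: (is_derive_eq (is_derive_const 1 x)).
rewrite (_ : (fun y : R => y ^+ n.+1) = (fun y => y * y ^+ n)); last first.
  by apply/funext => y; rewrite exprS.
apply: (is_derive_eq (is_derive_mul (is_derive_id x (1 : R)) IH)).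
rewrite mul1r /=; case: n {IH} => [|n]; first by rewrite mul0r mulr0 addr0 mul1r.
by rewrite /= mulrCA -exprS -[n.+2%:R]natr1 mulrDl !mul1r addrC.
Qed.

Lemma mean_value f F (a b : R) : a < b ->
  (forall x, a <= x <= b -> is_derive x 1 f (F x)) ->
  exists2 c, a < c < b & f b - f a = F c * (b - a).
Proof.
move=> ab h; have [||c] := @MVT R f F a b ab.
- by move=> x; rewrite in_itv /= => /andP[/ltW ax /ltW xb]; apply: h; rewrite ax.
- apply: derivable_within_continuous => x; rewrite in_itv /= => /h hx.
  exact: (@ex_derive _ _ _ _ _ _ _ hx).
by rewrite in_itv /= => ? ?; exists c.
Qed.

Lemma derive_ge0_homo f F (a : R) : (forall x, a < x -> is_derive x 1 f (F x)) ->
  (forall x, a < x -> 0 <= F x) -> forall x y, a < x -> x <= y -> f x <= f y.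
Proof.
move=> hd F0 x y ax; rewrite le_eqVlt => /orP[/eqP->//|xy].
have [|c /andP[xc _] E] := @mean_value f F x y xy.
  by move=> z /andP[xz _]; apply: hd; exact: lt_le_trans xz.
by rewrite -subr_ge0 E mulr_ge0 ?subr_ge0 ?F0 ?(ltW xy)// (lt_trans ax).
Qed.

Definition eventual_sign f :=
  [\/ \forall x \near +oo, 0 < f x, \forall x \near +oo, f x = 0 |
      \forall x \near +oo, f x < 0].

Lemma eventual_sign_opp f : eventual_sign (fun x => - f x) -> eventual_sign f.
Proof.
case=> h; [apply: Or33|apply: Or32|apply: Or31]; apply: filterS h => x.
- by rewrite oppr_gt0.
- by move/eqP; rewrite oppr_eq0 => /eqP.
- by rewrite oppr_lt0.
Qed.

Lemma eventual_sign_eq f g : (\forall x \near +oo, f x = g x) ->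
  eventual_sign f -> eventual_sign g.
Proof.
by move=> fg; case=> h; [apply: Or31|apply: Or32|apply: Or33];
  apply: filterS2 fg h => x ->.
Qed.

Lemma eventual_sign_mul f g : eventual_sign f -> eventual_sign g ->
  eventual_sign (fun x => f x * g x).
Proof.
case=> hf [] hg.
- by apply: Or31; apply: filterS2 hf hg => x; exact: mulr_gt0.
- by apply: Or32; apply: filterS2 hf hg => x _ ->; rewrite mulr0.
- by apply: Or33; apply: filterS2 hf hg => x a b; rewrite pmulr_rlt0.
- by apply: Or32; apply: filterS hf => x ->; rewrite mul0r.
- by apply: Or32; apply: filterS hf => x ->; rewrite mul0r.
- by apply: Or32; apply: filterS hf => x ->; rewrite mul0r.
- by apply: Or33; apply: filterS2 hf hg => x a b; rewrite nmulr_rlt0.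
- by apply: Or32; apply: filterS2 hf hg => x _ ->; rewrite mulr0.
- by apply: Or31; apply: filterS2 hf hg => x a b; rewrite nmulr_rgt0.
Qed.

(** Along a nondecreasing function the phases negative, zero, positive can only follow each other in
    this order, so one of them is final. *)
Lemma homo_eventual_sign f (a : R) :
  (forall x y, a < x -> x <= y -> f x <= f y) -> eventual_sign f.
Proof.
move=> h; case: (pselect (exists2 x, a < x & 0 < f x)) => [[x ax fx]|n1].
  apply: Or31; apply/near_pinftyP; exists x => y xy.
  by rewrite (lt_le_trans fx)// h// ltW.
have le0 x : a < x -> f x <= 0.
  by move=> ax; rewrite leNgt; apply/negP => fx; apply: n1; exists x.
case: (pselect (exists2 x, a < x & f x = 0)) => [[x ax fx]|n2].
  apply: Or32; apply/near_pinftyP; exists x => y xy.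
  by apply/eqP; rewrite eq_le le0 ?(lt_trans ax)//= -fx h// ltW.
apply: Or33; apply/near_pinftyP; exists a => x ax.
by rewrite lt_neqAle le0// andbT; apply/eqP => fx; apply: n2; exists x.
Qed.

Lemma derive_eventual_sign f F :
  near_derive f F -> eventual_sign F -> eventual_sign f.
Proof.
move=> /near_pinftyP[a hd].
have pos f' F' (b : R) : (forall x : R, b < x -> is_derive x (1 : R) f' (F' x)) ->
    (\forall x \near +oo, 0 <= F' x) -> eventual_sign f'.
  move=> hd' /(near_pinfty_pos b)[c bc F0].
  apply: (@homo_eventual_sign f' c); apply: derive_ge0_homo F0 => x cx.
  by apply: hd'; exact: lt_trans cx.
case=> h.
- by apply: (pos _ F a) => //; apply: filterS h => x /ltW.
- by apply: (pos _ F a) => //; apply: filterS h => x ->.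
- apply: eventual_sign_opp; apply: (pos _ (fun x => - F x) a).
    by move=> x ax; apply: is_deriveN; exact: hd.
  by apply: filterS h => x hx; rewrite oppr_ge0 ltW.
Qed.

Lemma continuous_nonzero_sign f : (\forall x \near +oo, {for x, continuous f}) ->
  (\forall x \near +oo, f x != 0) -> eventual_sign f.
Proof.
move=> /near_pinftyP[a1 h1] /(near_pinfty_pos a1)[a aa h0].
have h x : a < x -> {for x, continuous f} /\ f x != 0.
  by move=> ax; split; [apply: h1; exact: lt_trans ax|exact: h0].
have key x y : a < x -> x <= y -> 0 < f x * f y.
  move=> ax xy; have nx := (h _ ax).2; have ny := (h _ (lt_le_trans ax xy)).2.
  rewrite lt_neqAle eq_sym mulf_neq0//= leNgt; apply/negP => lt0.
  have cw : {within `[x, y], continuous f}.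
    apply: continuous_in_subspaceT => z; rewrite inE /= in_itv /= => /andP[xz _].
    by apply: (h _ _).1; exact: lt_le_trans xz.
  have [|c] := @IVT R f x y 0 xy cw.
    move: lt0; case: (ltgtP (f x) 0) nx => // fx _.
      rewrite nmulr_rlt0// => fy.
      by rewrite ge_min le_max (ltW fx) (ltW fy) orbT.
    rewrite pmulr_rlt0// => fy.
    by rewrite ge_min le_max (ltW fx) (ltW fy) orbT.
  rewrite in_itv /= => /andP[xc _] fc.
  by have := (h _ (lt_le_trans ax xc)).2; rewrite fc eqxx.
have ax : a < a + 1 by rewrite ltrDl.
case: (ltgtP (f (a + 1)) 0) (h _ ax).2 => // fx _.
- apply: Or33; apply/near_pinftyP; exists (a + 1) => y /ltW xy.
  by have := key _ _ ax xy; rewrite nmulr_rgt0.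
- apply: Or31; apply/near_pinftyP; exists (a + 1) => y /ltW xy.
  by have := key _ _ ax xy; rewrite pmulr_rgt0.
Qed.

End NearInfinity.

(** * Hardy fields *)

Section HardySpan.
Variables (R : realType) (H : set (R -> R)).
Hypothesis hH : hardy_field H.
Implicit Types (f g h : R -> R).

Lemma hardy_near_derive h : H h -> near_derive h (derive1 h).
Proof.
move=> /(hardy_derivable hH); apply: filterS => x dx.
by rewrite derive1E; exact: derivableP.
Qed.

(** A nonzero germ has an inverse, hence no zeros far out, and continuity then fixes the sign. *)
Lemma hardy_sign h : H h -> eventual_sign h.
Proof.
move=> Hh; case: (pselect (eq_germ h (fun=> 0))) => [?|n0]; first exact: Or32.
have [k Hk hk] := hardyV hH Hh n0.
apply: continuous_nonzero_sign; first exact: hardy_continuous Hh.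
by apply: filterS hk => x hk; apply: contra_eq_neq hk => ->; rewrite mul0r eq_sym oner_eq0.
Qed.

(* Germs of [\sum_(i < n) c_i h_i] with [c_i] real and [h_i] in [H]. *)
Inductive lin_span : nat -> (R -> R) -> Prop :=
| LinSpan0 f of eq_germ f (fun=> 0) : lin_span 0 f
| LinSpanS n f g c h of lin_span n g & H h &
    eq_germ f (fun x => c * h x + g x) : lin_span n.+1 f.

Lemma lin_span_germ n f g : eq_germ f g -> lin_span n f -> lin_span n g.
Proof.
move=> fg hf; case: hf fg => [f0 h0|m f0 g0 c h hg Hh E] fg.
  by apply: LinSpan0; apply: filterS2 fg h0 => x <-.
by apply: (LinSpanS (c := c) hg Hh); apply: filterS2 fg E => x <-.
Qed.

Lemma lin_spanD n m f g : lin_span n f -> lin_span m g ->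
  lin_span (n + m) (fun x => f x + g x).
Proof.
move=> + hg; elim=> [f0 h0|k f0 g0 c h _ IH Hh E].
  by apply: lin_span_germ hg; apply: filterS h0 => x ->; rewrite add0r.
by apply: (LinSpanS (c := c) IH Hh); apply: filterS E => x ->; rewrite addrA.
Qed.

Lemma lin_spanZ n f (c : R) : lin_span n f -> lin_span n (fun x => c * f x).
Proof.
elim=> [f0 h0|k f0 g0 d h _ IH Hh E].
  by apply: LinSpan0; apply: filterS h0 => x ->; rewrite mulr0.
by apply: (LinSpanS (c := c * d) IH Hh); apply: filterS E => x ->; rewrite mulrDr mulrA.
Qed.

Lemma lin_spanM n f k : H k -> lin_span n f -> lin_span n (fun x => f x * k x).
Proof.
move=> Hk; elim=> [f0 h0|m f0 g0 d h _ IH Hh E].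
  by apply: LinSpan0; apply: filterS h0 => x ->; rewrite mul0r.
apply: (LinSpanS (c := d) IH (hardyM hH Hh Hk)).
by apply: filterS E => x ->; rewrite mulrDl mulrA.
Qed.

Lemma lin_span_derive n f : lin_span n f -> exists2 F, lin_span n F & near_derive f F.
Proof.
elim=> [f0 h0|m f0 g0 d h _ [G hG dG] Hh E].
  exists (fun=> 0); first by apply: LinSpan0; near=> x.
  apply: (@near_is_derive_eq _ (fun=> 0) _ (fun=> 0)) => //.
  - by apply: filterS h0 => x ->.
  - by near=> x.
  - by near=> x; exact: is_derive_const.
exists (fun x => d * derive1 h x + G x).
  by apply: (LinSpanS (c := d) hG (hardy_derive hH Hh)); near=> x.
apply: (@near_is_derive_eq _ (fun x => d * h x + g0 x) _ (fun x => d * derive1 h x + G x)).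
- by apply: filterS E => x ->.
- by near=> x.
- apply: filterS2 (hardy_near_derive Hh) dG => x dh dg.
  by apply: is_derive_add => //; exact: is_derive_scale.
Unshelve. all: by end_near. Qed.

(* Germs of [\sum_(d < D) x ^+ d * g_d] with [g_d] in the linear span of [H]. *)
Inductive poly_span : nat -> (R -> R) -> Prop :=
| PolySpan0 f of eq_germ f (fun=> 0) : poly_span 0 f
| PolySpanS D n f g r of lin_span n g & poly_span D r &
    eq_germ f (fun x => x ^+ D * g x + r x) : poly_span D.+1 f.

Lemma poly_span_germ D f g : eq_germ f g -> poly_span D f -> poly_span D g.
Proof.
move=> fg hf; case: hf fg => [f0 h0|m n f0 g0 r hg hr E] fg.
  by apply: PolySpan0; apply: filterS2 fg h0 => x <-.
by apply: (PolySpanS hg hr); apply: filterS2 fg E => x <-.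
Qed.

Lemma poly_span_widenS D f : poly_span D f -> poly_span D.+1 f.
Proof.
move=> hf; apply: (@PolySpanS D 0 f (fun=> 0) f _ hf).
  by apply: LinSpan0; near=> x.
by near=> x; rewrite mulr0 add0r.
Unshelve. all: by end_near. Qed.

Lemma poly_span_widen D E f : (D <= E)%N -> poly_span D f -> poly_span E f.
Proof.
by move=> /subnK <-; elim: (E - D)%N => //= k IH /IH; exact: poly_span_widenS.
Qed.

Lemma poly_spanD_same D f g : poly_span D f -> poly_span D g ->
  poly_span D (fun x => f x + g x).
Proof.
elim: D f g => [|D IH] f g hf hg.
  inversion hf as [? h1|]; inversion hg as [? h2|]; subst.
  by apply: PolySpan0; apply: filterS2 h1 h2 => x -> ->; rewrite addr0.
inversion hf as [|? n1 ? g1 r1 hg1 hr1 E1]; inversion hg as [|? n2 ? g2 r2 hg2 hr2 E2]; subst.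
apply: (PolySpanS (lin_spanD hg1 hg2) (IH _ _ hr1 hr2)).
by apply: filterS2 E1 E2 => x -> ->; rewrite mulrDr addrACA.
Qed.

Lemma poly_spanD D E f g : poly_span D f -> poly_span E g ->
  poly_span (maxn D E) (fun x => f x + g x).
Proof.
by move=> /(poly_span_widen (leq_maxl D E)) hf /(poly_span_widen (leq_maxr D E)) hg;
  exact: poly_spanD_same.
Qed.

Lemma poly_spanZ D f (c : R) : poly_span D f -> poly_span D (fun x => c * f x).
Proof.
elim=> [f0 h0|k n f0 g0 r hg _ IH E].
  by apply: PolySpan0; apply: filterS h0 => x ->; rewrite mulr0.
apply: (PolySpanS (lin_spanZ c hg) IH).
by apply: filterS E => x ->; rewrite mulrDr mulrCA.
Qed.

Lemma poly_spanM D f k : H k -> poly_span D f -> poly_span D (fun x => f x * k x).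
Proof.
move=> Hk; elim=> [f0 h0|m n f0 g0 r hg _ IH E].
  by apply: PolySpan0; apply: filterS h0 => x ->; rewrite mul0r.
apply: (PolySpanS (lin_spanM Hk hg) IH).
by apply: filterS E => x ->; rewrite mulrDl mulrA.
Qed.

Lemma poly_span_lin n D g : lin_span n g -> poly_span D.+1 (fun x => x ^+ D * g x).
Proof.
move=> hg; apply: (@PolySpanS D n _ g (fun=> 0) hg).
  elim: D => [|D IH]; [by apply: PolySpan0; near=> x|exact: poly_span_widenS].
by near=> x; rewrite addr0.
Unshelve. all: by end_near. Qed.

Lemma poly_span_mulX D f : poly_span D f -> poly_span D.+1 (fun x => x * f x).
Proof.
elim=> [f0 h0|m n f0 g0 r hg _ IH E].
  apply: poly_span_widenS; apply: PolySpan0; apply: filterS h0 => x ->.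
  by rewrite mulr0.
apply: (PolySpanS hg IH).
by apply: filterS E => x ->; rewrite mulrDr exprS mulrA.
Qed.

(** Differentiation does not lengthen the coefficient of the top power, because
    [D%:R * x ^+ D.-1 * g x] falls into lower degree; the double induction in [poly_span_sign]
    depends on this. Only the derivative of [r] is asked to have lower degree: there [r] contains a
    term [x ^+ D * c] with a constant [c], which is of top degree while its derivative is not. *)
Lemma top_derive D n g r : lin_span n g ->
  (exists2 r', poly_span D r' & near_derive r r') ->
  exists g' r', [/\ lin_span n g', poly_span D r' &
    near_derive (fun x => x ^+ D * g x + r x) (fun x => x ^+ D * g' x + r' x)].
Proof.
move=> hg [r' hr' dr]; have [g' hg' dg] := lin_span_derive hg.
exists g', (fun x => D%:R * x ^+ D.-1 * g x + r' x); split => //.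
  apply: poly_spanD_same => //; case: D {hr' dr} => [|D].
    by apply: PolySpan0; near=> x; rewrite !mul0r.
  apply: poly_span_germ (poly_spanZ D.+1%:R (poly_span_lin D hg)).
  by near=> x; rewrite mulrA.
apply: filterS2 dg dr => x dg dr.
apply: is_derive_eq (is_derive_add (is_derive_mul (is_derive_exprn D x) dg) dr) _.
by rewrite -addrA addrCA.
Unshelve. all: by end_near. Qed.

Lemma poly_span_derive D f : poly_span D f -> exists2 F, poly_span D F & near_derive f F.
Proof.
elim=> [f0 h0|m n f0 g0 r hg _ IH E].
  exists (fun=> 0); first by apply: PolySpan0; near=> x.
  apply: (@near_is_derive_eq _ (fun=> 0) _ (fun=> 0)) => //.
  - by apply: filterS h0 => x ->.
  - by near=> x.
  - by near=> x; exact: is_derive_const.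
have [g' [r' [hg' hr' d]]] := top_derive hg IH.
exists (fun x => x ^+ m * g' x + r' x).
  by apply: (PolySpanS hg' hr'); near=> x.
apply: near_is_derive_eq d; last by near=> x.
by apply: filterS E => x ->.
Unshelve. all: by end_near. Qed.

(* After division by one of the [h_i] of top degree, differentiation removes it. *)
Lemma poly_span_sign D f : poly_span D f -> eventual_sign f.
Proof.
elim: D f => [|D IHD] f hf; first by inversion hf; apply: Or32.
inversion hf as [|? n ? g r hg hr E]; subst => {hf}.
apply: (@eventual_sign_eq _ (fun x => x ^+ D * g x + r x)).
  by apply: filterS E => x ->.
move: hg r hr {f E}; elim: n g => [|n IHn] g hg r hr.
  inversion hg as [? h0|]; subst; apply: eventual_sign_eq (IHD _ hr).
  by apply: filterS h0 => x ->; rewrite mulr0 add0r.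
inversion hg as [|? ? g' c h hg' Hh E]; subst => {hg}.
case: (pselect (eq_germ h (fun=> 0))) => [h0|nh0].
  apply: eventual_sign_eq (IHn _ hg' _ hr).
  by apply: filterS2 E h0 => x -> ->; rewrite mulr0 add0r.
have [k Hk hk] := hardyV hH Hh nh0.
pose r1 x := x ^+ D * c + r x * k x.
have hgk := lin_spanM Hk hg'.
have hr1 : exists2 r', poly_span D r' & near_derive r1 r'.
  have [rk' hrk drk] := poly_span_derive (poly_spanM Hk hr).
  exists (fun x => D%:R * x ^+ D.-1 * c + rk' x); last first.
    apply: filterS drk => x drk.
    apply: is_derive_eq (is_derive_add (is_derive_mul (is_derive_exprn D x) (is_derive_const c x)) drk) _.
    by rewrite mulr0 addr0.
  apply: poly_spanD_same => //; case: D {IHD IHn hr r1 hrk} => [|D].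
    by apply: PolySpan0; near=> x; rewrite !mul0r.
  have h1 : lin_span 1 (fun=> c).
    apply: (@LinSpanS 0 _ (fun=> 0) c (fun=> 1)); [|exact: hardy1 hH|].
      by apply: LinSpan0; near=> x.
    by near=> x; rewrite mulr1 addr0.
  apply: poly_span_germ (poly_spanZ D.+1%:R (poly_span_lin D h1)).
  by near=> x; rewrite mulrA.
have [G [r' [hG hr' d]]] := top_derive hgk hr1.
have sg := derive_eventual_sign d (IHn _ hG _ hr').
apply: eventual_sign_eq (eventual_sign_mul sg (hardy_sign Hh)).
apply: filterS2 E hk => x -> hk; rewrite /r1.
have -> : (x ^+ D * (g' x * k x) + (x ^+ D * c + r x * k x)) * h x =
  x ^+ D * (c * h x + g' x * (h x * k x)) + r x * (h x * k x) by ring.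
by rewrite hk !mulr1.
Unshelve. all: by end_near. Qed.

(** A stand-in for a Hardy field containing [H], the identity and the real constants: it is closed
    under differentiation and its members have eventual signs, which is all that comparisons of
    growth require. *)
Definition hardy_poly f := exists D, poly_span D f.

Lemma hardy_poly_sign f : hardy_poly f -> eventual_sign f.
Proof. by case=> D; exact: poly_span_sign. Qed.

Lemma hardy_polyH h : H h -> hardy_poly h.
Proof.
move=> Hh; exists 1%N; have h1 : lin_span 1 h.
  apply: (@LinSpanS 0 _ (fun=> 0) 1 h) => //; first by apply: LinSpan0; near=> x.
  by near=> x; rewrite mul1r addr0.
by apply: poly_span_germ (poly_span_lin 0 h1); near=> x; rewrite expr0 mul1r.
Unshelve. all: by end_near. Qed.

Lemma hardy_polyD f g : hardy_poly f -> hardy_poly g -> hardy_poly (fun x => f x + g x).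
Proof. by move=> [D hf] [E hg]; exists (maxn D E); exact: poly_spanD. Qed.

Lemma hardy_polyZ c f : hardy_poly f -> hardy_poly (fun x => c * f x).
Proof. by move=> [D hf]; exists D; exact: poly_spanZ. Qed.

Lemma hardy_polyX f : hardy_poly f -> hardy_poly (fun x => x * f x).
Proof. by move=> [D hf]; exists D.+1; exact: poly_span_mulX. Qed.

Lemma hardy_polyXn n f : hardy_poly f -> hardy_poly (fun x => x ^+ n * f x).
Proof.
move=> hf; elim: n => [|n /hardy_polyX].
  by rewrite (_ : (fun x => x ^+ 0 * f x) = f)//; apply/funext => x; rewrite mul1r.
by congr hardy_poly; apply/funext => x; rewrite exprS mulrA.
Qed.

Lemma hardy_poly_const c : hardy_poly (fun=> c).
Proof.
have := hardy_polyZ c (hardy_polyH (hardy1 hH)).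
by congr hardy_poly; apply/funext => x; rewrite mulr1.
Qed.

Lemma hardy_polyB f g : hardy_poly f -> hardy_poly g -> hardy_poly (fun x => f x - g x).
Proof.
move=> hf hg; have := hardy_polyD hf (hardy_polyZ (-1) hg).
by congr hardy_poly; apply/funext => x; rewrite mulN1r.
Qed.

Lemma hardy_poly_horner (p : {poly R}) : hardy_poly (fun x => p.[x]).
Proof.
elim/poly_ind: p => [|p c IH].
  by have := hardy_poly_const 0; congr hardy_poly; apply/funext => x; rewrite horner0.
have := hardy_polyD (hardy_polyX IH) (hardy_poly_const c).
by congr hardy_poly; apply/funext => x; rewrite hornerMXaddC mulrC.
Qed.

Lemma hardy_poly_cmp f (C : R) : hardy_poly f ->
  (\forall x \near +oo, f x <= C) \/ (\forall x \near +oo, C <= f x).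
Proof.
move=> hf; case: (hardy_poly_sign (hardy_polyB hf (hardy_poly_const C))) => h.
- by right; apply: filterS h => x; rewrite subr_gt0 => /ltW.
- by right; apply: filterS h => x /eqP; rewrite subr_eq0 => /eqP ->.
- by left; apply: filterS h => x; rewrite subr_lt0 => /ltW.
Qed.

Lemma hardy_poly_trichotomy f : hardy_poly f ->
  [\/ exists C, \forall x \near +oo, `|f x| <= C,
      forall C, \forall x \near +oo, C <= f x |
      forall C, \forall x \near +oo, C <= - f x].
Proof.
move=> hf; have hNf := hardy_polyZ (-1) hf.
case: (pselect (exists C, \forall x \near +oo, f x <= C)) => [[C hC]|nC]; last first.
  apply: Or32 => C; case: (hardy_poly_cmp C hf) => // h.
  by exfalso; apply: nC; exists C.
case: (pselect (exists C, \forall x \near +oo, - f x <= C)) => [[C' hC']|nC]; last first.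
  apply: Or33 => C0; case: (hardy_poly_cmp C0 hNf) => h.
    by exfalso; apply: nC; exists C0; apply: filterS h => x; rewrite mulN1r.
  by apply: filterS h => x; rewrite mulN1r.
apply: Or31; exists (Num.max C C'); apply: filterS2 hC hC' => x h1 h2.
by rewrite ler_norml lerNl !le_max h1 h2 orbT.
Qed.

End HardySpan.

(** * Regular growth: logarithmic derivatives and comparison with powers *)

Section Growth.
Variable R : realType.
Implicit Types (f g h : R -> R).

Lemma is_derive_opp f (x a : R) : is_derive x 1 f a ->
  is_derive x 1 (fun x => - f x) (- a).
Proof. exact: is_deriveN. Qed.

Lemma is_derive_invn (n : nat) (x : R) : x != 0 ->
  is_derive x 1 (fun x : R => x^-1 ^+ n) (- n%:R * x^-1 ^+ n.+1).
Proof.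
move=> x0; have hV := is_deriveV x0 (is_derive_id x (1 : R)).
apply: is_derive_eq (is_derive1_comp (is_derive_exprn n x^-1) hV) _.
rewrite /GRing.scale /= mulr1 mulrN mulNr; congr (- _).
case: n => [|n]; first by rewrite !mul0r.
by rewrite /= -mulrA -exprVn -exprD addn2.
Qed.

Lemma derive_le0_homo f (F : R -> R) (a : R) :
  (forall x, a < x -> is_derive x 1 f (F x)) ->
  (forall x, a < x -> F x <= 0) -> forall x y, a < x -> x <= y -> f y <= f x.
Proof.
move=> hd F0 x y ax xy; rewrite -lerN2.
apply: (@derive_ge0_homo _ (fun x => - f x) (fun x => - F x) a) => // z az.
  by apply: is_derive_opp; exact: hd.
by rewrite oppr_ge0 F0.
Qed.

Lemma derive_ge_exprn f (F : R -> R) (c : R) (m : nat) : 0 < c ->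
  near_derive f F -> (\forall x \near +oo, c * x ^+ m <= F x) ->
  exists2 c', 0 < c' & \forall x \near +oo, c' * x ^+ m.+1 <= f x.
Proof.
move=> c0 /(near_pinfty_pos 0)[a a0 hd] /(near_pinfty_pos a)[b ab hF].
have b0 : 0 < b by exact: lt_trans ab.
pose k := c / m.+1%:R.
have k0 : 0 < k by rewrite divr_gt0.
exists (k / 2); first by rewrite divr_gt0.
pose f1 x := f x - k * x ^+ m.+1.
have hom x y : b < x -> x <= y -> f1 x <= f1 y.
  apply: (@derive_ge0_homo _ f1 (fun x => F x - c * x ^+ m) b) => z bz.
    apply: is_derive_eq (is_derive_add (hd _ (lt_trans ab bz))
      (is_derive_opp (is_derive_scale k (is_derive_exprn m.+1 z)))) _.
    by rewrite /k mulrA divfK ?pnatr_eq0.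
  by rewrite subr_ge0 hF.
have b1 : b < b + 1 by rewrite ltrDl.
apply/near_pinftyP; exists (Num.max (b + 1) (Num.max 1 (- f1 (b + 1) / (k / 2)))) => x.
rewrite !gt_max => /and3P[x1 x2 x3].
have := hom _ _ b1 (ltW x1); rewrite {2}/f1.
have : - f1 (b + 1) <= k / 2 * x ^+ m.+1.
  rewrite ltr_pdivrMr ?divr_gt0// in x3.
  rewrite (le_trans (ltW x3))// mulrC ler_pM2l ?divr_gt0// exprS ler_peMr//.
    by rewrite (le_trans ler01)// ltW.
  by rewrite exprn_ege1// ltW.
lra.
Qed.

Lemma tower_ge_exprn (d : nat -> R -> R) (j k m : nat) (c : R) : 0 < c ->
  (forall j, near_derive (d j) (d j.+1)) ->
  (\forall x \near +oo, c * x ^+ m <= d (j + k)%N x) ->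
  exists2 c', 0 < c' & \forall x \near +oo, c' * x ^+ (m + k) <= d j x.
Proof.
move=> c0 hd; elim: k j => [|k IH] j h; first by exists c; rewrite // addn0 -[j]addn0.
rewrite addnS -addSn in h; have [c1 c10 h1] := IH _ h.
have [c2 c20 h2] := derive_ge_exprn c10 (hd j) h1; exists c2 => //.
by rewrite addnS.
Qed.

(** The derivative of [h x * x^-1 ^+ K] is [x^-1 ^+ K.+1] times [x * h' x - K%:R * h x]. *)
Lemma log_derive_homo h (h' : R -> R) (a : R) (K : nat) : 0 <= a ->
  (forall x, a < x -> is_derive x 1 h (h' x)) ->
  (forall x, a < x -> K%:R * h x <= x * h' x) ->
  forall x y, a < x -> x <= y -> h x * x^-1 ^+ K <= h y * y^-1 ^+ K.
Proof.
move=> a0 hd hK; apply: (@derive_ge0_homo _ (fun x => h x * x^-1 ^+ K)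
  (fun x => x^-1 ^+ K.+1 * (x * h' x - K%:R * h x)) a) => x ax.
  have x0 : x != 0 by rewrite gt_eqF// (le_lt_trans a0).
  apply: is_derive_eq (is_derive_mul (hd _ ax) (is_derive_invn K x0)) _.
  by rewrite exprS; field.
rewrite mulr_ge0 ?subr_ge0 ?hK// exprn_ge0// invr_ge0 ltW//.
exact: le_lt_trans ax.
Qed.

Lemma log_derive_homo_neg h (h' : R -> R) (a : R) (K : nat) : 0 <= a ->
  (forall x, a < x -> is_derive x 1 h (h' x)) ->
  (forall x, a < x -> - (K%:R * h x) <= x * h' x) ->
  forall x y, a < x -> x <= y -> h x * x ^+ K <= h y * y ^+ K.
Proof.
move=> a0 hd hK; apply: (@derive_ge0_homo _ (fun x => h x * x ^+ K)
  (fun x => h' x * x ^+ K + h x * (K%:R * x ^+ K.-1)) a) => x ax.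
  exact: is_derive_mul (hd _ ax) (is_derive_exprn K x).
have x0 : 0 < x by exact: le_lt_trans ax.
have := hK x ax; case: K {hK} => [|K] hK.
  rewrite mul0r mulr0 addr0 mulr1; move: hK; rewrite mul0r oppr0.
  by rewrite pmulr_rge0.
have -> : h' x * x ^+ K.+1 + h x * (K.+1%:R * x ^+ K) =
  x ^+ K * (x * h' x + K.+1%:R * h x) by rewrite exprS; ring.
rewrite mulr_ge0 ?exprn_ge0 ?(ltW x0)//; lra.
Qed.

(** The logarithmic derivative is at most [K / x], so that [h] changes by a bounded factor when its
    argument does. *)
Definition log_bounded h (h' : R -> R) (K : nat) (a : R) :=
  forall x, a < x -> 0 < `|h x| /\ `|x * h' x| <= K%:R * `|h x|.

(** For positive [h] the hypothesis makes [h x * x ^+ K] nondecreasing and [h x / x ^+ K]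
    nonincreasing; negative [h] is handled by a change of sign. *)
Lemma log_bounded_ratio h (h' : R -> R) (K : nat) (a L : R) : 0 <= a -> 1 <= L ->
  (forall x, a < x -> is_derive x 1 h (h' x)) -> log_bounded h h' K a ->
  eventual_sign h ->
  exists b, forall x y, b < x -> b < y -> x <= L * y -> y <= L * x ->
   `|h x| <= L ^+ K * `|h y|.
Proof.
move=> a0 L1 hd hK.
wlog sg : h h' hd hK / \forall x \near +oo, 0 < h x => [wl|_].
  case=> hs.
  - by apply: (wl h h') => //; apply: Or31.
  - have /near_pinftyP[b hb] := hs; have := hK (Num.max a b + 1).
    have m1 : a < Num.max a b + 1 by rewrite ltr_pwDr// le_max lexx.
    have m2 : b < Num.max a b + 1 by rewrite ltr_pwDr// le_max lexx orbT.
    by rewrite hb// normr0 ltxx => /(_ m1)[].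
  - have [||||b hb] := wl (fun x => - h x) (fun x => - h' x).
    + by move=> x ax; apply: is_derive_opp; exact: hd.
    + by move=> x ax; rewrite mulrN !normrN; exact: hK.
    + by apply: filterS hs => x; rewrite oppr_gt0.
    + by apply: Or31; apply: filterS hs => x; rewrite oppr_gt0.
    + by exists b => x y; rewrite -(normrN (h x)) -(normrN (h y)); exact: hb.
have [b ab hb] := near_pinfty_pos a sg.
have b0 : 0 <= b by rewrite (le_trans a0)// ltW.
have hd' x : b < x -> is_derive x 1 h (h' x) by move=> /(lt_trans ab)/hd.
have hup x : b < x -> - (K%:R * h x) <= x * h' x.
  move=> bx; have [_] := hK x (lt_trans ab bx); rewrite (gtr0_norm (hb x bx)).
  by rewrite ler_norml => /andP[].
have hdn x : b < x -> K%:R * (- h x) <= x * (- h' x).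
  move=> bx; have [_] := hK x (lt_trans ab bx); rewrite (gtr0_norm (hb x bx)).
  by rewrite ler_norml => /andP[_]; rewrite !mulrN lerN2.
exists b => x y bx bye xLy yLx.
have x0 : 0 < x by exact: le_lt_trans bx.
have y0 : 0 < y by exact: le_lt_trans bye.
rewrite !gtr0_norm ?hb//.
have L0 : 0 < L by exact: lt_le_trans L1.
case: (leP x y) => [xy|/ltW yx].
  have := log_derive_homo_neg b0 hd' hup bx xy => hh.
  rewrite -(@ler_pM2r _ (x ^+ K)) ?exprn_gt0// (le_trans hh)//.
  rewrite mulrAC -exprMn mulrC ler_pM2r ?hb// lerXn2r ?nnegrE ?mulr_ge0 ?(ltW L0) ?(ltW x0) ?(ltW y0)//.
have := @log_derive_homo (fun x => - h x) (fun x => - h' x) b K b0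
  (fun x bx => is_derive_opp (hd' x bx)) hdn _ _ bye yx.
rewrite !mulNr lerN2 => hh.
have {}hh : h x <= h y * (x / y) ^+ K.
  rewrite -(@ler_pM2r _ (x^-1 ^+ K)) ?exprn_gt0 ?invr_gt0// (le_trans hh)//.
  by rewrite -mulrA -exprMn mulrAC divff ?gt_eqF// mul1r.
rewrite (le_trans hh)// mulrC ler_pM2r ?hb// lerXn2r ?nnegrE ?divr_ge0 ?(ltW L0) ?(ltW x0) ?(ltW y0)//.
by rewrite ler_pdivrMr.
Qed.

Variables (H : set (R -> R)).
Hypothesis hH : hardy_field H.

(** Take [h] positive. Both [x * h' x - m.+1%:R * h x] and [x * h' x + m.+1%:R * h x] have eventual
    signs. A wrong sign of the first would make [h x / x ^+ m.+1] nondecreasing, against the upper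
    bound; a wrong sign of the second would make [h x * x ^+ m.+1] nonincreasing, against the lower
    one. *)
Lemma hardy_log_bounded h (h' : R -> R) (m : nat) : hardy_poly H h -> hardy_poly H h' ->
  near_derive h h' ->
  (\forall x \near +oo, x^-1 ^+ m <= `|h x|) -> (\forall x \near +oo, `|h x| <= x ^+ m) ->
  exists (K : nat) (a : R), 0 <= a /\ log_bounded h h' K a.
Proof.
move=> hh hh' hd.
have key f (f' : R -> R) : hardy_poly H f -> hardy_poly H f' -> near_derive f f' ->
    (\forall x \near +oo, 0 < f x) -> (\forall x \near +oo, x^-1 ^+ m <= f x) ->
    (\forall x \near +oo, f x <= x ^+ m) ->
    \forall x \near +oo, 0 < `|f x| /\ `|x * f' x| <= m.+1%:R * `|f x|.
  move=> hf hf' df f0 flo fhi.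
  have up : \forall x \near +oo, x * f' x <= m.+1%:R * f x.
    have := hardy_poly_cmp hH 0 (hardy_polyB (hardy_polyX hf') (hardy_polyZ m.+1%:R hf)).
    case=> h0; first by apply: filterS h0 => x; rewrite subr_le0.
    have /(near_pinfty_pos 0)[a a0 ha] := df.
    have /(near_pinfty_pos a)[b ab hb] := h0.
    have /(near_pinfty_pos b)[c bc hc] := f0.
    exfalso.
    have c0 : 0 < c by rewrite (lt_trans a0)// (lt_trans ab).
    have hom := @log_derive_homo f f' c m.+1 (ltW c0)
      (fun x cx => ha x (lt_trans (lt_trans ab bc) cx)) _.
    have {}hom := hom (fun x cx => ltac:(by rewrite -subr_ge0; exact: hb x (lt_trans bc cx))).
    have c1 : c < c + 1 by rewrite ltrDl.
    pose e := f (c + 1) * (c + 1)^-1 ^+ m.+1.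
    have e0 : 0 < e by rewrite mulr_gt0 ?hc// exprn_gt0// invr_gt0 (lt_trans c0).
    have /(near_pinfty_pos (Num.max (c + 1) e^-1))[b' bb' hb'] := fhi.
    move: bb'; rewrite gt_max => /andP[cb' eb'].
    have b'1 : b' < b' + 1 by rewrite ltrDl.
    have := hom (c + 1) (b' + 1) c1 (ltW (lt_trans cb' b'1)); rewrite -/e.
    have z0 : 0 < b' + 1 by rewrite (lt_trans _ b'1)// (lt_trans _ cb')// (lt_trans c0).
    have := hb' _ b'1; rewrite -(@ler_pM2r _ ((b' + 1)^-1 ^+ m.+1)) ?exprn_gt0 ?invr_gt0//.
    have -> : (b' + 1) ^+ m * (b' + 1)^-1 ^+ m.+1 = (b' + 1)^-1.
      by rewrite exprS mulrCA -exprMn divff ?gt_eqF// expr1n mulr1.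
    move=> l1 l2; have := le_trans l2 l1; apply/negP; rewrite -ltNge.
    by rewrite invf_plt ?posrE// (lt_trans eb').
  have dn : \forall x \near +oo, - (m.+1%:R * f x) <= x * f' x.
    have := hardy_poly_cmp hH 0 (hardy_polyD (hardy_polyX hf') (hardy_polyZ m.+1%:R hf)).
    case=> h0; last by apply: filterS h0 => x h0; rewrite -subr_ge0 opprK.
    have /(near_pinfty_pos 0)[a a0 ha] := df.
    have /(near_pinfty_pos a)[b ab hb] := h0.
    have /(near_pinfty_pos b)[c bc hc] := f0.
    exfalso.
    have c0 : 0 < c by rewrite (lt_trans a0)// (lt_trans ab).
    have hom := @log_derive_homo_neg (fun x => - f x) (fun x => - f' x) c m.+1 (ltW c0)
      (fun x cx => is_derive_opp (ha x (lt_trans (lt_trans ab bc) cx))) _.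
    have {}hom := hom (fun x cx => ltac:(by have := hb x (lt_trans bc cx); lra)).
    have c1 : c < c + 1 by rewrite ltrDl.
    pose e := f (c + 1) * (c + 1) ^+ m.+1.
    have e0 : 0 < e by rewrite mulr_gt0 ?hc// exprn_gt0// (lt_trans c0).
    have /(near_pinfty_pos (Num.max (c + 1) e))[b' bb' hb'] := flo.
    move: bb'; rewrite gt_max => /andP[cb' eb'].
    have b'1 : b' < b' + 1 by rewrite ltrDl.
    have := hom (c + 1) (b' + 1) c1 (ltW (lt_trans cb' b'1)).
    rewrite !mulNr lerN2 -/e.
    have z0 : 0 < b' + 1 by rewrite (lt_trans _ b'1)// (lt_trans _ cb')// (lt_trans c0).
    have := hb' _ b'1; rewrite -(@ler_pM2r _ ((b' + 1) ^+ m.+1)) ?exprn_gt0//.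
    have -> : (b' + 1)^-1 ^+ m * (b' + 1) ^+ m.+1 = b' + 1.
      by rewrite exprS mulrCA -exprMn mulVf ?gt_eqF// expr1n mulr1.
    move=> l1 l2; have := le_trans l1 l2; apply/negP; rewrite -ltNge.
    by rewrite (lt_trans eb').
  apply: filterS3 f0 up dn => x f0 up dn.
  by rewrite (gtr0_norm f0) f0; split=> //; rewrite ler_norml dn up.
move=> lo hi.
suff : \forall x \near +oo, 0 < `|h x| /\ `|x * h' x| <= m.+1%:R * `|h x|.
  by case/(near_pinfty_pos 0) => a a0 ha; exists m.+1, a; split; [exact: ltW|].
case: (hardy_poly_sign hH hh) => hs.
- by apply: key => //; [apply: filterS2 hs lo|apply: filterS2 hs hi] => x /gtr0_norm ->.
- have [a a0 ha] : exists2 a, 0 < a & forall x, a < x -> x^-1 ^+ m <= `|h x| /\ h x = 0.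
    by apply: near_pinfty_pos; apply: filterS2 lo hs.
  exfalso; have a1 : a < a + 1 by rewrite ltrDl.
  have [] := ha _ a1; rewrite leNgt => + h0; rewrite h0 normr0 exprn_gt0//.
  by rewrite invr_gt0 (lt_trans a0).
- have := key (fun x => - h x) (fun x => - h' x) _ _ _ _ _ _.
  have hN f : hardy_poly H f -> hardy_poly H (fun x => - f x).
    move=> hf; have := hardy_polyZ (-1) hf.
    by congr hardy_poly; apply/funext => x; rewrite mulN1r.
  move=> k; apply: filterS (k (hN _ hh) (hN _ hh') _ _ _ _) => [x||||].
  + by rewrite mulrN !normrN.
  + by apply: filterS hd => x; exact: is_derive_opp.
  + by apply: filterS hs => x; rewrite oppr_gt0.
  + by apply: filterS2 hs lo => x /ltr0_norm ->.
  + by apply: filterS2 hs hi => x /ltr0_norm ->.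
Qed.

(** If [h' / h] were at most [1 / (ep * x ^+ 2)] for all large [x], it would be integrable and [h]
    bounded. The eventual sign turns a failure of the claim into exactly this inequality. *)
Lemma hardy_derive_ge h (h' : R -> R) (ep : R) : 0 < ep ->
  hardy_poly H h -> hardy_poly H h' -> near_derive h h' ->
  (forall C, \forall x \near +oo, C <= h x) ->
  \forall x \near +oo, h x <= ep * x ^+ 2 * h' x.
Proof.
move=> ep0 hh hh' hd hinf.
have := hardy_poly_cmp hH 0 (hardy_polyB hh (hardy_polyZ ep (hardy_polyXn 2 hh'))).
case=> h0; first by apply: filterS h0 => x; rewrite subr_le0 mulrA.
have /(near_pinfty_pos 0)[a a0 ha] := hd.
have /(near_pinfty_pos a)[b ab hb] := h0.
have /(near_pinfty_pos b)[c1 bc1 hc1] := hinf 1.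
have [c [c0 cc1 cep]] : exists c, [/\ 0 < c, c1 <= c & 2 / ep <= c].
  exists (Num.max c1 (2 / ep)); rewrite !le_max !lexx orbT lt_max divr_gt0 ?orbT//.
exfalso.
have [k [k0 kE]] : exists k, 0 < k /\ k = 1 / ep by exists (1 / ep); rewrite divr_gt0.
(* An elementary substitute for the integrating factor exp(k / x): [phi] is nonincreasing as soon as
   [2 * k <= x], and it dominates [h]. *)
pose phi x := h x * (1 + 2 * k * x^-1 ^+ 1).
have hom := @derive_le0_homo phi
  (fun x => h' x * (1 + 2 * k * x^-1 ^+ 1) + h x * (0 + 2 * k * (- 1%:R * x^-1 ^+ 2))) c.
have {}hom : forall x y, c < x -> x <= y -> phi y <= phi x.
  apply: hom => x cx.
    have x0 : x != 0 by rewrite gt_eqF// (lt_trans c0).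
    apply: is_derive_mul.
      by apply: ha; rewrite (lt_trans ab)// (lt_trans bc1)// (le_lt_trans cc1).
    by apply: is_derive_add; apply: is_derive_scale; exact: is_derive_invn.
  have x0 : 0 < x by exact: lt_trans cx.
  have hx : 0 < h x by rewrite (lt_le_trans ltr01)// hc1// (le_lt_trans cc1).
  have := hb x; rewrite (lt_trans bc1 (le_lt_trans cc1 cx)) => /(_ isT).
  rewrite subr_ge0 => up.
  have up' : h' x <= k * h x * x^-1 ^+ 2.
    rewrite -(@ler_pM2l _ (ep * x ^+ 2)) ?mulr_gt0 ?exprn_gt0//.
    apply: (@le_trans _ _ (h x)); first by move: up; rewrite mulrA.
    by rewrite le_eqVlt; apply/orP; left; apply/eqP; rewrite kE; field; rewrite !gt_eqF.
  have kx : 2 * k * x^-1 <= 1.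
    rewrite ler_pdivrMr// mul1r (le_trans _ (ltW cx))// (le_trans _ cep)//.
    by rewrite kE mul1r.
  have w0 : 0 < x^-1 by rewrite invr_gt0.
  move: (x^-1) w0 kx up' => w w0 kx up'; rewrite expr1 add0r mulN1r.
  have hk : 0 < k * h x * w ^+ 2 by apply: mulr_gt0; [exact: mulr_gt0|exact: exprn_gt0].
  have kw0 : 0 < 2 * k * w by apply: mulr_gt0 => //; exact: mulr_gt0.
  have : h' x * (1 + 2 * k * w) <= k * h x * w ^+ 2 * (1 + 2 * k * w).
    by rewrite ler_pM2r//; lra.
  have : k * h x * w ^+ 2 * (1 + 2 * k * w) <= k * h x * w ^+ 2 * 2.
    by rewrite ler_pM2l//; lra.
  lra.
have cc : c < c + 1 by rewrite ltrDl.
have /(near_pinfty_pos (c + 1))[b' bb' hb'] := hinf (phi (c + 1) + 1).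
have b'1 : b' < b' + 1 by rewrite ltrDl.
have := hom (c + 1) (b' + 1) cc (ltW (lt_trans bb' b'1)).
have := hb' _ b'1.
have z0 : 0 < b' + 1 by rewrite (lt_trans _ b'1)// (lt_trans _ bb')// (lt_trans c0).
have hz : 0 < h (b' + 1).
  rewrite (lt_le_trans ltr01)// hc1// (le_lt_trans cc1)// (lt_trans cc)//.
  exact: lt_trans bb' b'1.
have : h (b' + 1) <= phi (b' + 1).
  rewrite /phi ler_peMr ?(ltW hz)// lerDl mulr_ge0 ?mulr_ge0 ?(ltW k0)//.
  by rewrite exprn_ge0// invr_ge0 ltW.
lra.
Qed.

End Growth.

(** * Logarithmic growth, polynomial approximation and mean values of differences *)

Section TaylorLike.
Variable R : realType.
Implicit Types (f g h : R -> R).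

Lemma near_ln_ge (b : R) : \forall x \near +oo, b <= ln x.
Proof.
apply/near_pinftyP; exists (expR b) => x bx.
have x0 : 0 < x by exact: lt_trans (expR_gt0 b) bx.
by rewrite -[b]expRK ler_ln ?posrE ?expR_gt0// ltW.
Qed.

Lemma derive_ge_log f (F : R -> R) (c : R) : 0 < c -> near_derive f F ->
  (\forall x \near +oo, c <= x * F x) -> \forall x \near +oo, c / 2 * ln x <= f x.
Proof.
move=> c0 /(near_pinfty_pos 0)[a a0 ha] /(near_pinfty_pos a)[b ab hb].
pose f1 x := f x - c * ln x.
have hom x y : b < x -> x <= y -> f1 x <= f1 y.
  apply: (@derive_ge0_homo _ f1 (fun x => F x - c * x^-1)) => z bz.
    have z0 : 0 < z by rewrite (lt_trans a0)// (lt_trans ab).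
    apply: is_derive_add; first by apply: ha; exact: lt_trans bz.
    by apply: is_derive_opp; apply: is_derive_scale; exact: is_derive1_ln.
  have z0 : 0 < z by rewrite (lt_trans a0)// (lt_trans ab).
  by rewrite subr_ge0 ler_pdivrMr// mulrC hb.
have b1 : b < b + 1 by rewrite ltrDl.
have h1 := near_ln_ge (- f1 (b + 1) / (c / 2)).
have h2 : \forall x \near +oo, b + 1 < x by apply: nbhs_pinfty_gt; exact: num_real.
apply: filterS2 h1 h2 => x h1 h2.
have := hom _ _ b1 (ltW h2); rewrite {2}/f1.
by rewrite ler_pdivrMr ?divr_gt0// in h1; lra.
Qed.

Lemma derive_bounded_log g (G : R -> R) (C : R) : near_derive g G ->
  (\forall x \near +oo, `|x * G x| <= C) ->
  exists2 C', 0 < C' & \forall x \near +oo, `|g x| <= C' * ln x.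
Proof.
move=> hd hG; pose c : R := Num.max C 0 + 1.
have c0 : 0 < c by rewrite ltr_pwDr// le_max lexx orbT.
have Cc : C <= c by rewrite ler_wpDr// le_max lexx.
have key (s : R) : `|s| <= 1 -> \forall x \near +oo, 0 <= 2 * c * ln x + s * g x.
  move=> s1; have dl : near_derive (fun x => 2 * c * ln x + s * g x) (fun x => 2 * c * x^-1 + s * G x).
    have p : \forall x \near +oo, (0 : R) < x by apply: nbhs_pinfty_gt; exact: num_real.
    apply: filterS2 p hd => x x0 dx.
    by apply: is_derive_add; apply: is_derive_scale => //; exact: is_derive1_ln.
  have := derive_ge_log c0 dl _.
  have p : \forall x \near +oo, (0 : R) < x by apply: nbhs_pinfty_gt; exact: num_real.
  have q : \forall x \near +oo, c <= x * (2 * c * x^-1 + s * G x).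
    apply: filterS2 p hG => x x0 hx.
    have -> : x * (2 * c * x^-1 + s * G x) = 2 * c + s * (x * G x).
      by field; rewrite gt_eqF.
    have : `|s * (x * G x)| <= c.
      rewrite normrM (le_trans _ Cc)// (le_trans _ hx)// ler_piMl//.
    by rewrite ler_norml => /andP[+ _]; lra.
  move=> /(_ q); have := near_ln_ge 0; apply: filterS2 => x l0.
  by apply: le_trans; rewrite mulr_ge0// divr_ge0// ltW.
exists (2 * c); first by rewrite mulr_gt0.
have k1 := key 1 _; have k2 := key (-1) _.
apply: filterS2 (k1 _) (k2 _); rewrite ?normrN ?normr1// => x h1 h2.
by rewrite ler_norml; apply/andP; split; lra.
Qed.

(** Adding and subtracting [C / x ^+ m.+1] gives a nonincreasing [u] and a nondecreasing [v] with
    [v <= u]; the supremum of [v] lies between them and serves as the limit of [h]. *)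
Lemma derive_bounded_limit h (h' : R -> R) (C : R) (m : nat) : 0 <= C ->
  near_derive h h' -> (\forall x \near +oo, `|h' x| * x ^+ m.+2 <= C) ->
  exists c : R, \forall x \near +oo, `|h x - c| * x ^+ m.+1 <= C.
Proof.
move=> C0 /(near_pinfty_pos 0)[a a0 ha] /(near_pinfty_pos a)[b ab hb].
have dw (z : R) : 0 < z -> is_derive z (1 : R) (fun x => C * x^-1 ^+ m.+1) (C * (- m.+1%:R * z^-1 ^+ m.+2)).
  by move=> z0; apply: is_derive_scale; apply: is_derive_invn; rewrite gt_eqF.
have bnd z : b < z -> `|h' z| <= C * (m.+1%:R * z^-1 ^+ m.+2).
  move=> bz; have z0 : 0 < z by rewrite (lt_trans a0)// (lt_trans ab).
  have zk : 0 < z ^+ m.+2 by rewrite exprn_gt0.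
  rewrite exprVn mulrA ler_pdivlMr// (le_trans (hb _ bz))//.
  by rewrite ler_peMr// ler1n.
pose u x := h x + C * x^-1 ^+ m.+1.
pose v x := h x + - (C * x^-1 ^+ m.+1).
have pos z : b < z -> 0 < z by move=> bz; rewrite (lt_trans a0)// (lt_trans ab).
have hu x y : b < x -> x <= y -> u y <= u x.
  apply: (@derive_le0_homo _ u (fun z => h' z + C * (- m.+1%:R * z^-1 ^+ m.+2))) => z bz.
    by apply: is_derive_add; [apply: ha; exact: lt_trans bz|apply: dw; exact: pos].
  by have := bnd z bz; rewrite ler_norml mulNr mulrN => /andP[_]; lra.
have hv x y : b < x -> x <= y -> v x <= v y.
  apply: (@derive_ge0_homo _ v (fun z => h' z + - (C * (- m.+1%:R * z^-1 ^+ m.+2)))) => z bz.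
    apply: is_derive_add; first by apply: ha; exact: lt_trans bz.
    by apply: is_derive_opp; apply: dw; exact: pos.
  by have := bnd z bz; rewrite ler_norml mulNr mulrN => /andP[+ _]; lra.
have vu x : b < x -> v x <= u x.
  move=> /pos x0; rewrite lerD2l ge0_cp// ?mulr_ge0 ?exprn_ge0 ?invr_ge0// ltW//.
have vux x y : b < x -> b < y -> v x <= u y.
  move=> bx bY; case: (leP x y) => [xy|/ltW yx].
    by rewrite (le_trans (hv _ _ bx xy))// vu.
  by rewrite (le_trans (vu _ bx))// hu.
pose S := [set v x | x in [set x | b < x]].
have S0 : S !=set0 by exists (v (b + 1)), (b + 1) => //=; rewrite ltrDl.
have Sub y : b < y -> ubound S (u y) by move=> bY _ [x /= bx <-]; exact: vux.
exists (sup S); apply/near_pinftyP; exists b => x bx.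
have x0 := pos x bx; have xk : 0 < x ^+ m.+1 by rewrite exprn_gt0.
have s1 : v x <= sup S.
  by apply: ub_le_sup; [exists (u x); exact: Sub|exists x].
have s2 : sup S <= u x by apply: ge_sup => //; exact: Sub.
rewrite -ler_pdivlMr// -exprVn ler_norml.
by move: s1 s2; rewrite /u /v; move: (C * _) => w; lra.
Qed.

(** Each integration determines one coefficient of [Q]: the limit of the highest remaining
    derivative gives a monomial, which is subtracted from the whole tower. The bounds stop at
    [j = 1], because integrating [1 / x] once more gives a logarithm; this is where the scale [ln x]
    of condition (i) comes from. *)
Lemma tower_polynomial (d : nat -> R -> R) (s : nat) (C : R) :
  (forall j, near_derive (d j) (d j.+1)) ->
  (\forall x \near +oo, `|d s.+1 x| * x ^+ s.+1 <= C) ->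
  exists (Q : {poly R}) (C' : R), (size Q <= s.+1)%N /\
    \forall x \near +oo, forall j, (0 < j <= s.+1)%N -> `|d j x - Q^`(j).[x]| * x ^+ j <= C'.
Proof.
elim: s d C => [|s IH] d C hd hC.
  exists 0, C; split; first by rewrite size_poly0.
  apply: filterS hC => x hx j; rewrite -eqn_leq => /eqP <-.
  by rewrite derivn_poly0 ?size_poly0// horner0 subr0.
pose C0 := Num.max C 0.
have C00 : 0 <= C0 by rewrite le_max lexx orbT.
have hC0 : \forall x \near +oo, `|d s.+2 x| * x ^+ s.+2 <= C0.
  by apply: filterS hC => x hx; rewrite le_max hx.
have [c hc] := derive_bounded_limit C00 (hd s.+1) hC0.
pose M : {poly R} := (c / s.+1`!%:R) *: 'X^(s.+1).
have M1 : M^`(s.+1) = c%:P.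
  rewrite derivnZ derivnXn subnn ffactnn expr0.
  rewrite [X in _ *: X](_ : _ = (s.+1)`!%:R *: 1); last by rewrite scaler_nat.
  by rewrite scalerA divfK ?alg_polyC// pnatr_eq0 -lt0n fact_gt0.
pose d1 j x := d j x - M^`(j).[x].
have hd1 j : near_derive (d1 j) (d1 j.+1).
  apply: filterS (hd j) => x dx; rewrite /d1 derivnS.
  exact: is_derive_add dx (is_derive_opp (is_derive_poly _ _)).
have [|Q [C1 [sQ hQ]]] := IH d1 C0 hd1.
  by apply: filterS hc => x; rewrite /d1 M1 hornerC.
have sM : (size M <= s.+2)%N by rewrite (leq_trans (size_scale_leq _ _))// size_polyXn.
exists (Q + M), (Num.max C1 C0); split.
  by rewrite (leq_trans (size_polyD _ _))// geq_max sM (leq_trans sQ).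
apply: filterS2 hQ hC0 => x h1 h2 j /andP[j0]; rewrite leq_eqVlt => /orP[/eqP ->|js].
  rewrite derivn_poly0; first by rewrite horner0 subr0 le_max h2 orbT.
  by rewrite (leq_trans (size_polyD _ _))// geq_max sM (leq_trans sQ).
rewrite derivnD hornerD opprD [- _ - _]addrC addrA.
by rewrite le_max h1// j0.
Qed.

(** The induction hypothesis is applied to the tower of differences [d j (x + a) - d j x]; one use
    of the mean value theorem converts the difference of [d k] into a value of [d k.+1]. *)
Lemma iter_dif_mean (k : nat) (d : nat -> R -> R) (x0 a y : R) (n : nat) : 0 < a -> x0 < y ->
  (forall j x, (j < k)%N -> x0 < x -> is_derive x 1 (d j) (d j.+1 x)) ->
  exists2 xi, y + a * n%:R <= xi <= y + a * (n + k)%N%:R &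
    iter k (@dif R) (fun n => d 0%N (y + a * n%:R)) n = a ^+ k * d k xi.
Proof.
move=> a0 xy; elim: k d => [|k IH] d hd.
  by exists (y + a * n%:R); rewrite ?addn0 ?lexx// expr0 mul1r.
pose d1 j x := d j (x + a) - d j x.
have hd1 j x : (j < k)%N -> x0 < x -> is_derive x 1 (d1 j) (d1 j.+1 x).
  move=> jk xx.
  have := hd j (x + a) (ltnW jk) (lt_trans xx (ltr_pwDr a0 (lexx x))).
  have sh : is_derive x 1 (fun z => z + a) (1 + 0 : R).
    exact: is_derive_add (is_derive_id _ _) (is_derive_const _ _).
  move=> h; have h2 : is_derive x 1 (fun z => d j (z + a)) (d j.+1 (x + a)).
    have h3 := is_derive1_comp (g := fun z => z + a) h sh.
    by move: h3; rewrite addr0 mulr1.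
  exact: is_derive_add h2 (is_derive_opp (hd _ _ (ltnW jk) xx)).
have [xi /andP[x1 x2] E] := IH d1 hd1.
have xxi : x0 < xi by rewrite (lt_le_trans xy)// (le_trans _ x1)// lerDl mulr_ge0// ltW.
have [|z /andP[z1 z2] Ez] := @mean_value _ (d k) (d k.+1) xi (xi + a) (ltr_pwDr a0 (lexx xi)).
  by move=> z /andP[z1 _]; apply: hd => //; exact: lt_le_trans z1.
exists z.
  rewrite (le_trans x1 (ltW z1))/= (le_trans (ltW z2))// addnS -natr1 mulrDr mulr1 addrA.
  by rewrite lerD2r.
rewrite iterSr.
have -> : dif (fun n0 => d 0%N (y + a * n0%:R)) = fun n0 => d1 0%N (y + a * n0%:R).
  by apply/funext => m; rewrite /dif /d1 -natr1 mulrDr mulr1 addrA.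
by rewrite E /d1 Ez addrAC subrr add0r exprSr [_ * a]mulrC mulrA.
Qed.

End TaylorLike.

(** * Exponential sums along Hardy functions *)

Section TowerTests.
Variable R : realType.
Implicit Types (ep A lam rho a y : R) (d : nat -> R -> R).

Lemma normc_expi_opp (g : nat -> R) (N : nat) :
  normc (\sum_(0 <= n < N) expi (- g n)) = normc (\sum_(0 <= n < N) expi (g n)).
Proof.
rewrite -[RHS]normc_conj rmorph_sum /=; congr normc.
by apply: eq_bigr => n _; rewrite expiN.
Qed.

(** Mean values turn the hypotheses on differences into hypotheses on derivatives. The step [a] is
    left free for three uses: the integers, a progression of ratio [b], and the grid of step
    [1 / L]. Changing the sign of the phase conjugates the sum, so one sign of the derivative
    suffices. *)
Lemma tower_deriv_test (k : nat) ep A : 0 < ep -> 1 <= A ->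
  exists2 rho, 0 < rho & forall (d : nat -> R -> R) x0 a y lam (N : nat),
    0 < a -> x0 < y -> 0 < lam ->
    (forall j x, (j < k.+2)%N -> x0 < x -> is_derive x 1 (d j) (d j.+1 x)) ->
    (forall x, y <= x <= y + a * (N + k.+2)%N%:R -> lam <= `|d k.+1 x| <= A * lam) ->
    (forall x z, y <= x <= y + a * (N + k.+2)%N%:R -> y <= z <= y + a * (N + k.+2)%N%:R ->
       0 <= d k.+1 x * d k.+1 z) ->
    (forall x, y <= x <= y + a * (N + k.+2)%N%:R -> a * N%:R * `|d k.+2 x| <= A * lam) ->
    a ^+ k.+1 * lam <= rho -> 1 <= rho * (lam * (a * N%:R) ^+ k.+1) ->
    normc (\sum_(0 <= n < N) expi (d 0%N (y + a * n%:R))) <= ep * N%:R.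
Proof.
move=> ep0 A1; have [rho rho0 hrho] := @deriv_testP R k ep A ep0 A1.
exists rho => // d x0 a y lam N a0 xy lam0 hd hb hs hv h1 h2.
have ak0 j : 0 < a ^+ j by rewrite exprn_gt0.
wlog sg : d hd hb hs hv / forall x, y <= x <= y + a * (N + k.+2)%N%:R -> 0 <= d k.+1 x.
  move=> wl; have yy : y <= y <= y + a * (N + k.+2)%N%:R.
    by rewrite lexx/= lerDl mulr_ge0// ltW.
  have [p|n] := leP 0 (d k.+1 y).
    apply: wl => // x hx; have := hs y x yy hx; rewrite pmulr_rge0// lt_neqAle p andbT.
    apply/eqP => E; have /andP[+ _] := hb y yy; rewrite -E normr0; apply/negP.
    by rewrite -ltNge.
  rewrite -normc_expi_opp; apply: (wl (fun j x => - d j x)).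
  - by move=> j x jk xx; apply: is_derive_opp; exact: hd.
  - by move=> x hx; rewrite normrN; exact: hb.
  - by move=> x z hx hz; rewrite mulrNN; exact: hs.
  - by move=> x hx; rewrite normrN; exact: hv.
  - by move=> x hx; rewrite oppr_ge0; have := hs y x yy hx; rewrite nmulr_rge0.
have rng (n i : nat) (x : R) : (n < N)%N -> (i <= k.+2)%N ->
    y + a * n%:R <= x <= y + a * (n + i)%N%:R -> y <= x <= y + a * (N + k.+2)%N%:R.
  move=> nN ik /andP[l1 l2]; apply/andP; split.
    by rewrite (le_trans _ l1)// lerDl mulr_ge0// ltW.
  by rewrite (le_trans l2)// lerD2l ler_pM2l// ler_nat leq_add// ltnW.
apply: (hrho (a ^+ k.+1 * lam)) => //.
- exact: mulr_gt0.
- by apply: (le_trans h2); rewrite ler_pM2l// [(a * _) ^+ _]exprMn mulrCA mulrA.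
- move=> n nN.
  have [x hx ->] := iter_dif_mean (k := k.+1) n a0 xy (fun j x jk => hd j x (ltnW jk)).
  have hx' := rng _ _ _ nN (leqnSn _) hx.
  have /andP[b1 b2] := hb x hx'; rewrite ger0_norm ?sg// in b1 b2.
  by rewrite mulrCA !ler_pM2l// b1 b2.
- have bnd n : (0 <= n < N)%N -> `|iter k.+2 (@dif R) (fun n => d 0%N (y + a * n%:R)) n| <=
      A * (a ^+ k.+1 * lam) / N%:R.
    move=> /andP[_ nN]; have N0 : 0 < N%:R :> R by rewrite ltr0n (leq_ltn_trans _ nN).
    have [x hx ->] := iter_dif_mean (k := k.+2) n a0 xy hd.
    have := hv x (rng _ _ _ nN (leqnn _) hx) => hvx.
    rewrite normrM gtr0_norm// ler_pdivlMr// mulrCA.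
    apply: (@le_trans _ _ (a ^+ k.+1 * (a * N%:R * `|d k.+2 x|))).
      by rewrite le_eqVlt; apply/orP; left; apply/eqP; rewrite exprSr; ring.
    by rewrite ler_pM2l.
  rewrite (le_trans (ler_sum_nat bnd))// sumr_const_nat subn0.
  case: N {hb hs hv h2 sg rng bnd} => [|N].
    by rewrite mulr0n mulr_ge0 ?mulr_ge0 ?(ltW (ak0 _)) ?(ltW lam0)// (le_trans ler01).
  by rewrite -[_ *+ _]mulr_natr divfK// pnatr_eq0.
Qed.

Lemma tower_weyl (r : nat) ep (nu : R) : 0 < ep -> irrational_number nu ->
  exists (N0 : nat) (zeta : R), 0 < zeta /\ forall d x0 a y (N : nat), (N0 <= N)%N ->
    0 < a -> x0 < y ->
    (forall j x, (j < r.+1)%N -> x0 < x -> is_derive x 1 (d j) (d j.+1 x)) ->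
    (forall x, y <= x <= y + a * (N + r.+1)%N%:R -> `|a ^+ r.+1 * d r.+1 x - nu| <= zeta) ->
    normc (\sum_(0 <= n < N) expi (d 0%N (y + a * n%:R))) <= ep * N%:R.
Proof.
move=> ep0 irr; have [N0 [zeta [z0 h]]] := weyl_sumP r ep0 irr.
exists N0, zeta; split=> // d x0 a y N NN a0 xy hd hb.
apply: h => // n nN.
have [x /andP[x1 x2] ->] := iter_dif_mean (k := r.+1) n a0 xy hd.
apply: hb; rewrite (le_trans _ x1)/= ?lerDl ?mulr_ge0 ?(ltW a0)//.
by rewrite (le_trans x2)// lerD2l ler_pM2l// ler_nat leq_add2r ltnW.
Qed.

Lemma sum_tail_le (u : nat -> R[i]) (m M : nat) : (m <= M)%N ->
  (forall n, normc (u n) <= 1) ->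
  normc (\sum_(0 <= n < M) u n) <= m%:R + normc (\sum_(0 <= n < M - m) u (m + n)%N).
Proof.
move=> mM u1; rewrite (@big_cat_nat _ _ _ m)//= (le_trans (normcD_le _ _))// lerD//.
  rewrite (le_trans (normc_sum _ _ _))//.
  by apply: (@le_trans _ _ (\sum_(0 <= n < m) 1)); [exact: ler_sum|rewrite sumr_const_nat subn0].
rewrite -{1}[m]add0n big_addn.
by under eq_bigr do rewrite addnC.
Qed.

Lemma sum_progressions (u : nat -> R[i]) (b N : nat) :
  \sum_(0 <= n < b * N) u n = \sum_(0 <= i < b) \sum_(0 <= t < N) u (i + b * t)%N.
Proof.
rewrite exchange_big_nat /=; elim: N => [|N IH]; first by rewrite muln0 !big_geq.
rewrite mulnS addnC (@big_cat_nat _ _ _ (b * N))//= ?leq_addr// IH.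
rewrite [in RHS]big_nat_recr//=; congr (_ + _).
by rewrite -{1}[(b * N)%N]add0n big_addn addKn.
Qed.

End TowerTests.

(** * Iterated derivatives of a sub-polynomial Hardy function *)

Section HardyTower.
Variables (R : realType) (H : set (R -> R)).
Hypothesis hH : hardy_field H.
Variable alpha : R -> R.
Hypothesis Ha : H alpha.
Variable l0 : nat.
Hypothesis hl : \forall x \near +oo, `|alpha x| <= x ^+ l0.

Definition dtower (j : nat) : R -> R := iter j (fun f => derive1 f) alpha.

Lemma dtowerH j : H (dtower j).
Proof. by elim: j => //= j; exact: hardy_derive. Qed.

Lemma dtower_derive j : near_derive (dtower j) (dtower j.+1).
Proof. exact: hardy_near_derive (dtowerH j). Qed.

Lemma dtower_poly j : hardy_poly H (dtower j).
Proof. exact: hardy_polyH (dtowerH j). Qed.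

Lemma near_forall_ltn (P : nat -> R -> Prop) (k : nat) :
  (forall j, \forall x \near +oo, P j x) ->
  \forall x \near +oo, forall j, (j < k)%N -> P j x.
Proof.
move=> h; elim: k => [|k IH]; first by near=> x.
apply: filterS2 IH (h k) => x h1 h2 j; rewrite ltnS leq_eqVlt => /orP[/eqP->//|]; exact: h1.
Unshelve. all: by end_near. Qed.

Lemma near_gt (b : R) : \forall x \near +oo, b < x.
Proof. by apply: nbhs_pinfty_gt; exact: num_real. Qed.

Lemma exprn_ge_contra (f : R -> R) (c : R) (k : nat) : 0 < c ->
  (\forall x \near +oo, c * x ^+ (l0 + k.+1) <= f x) ->
  (\forall x \near +oo, f x <= x ^+ l0) -> False.
Proof.
move=> c0 h1 h2.
have [b b0 hb] : exists2 b, Num.max 1 c^-1 < b & forall x, b < x -> c * x ^+ (l0 + k.+1) <= x ^+ l0.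
  by apply: near_pinfty_pos; apply: filterS2 h1 h2 => x; exact: le_trans.
have b1 : b < b + 1 by rewrite ltrDl.
move: b0; rewrite gt_max => /andP[lt1b b0].
have l1 : 1 < b + 1 by exact: lt_trans b1.
have p0 : 0 < b + 1 by exact: lt_trans l1.
have := hb _ b1; rewrite exprD mulrCA ger_pMr ?exprn_gt0//.
apply/negP; rewrite -ltNge exprS mulrA.
have : 1 < c * (b + 1) by rewrite -ltr_pdivrMl// mulr1 (lt_trans b0).
move=> cb; rewrite (lt_le_trans cb)// ler_peMr ?exprn_ege1 ?(ltW l1)//.
by rewrite ltW// (lt_trans ltr01).
Qed.

Lemma dtower_opp_derive j : near_derive (fun x => - dtower j x) (fun x => - dtower j.+1 x).
Proof. by apply: filterS (dtower_derive j) => x; exact: is_derive_opp. Qed.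

(** Integrating [c * x ^+ k] from order [j] down to order 0 would give growth of order [k + j], more
    than [alpha] has. The factor [(-1) ^+ s] treats both signs at once. *)
Lemma dtower_ge_contra j k (c : R) (s : bool) : 0 < c ->
  (\forall x \near +oo, c * x ^+ k <= (-1) ^+ s * dtower j x) -> (l0 < k + j)%N -> False.
Proof.
move=> c0 h kj.
have h0 : \forall x \near +oo, (-1) ^+ s * dtower 0 x <= x ^+ l0.
  apply: filterS hl => x; apply: le_trans; rewrite (le_trans (ler_norm _))//.
  by rewrite normrM normrX normrN1 expr1n mul1r.
have hd i : near_derive (fun x => (-1) ^+ s * dtower i x) (fun x => (-1) ^+ s * dtower i.+1 x).
  by apply: filterS (dtower_derive i) => x; exact: is_derive_scale.
have [c' c'0 h'] := @tower_ge_exprn _ (fun i x => (-1) ^+ s * dtower i x) 0 j k c c0 hd h.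
have E : (k + j = l0 + (k + j - l0).-1.+1)%N by rewrite prednK ?subnKC ?subn_gt0// ltnW.
by rewrite E in h'; exact: exprn_ge_contra h' h0.
Qed.

Lemma dtower_upper j : \forall x \near +oo, `|dtower j x| <= x ^+ l0.+1.
Proof.
have hX : hardy_poly H (fun x => x ^+ l0.+1).
  have := hardy_polyXn l0.+1 (hardy_poly_const hH 1).
  by congr hardy_poly; apply/funext => x; rewrite mulr1.
have key (s : bool) : \forall x \near +oo, (-1) ^+ s * dtower j x <= x ^+ l0.+1.
  have := hardy_poly_cmp hH 0 (hardy_polyB (hardy_polyZ ((-1) ^+ s) (dtower_poly j)) hX).
  case=> h; first by apply: filterS h => x; rewrite subr_le0.
  exfalso; apply: (@dtower_ge_contra j l0.+1 1 s) => //; last by rewrite addSn ltnS leq_addr.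
  by apply: filterS h => x; rewrite mul1r subr_ge0.
apply: filterS2 (key false) (key true) => x; rewrite expr0 expr1 mul1r mulN1r => h1 h2.
by rewrite ler_norml lerNl h1 h2.
Qed.

Lemma dtower_small (ep : R) : 0 < ep -> \forall x \near +oo, `|dtower l0.+1 x| <= ep.
Proof.
move=> ep0.
have key (s : bool) : \forall x \near +oo, (-1) ^+ s * dtower l0.+1 x <= ep.
  have := hardy_poly_cmp hH ep (hardy_polyZ ((-1) ^+ s) (dtower_poly l0.+1)).
  case=> h //; exfalso; apply: (@dtower_ge_contra l0.+1 0 ep s) => //.
  by apply: filterS h => x; rewrite expr0 mulr1.
apply: filterS2 (key false) (key true) => x; rewrite expr0 expr1 mul1r mulN1r => h1 h2.
by rewrite ler_norml lerNl h1 h2.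
Qed.

(** The hypothesis keeps the derivative above [x^-1 ^+ j] in size, [dtower_upper] keeps it below a
    power, and [hardy_log_bounded] applies. Bundled together, the conclusions express that the
    derivative is regular across comparable arguments. *)
Lemma dtower_ratio j : (forall C, \forall x \near +oo, C <= `|x ^+ j * dtower j x|) ->
  exists (K : nat), forall L : R, 1 <= L -> \forall b \near +oo,
    forall x y, b < x -> b < y ->
      0 < `|dtower j x| /\ `|x * dtower j.+1 x| <= K%:R * `|dtower j x| /\
      0 <= dtower j x * dtower j y /\
      (x <= L * y -> y <= L * x -> `|dtower j x| <= L ^+ K * `|dtower j y|).
Proof.
move=> hU; pose m := maxn j l0.+1.
have lo : \forall x \near +oo, x^-1 ^+ m <= `|dtower j x|.
  apply: filterS2 (hU 1) (near_gt 1) => x h1 x1.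
  have x0 : 0 < x by exact: lt_trans x1.
  rewrite normrM (gtr0_norm (exprn_gt0 _ x0)) in h1.
  apply: (@le_trans _ _ (x^-1 ^+ j)).
    by rewrite !exprVn lef_pV2 ?posrE ?exprn_gt0// ler_weXn2l ?leq_maxl// ltW.
  by rewrite exprVn -[leLHS]mulr1 ler_pdivrMl ?exprn_gt0.
have hi : \forall x \near +oo, `|dtower j x| <= x ^+ m.
  apply: filterS2 (dtower_upper j) (near_gt 1) => x h1 x1; rewrite (le_trans h1)//.
  by rewrite ler_weXn2l ?leq_maxr// ltW.
have [K [a1 [a10 hK]]] := hardy_log_bounded hH (dtower_poly j) (dtower_poly j.+1)
  (dtower_derive j) lo hi.
exists K => L L1.
have /(near_pinfty_pos a1)[a aa1 ha] := dtower_derive j.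
have a0 : 0 <= a by rewrite (le_trans a10)// ltW.
have hKa : log_bounded (dtower j) (dtower j.+1) K a.
  by move=> x ax; apply: hK; exact: lt_trans ax.
have sg := hardy_poly_sign hH (dtower_poly j).
have [b hb] := log_bounded_ratio a0 L1 ha hKa sg.
have [c hc] : exists c, forall x y, c < x -> c < y -> 0 <= dtower j x * dtower j y.
  case: sg => /near_pinftyP[c hc]; exists c => x y cx cy.
  - by rewrite mulr_ge0// ltW// hc.
  - by rewrite hc// mul0r.
  - by rewrite mulr_le0// ltW// hc.
apply: filterS3 (near_gt a) (near_gt b) (near_gt c) => z az bz cz x y zx zy.
have [p q] := hKa x (lt_trans az zx); split=> //; split=> //; split.
  by apply: hc; exact: lt_trans cz _.
by apply: hb; exact: lt_trans bz _.
Qed.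

(** Arguments between [ep / 2 * M] and [2 * M] are within a factor [L = 2 / ep] of [M], so the
    derivative of order [j.+1] is within a factor [A = L ^+ K0] of its value at [M]. The derivative
    test applies with [lam] equal to the size of [th * dtower alpha j.+1 M] divided by [A]. *)
Lemma tower_sum_small j (ep : R) : 0 < ep -> ep <= 1 ->
  (forall C, \forall x \near +oo, C <= `|x ^+ j.+1 * dtower j.+1 x|) ->
  exists rho K : R, [/\ 0 < rho, 0 < K & \forall z \near +oo,
    forall (M th a y : R) (N : nat), z < M -> 0 < a ->
    ep / 2 * M <= y -> M <= 4 * (a * N%:R) -> y + a * (N + j.+2)%N%:R <= 2 * M ->
    a ^+ j.+1 * `|th * dtower j.+1 M| <= rho -> K <= `|th * dtower j.+1 M| * M ^+ j.+1 ->
    normc (\sum_(0 <= n < N) expi (th * alpha (y + a * n%:R))) <= ep / 4 * N%:R].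
Proof.
move=> ep0 ep1 hU.
have [K0 hK0] := dtower_ratio hU.
have [L [L1 L2 L3]] : exists L : R, [/\ 1 <= L, 2 / ep <= L & 2 <= L].
  exists (2 / ep); split => //; rewrite ler_pdivlMr//; lra.
have [A [A1 AE]] : exists A : R, 1 <= A /\ A = L ^+ K0 by exists (L ^+ K0); rewrite exprn_ege1.
have A0 : 0 < A by exact: lt_le_trans A1.
have k0 : 0 <= 4 * K0%:R / ep by rewrite divr_ge0 ?mulr_ge0// ltW.
have [B [B1 B2 B3]] : exists B : R, [/\ 1 <= B, A ^+ 2 <= B & 4 * K0%:R / ep * A ^+ 2 <= B].
  have A2 : 1 <= A ^+ 2 by rewrite exprn_ege1.
  exists (A ^+ 2 * (1 + 4 * K0%:R / ep)); split.
  - by rewrite mulr_ege1// lerDl.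
  - by rewrite ler_peMr ?lerDl// (le_trans ler01).
  - rewrite [leRHS]mulrC ler_wpM2r ?(le_trans ler01 A2)//; lra.
have ep40 : 0 < ep / 4 by rewrite divr_gt0.
have [rho0 rho00 hrho] := @tower_deriv_test R j (ep / 4) B ep40 B1.
exists rho0, (A * 4 ^+ j.+1 / rho0); split => //.
  by rewrite divr_gt0 ?mulr_gt0 ?exprn_gt0.
have hder := near_forall_ltn j.+2 dtower_derive.
have [x0 x00 hx0] := near_pinfty_pos 0 hder.
have [b bx0 hb] := near_pinfty_pos x0 (hK0 L L1).
have b1 : b < b + 1 by rewrite ltrDl.
have {}hb := hb _ b1.
have b10 : 0 < b + 1 by rewrite (lt_trans _ b1)// (lt_trans x00).
apply: filterS2 (near_gt (b + 1)) (near_gt ((b + 1) * (2 / ep))) => z z1 z2 M th a y N zM a0 yM NM hiM small big.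
have bM : b + 1 < M by exact: lt_trans zM.
have M0 : 0 < M by exact: lt_trans bM.
have by_ : b + 1 < y.
  apply: lt_le_trans yM; rewrite -ltr_pdivrMl ?divr_gt0// invf_div mulrC.
  exact: lt_trans zM.
have th0 : 0 < `|th * dtower j.+1 M|.
  rewrite -(@pmulr_lgt0 _ (M ^+ j.+1)) ?exprn_gt0// (lt_le_trans _ big)//.
  by rewrite divr_gt0 ?mulr_gt0 ?exprn_gt0.
have [lam [lam0 lamE]] : exists lam, 0 < lam /\ `|th * dtower j.+1 M| = A * lam.
  by exists (`|th * dtower j.+1 M| / A); rewrite divr_gt0// mulrCA mulfV ?mulr1// gt_eqF.
have rng x : y <= x <= y + a * (N + j.+2)%N%:R ->
    [/\ b + 1 < x, 0 < x, ep / 2 * M <= x, x <= L * M & M <= L * x].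
  move=> /andP[x1 x2]; have bx : b + 1 < x by exact: lt_le_trans x1.
  have ex : ep / 2 * M <= x by exact: le_trans x1.
  have x0' : 0 < x by exact: lt_trans bx.
  split => //.
    by rewrite (le_trans x2)// (le_trans hiM)// ler_wpM2r// ltW.
  rewrite (@le_trans _ _ (2 / ep * x))// ?ler_wpM2r ?(ltW x0')//.
  by rewrite -ler_pdivrMl ?divr_gt0// invf_div.
have up x : y <= x <= y + a * (N + j.+2)%N%:R -> `|th * dtower j.+1 x| <= A ^+ 2 * lam.
  move=> /rng[bx _ _ l1 l2]; have [_ [_ [_ h]]] := hb x M bx bM.
  by rewrite expr2 -mulrA -lamE !normrM mulrCA ler_wpM2l// AE h.
have /= := hrho (fun i x => th * dtower i x) x0 a y lam N a0; apply => //.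
- by rewrite (lt_trans bx0)// (lt_trans b1).
- by move=> i x ij xx; apply: is_derive_scale; exact: hx0.
- move=> x hx; rewrite (le_trans (up x hx)) ?ler_wpM2r ?(ltW lam0)// andbT.
  have [bx _ _ l1 l2] := rng x hx; have [_ [_ [_ h]]] := hb M x bM bx.
  rewrite -(@ler_pM2l _ A)// -lamE !normrM mulrCA ler_wpM2l// AE.
  exact: h.
- move=> x w hx hw; have [bx _ _ _ _] := rng x hx; have [bw _ _ _ _] := rng w hw.
  have [_ [_ [s _]]] := hb x w bx bw.
  by rewrite mulrACA mulr_ge0// -expr2 sqr_ge0.
- move=> x hx; have [bx x0' ex _ _] := rng x hx; have [_ [h _]] := hb x x bx bx.
  rewrite (le_trans _ (ler_wpM2r (ltW lam0) B3))//.
  have aN : a * N%:R <= 4 / ep * x.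
    rewrite mulrAC ler_pdivlMr//.
    have : a * N%:R <= 2 * M.
      rewrite (le_trans _ hiM)// ler_wpDl//; first by rewrite (le_trans (ltW b10))// ltW.
      by rewrite ler_pM2l// ler_nat leq_addr.
    move=> /(ler_wpM2r (ltW ep0)) /le_trans; apply.
    rewrite (le_trans _ (ler_wpM2l (ler0n _ 4) ex))// le_eqVlt; apply/orP; left; apply/eqP.
    by field.
  rewrite (le_trans (ler_wpM2r (normr_ge0 _) aN))//.
  have -> : 4 / ep * x * `|th * dtower j.+2 x| = 4 / ep * (`|th| * `|x * dtower j.+2 x|).
    by rewrite !normrM (gtr0_norm x0'); ring.
  rewrite (@le_trans _ _ (4 / ep * (`|th| * (K0%:R * `|dtower j.+1 x|))))//.
    by rewrite ler_wpM2l ?divr_ge0 ?(ltW ep0)// ler_wpM2l.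
  have -> : 4 / ep * (`|th| * (K0%:R * `|dtower j.+1 x|)) =
    4 * K0%:R / ep * `|th * dtower j.+1 x| by rewrite normrM; ring.
  by rewrite -[X in _ <= X]mulrA ler_wpM2l// up.
- apply: le_trans small; rewrite ler_pM2l ?exprn_gt0// lamE ler_peMl ?(ltW lam0)//.
- have : A * 4 ^+ j.+1 / rho0 <= A * lam * M ^+ j.+1 by rewrite -lamE.
  rewrite ler_pdivrMr// -!mulrA ler_pM2l// => h.
  have : M ^+ j.+1 <= 4 ^+ j.+1 * (a * N%:R) ^+ j.+1.
    by rewrite -exprMn lerXn2r ?nnegrE ?mulr_ge0 ?(ltW a0) ?(ltW M0).
  move=> h2; rewrite -(@ler_pM2l _ (4 ^+ j.+1 : R)) ?exprn_gt0// mulr1 (le_trans h)//.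
  have -> : lam * (M ^+ j.+1 * rho0) = (rho0 * lam) * M ^+ j.+1 by ring.
  rewrite (le_trans (ler_wpM2l (ltW (mulr_gt0 rho00 lam0)) h2))//.
  by rewrite le_eqVlt; apply/orP; left; apply/eqP; ring.
Qed.

End HardyTower.

(** * Splitting into progressions, and polynomial phases along them *)

Section Progressions.
Variable R : realType.

(** An initial segment of length about [ep / 2 * M], where derivatives are not comparable with those
    at [M], is counted trivially. The rest is cut into residue classes modulo [b], each of which is
    a progression open to the tests. *)
Lemma progression_bound (ep : R) (b : nat) : 0 < ep -> ep <= 1 -> (0 < b)%N ->
  exists M1 : R, forall M : nat, M1 <= M%:R -> forall u : nat -> R[i],
    (forall n, normc (u n) <= 1) ->
    (forall m i N : nat, (i < b)%N -> ep / 2 * M%:R <= m%:R -> M%:R <= 4 * (b%:R * N%:R) :> R ->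
       (m + b * N <= M)%N ->
       normc (\sum_(0 <= t < N) u (m + i + b * t)%N) <= ep / 4 * N%:R) ->
    normc (\sum_(0 <= n < M) u n) <= ep * M%:R.
Proof.
move=> ep0 ep1 b0; exists (8 * b.+1%:R / ep) => M; rewrite ler_pdivrMr// => hM u u1 hu.
have b1 : 1 <= b.+1%:R :> R by rewrite ler1n.
have bb : b.+1%:R = b%:R + 1 :> R by rewrite natr1.
have eM : M%:R * ep <= M%:R by rewrite ler_piMr.
pose m := (Num.truncn (ep / 2 * M%:R)).+1.
have x0 : 0 <= ep / 2 * M%:R by rewrite mulr_ge0// divr_ge0// ltW.
have /andP[m1 m2] := truncn_itv x0.
have hm1 : ep / 2 * M%:R <= m%:R by rewrite ltW.
have hm2 : m%:R <= ep / 2 * M%:R + 1 by rewrite /m -natr1 lerD2r.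
have mM : (m <= M)%N by rewrite -(ler_nat R); lra.
rewrite (le_trans (sum_tail_le mM u1))//.
pose N := ((M - m) %/ b)%N.
have dE := divn_eq (M - m) b; rewrite -/N in dE.
have rb : ((M - m) %% b < b)%N by rewrite ltn_mod.
have hN : (M - m)%:R <= b%:R * N%:R + b%:R :> R.
  by rewrite -natrM -natrD ler_nat dE mulnC leq_add2l ltnW.
rewrite natrB// in hN.
have h4 : M%:R <= 4 * (b%:R * N%:R) :> R by lra.
have bN : (m + b * N <= M)%N by move: dE mM; clear; lia.
have bNR : b%:R * N%:R <= M%:R :> R.
  by rewrite -natrM ler_nat (leq_trans _ bN)// leq_addl.
have s1 : normc (\sum_(0 <= n < b * N) u (m + n)%N) <= ep / 4 * (b%:R * N%:R).
  rewrite sum_progressions (le_trans (normc_sum _ _ _))//.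
  rewrite (_ : ep / 4 * (b%:R * N%:R) = \sum_(0 <= i < b) (ep / 4 * N%:R)); last first.
    by rewrite sumr_const_nat subn0 -[RHS]mulr_natl mulrCA.
  apply: ler_sum_nat => i /andP[_ ib].
  under eq_bigr do rewrite addnA.
  exact: hu.
have s2 : normc (\sum_(0 <= n < M - m) u (m + n)%N) <=
    normc (\sum_(0 <= n < b * N) u (m + n)%N) + b%:R.
  rewrite dE mulnC (@big_cat_nat _ _ _ (b * N))//= ?leq_addr//.
  rewrite (le_trans (normcD_le _ _))// lerD2l (le_trans (normc_sum _ _ _))//.
  apply: (@le_trans _ _ (\sum_(b * N <= n < b * N + (M - m) %% b) 1)).
    exact: ler_sum.
  by rewrite sumr_const_nat addKn ler_nat ltnW.
have : ep / 4 * (b%:R * N%:R) <= ep / 4 * M%:R.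
  by rewrite ler_wpM2l// divr_ge0// ltW.
lra.
Qed.

Lemma common_denominator (c : nat -> R) (k : nat) :
  (forall j, (j < k)%N -> exists p : rat, c j = ratr p) ->
  exists2 b : nat, (0 < b)%N & forall j, (j < k)%N -> exists m : int, b%:R * c j = m%:~R.
Proof.
elim: k => [|k IH] h; first by exists 1%N.
have [b b0 hb] := IH (fun j jk => h j (ltnW jk)).
have [p pE] := h k (ltnSn k).
have dn : denq p = `|denq p|%N :> int by rewrite gez0_abs// ltW// denq_gt0.
exists (b * `|denq p|)%N; first by rewrite muln_gt0 b0 absz_gt0 denq_neq0.
move=> j; rewrite ltnS leq_eqVlt => /orP[/eqP ->|jk].
  exists (b%:Z * numq p); rewrite pE /ratr natrM -mulrA intrM; congr (_ * _).
  rewrite -[`|denq p|%N%:R]/(`|denq p|%N%:Z%:~R) -dn mulrCA divff ?mulr1//.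
  by rewrite intr_eq0 denq_neq0.
have [m mE] := hb j jk; exists (m * `|denq p|%N%:Z).
by rewrite natrM mulrAC mE intrM.
Qed.

Lemma expn_progression (i b t j : nat) : exists k, ((i + b * t) ^ j = i ^ j + b * k)%N.
Proof.
elim: j => [|j [k IH]]; first by exists 0%N; rewrite muln0.
exists (t * (i ^ j + b * k) + i * k)%N; rewrite !expnS IH; lia.
Qed.

Lemma horner_progression (p : {poly R}) (th : R) (b : nat) :
  (forall j, exists m : int, b%:R * (th * p`_j) = m%:~R) ->
  forall i t : nat, exists m : int,
    th * p.[(i + b * t)%N%:R] = th * p.[i%:R] + m%:~R.
Proof.
move=> h i t; rewrite !horner_coef !mulr_sumr.
suff H (n : nat) : exists m : int, \sum_(j < n) th * (p`_j * (i + b * t)%N%:R ^+ j) =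
   \sum_(j < n) th * (p`_j * i%:R ^+ j) + m%:~R by exact: H.
elim: n => [|n [m IH]]; first by exists 0; rewrite !big_ord0 add0r.
have [k kE] := expn_progression i b t n; have [m' m'E] := h n.
exists (m + m' * k%:Z); rewrite !big_ord_recr /= IH -!natrX kE natrD natrM.
rewrite intrD intrM -m'E -[k%:~R]/(k%:R); ring.
Qed.

Lemma horner_bound (p : {poly R}) (n : nat) : (size p <= n.+1)%N ->
  exists2 B, 0 <= B & forall x : R, 1 <= x -> `|p.[x]| <= B * x ^+ n.
Proof.
move=> sp; exists (\sum_(j < size p) `|p`_j|); first exact: sumr_ge0.
move=> x x1; rewrite horner_coef mulr_suml (le_trans (ler_norm_sum _ _ _))//.
apply: ler_sum => j _; rewrite normrM ler_wpM2l// normrX ger0_norm ?(le_trans ler01)//.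
by rewrite ler_weXn2l// -ltnS (leq_trans _ sp).
Qed.

Lemma derivn_top (p : {poly R}) (r : nat) : (size p <= r.+1)%N ->
  p^`(r) = (p`_r *+ r`!)%:P.
Proof.
move=> sp; apply/polyP => i; rewrite coef_derivn coefC.
case: i => [|i]; first by rewrite addn0 ffactnn.
by rewrite (nth_default 0) ?mul0rn// (leq_trans sp)// addnS ltnS leq_addr.
Qed.

End Progressions.

(** * Phases close to a polynomial with an irrational coefficient *)

Section PolynomialCase.
Variable R : realType.
Variables (d : nat -> R -> R) (Q : {poly R}) (s : nat) (C : R).
Hypothesis hd : forall j, near_derive (d j) (d j.+1).
Hypothesis sQ : (size Q <= s.+1)%N.
Hypothesis C0 : 0 <= C.
Hypothesis hQ : \forall x \near +oo, forall j, (0 < j <= s.+1)%N ->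
  `|d j x - Q^`(j).[x]| * x ^+ j <= C.

Variables (th0 : R) (r : nat).
Hypothesis irr : irrational_number (th0 * Q`_r.+1).
Hypothesis rat_above : forall j, (r.+1 < j)%N -> exists p : rat, th0 * Q`_j = ratr p.

(** The part of [Q] above the last irrational coefficient. Times [th0] it has rational coefficients,
    so it is constant modulo 1 along progressions whose ratio is a common denominator. *)
Definition hi : {poly R} := \poly_(j < size Q) (if (r.+1 < j)%N then Q`_j else 0).

Lemma hi_coef j : hi`_j = if (r.+1 < j)%N then Q`_j else 0.
Proof.
rewrite coef_poly; case: ltnP => // sj; case: ifP => // _.
by rewrite nth_default.
Qed.

Lemma hi_progression : exists2 b : nat, (0 < b)%N & forall i t : nat,
  exists m : int, th0 * hi.[(i + b * t)%N%:R] = th0 * hi.[i%:R] + m%:~R.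
Proof.
have [j js|b b0 hb] := @common_denominator R (fun j => th0 * hi`_j) (size Q).
  rewrite hi_coef; case: ifP => [/rat_above//|_].
  by exists 0; rewrite mulr0 rmorph0.
exists b => //; apply: horner_progression => j.
have [js|sj] := ltnP j (size Q); first exact: hb.
by exists 0; rewrite coef_poly ltnNge sj /= !mulr0.
Qed.

Lemma derivn_hi_r x : Q^`(r.+1).[x] - hi^`(r.+1).[x] = Q`_r.+1 *+ (r.+1)`!.
Proof.
rewrite -hornerN -hornerD -derivnN -derivnD derivn_top ?hornerC.
  by rewrite coefB hi_coef ltnn subr0.
apply/leq_sizeP => j jr; rewrite coefB hi_coef jr subrr//.
Qed.

Lemma derivn_hi_top x : (r.+1 < (size Q).-1)%N ->
  hi^`((size Q).-1).[x] = Q^`((size Q).-1).[x].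
Proof.
move=> rd; rewrite !derivn_top ?hornerC ?hi_coef ?rd//.
  by rewrite leqSpred.
by rewrite (leq_trans (size_poly _ _))// leqSpred.
Qed.

(** The derivatives of the phase without its rational part. That part is taken at [th0] and not at
    [th], since only then does it drop out of the exponentials. *)
Definition twr (th : R) (j : nat) (x : R) := th * d j x - th0 * hi^`(j).[x].

Lemma twr_derive th j (x : R) : is_derive x 1 (d j) (d j.+1 x) ->
  is_derive x 1 (twr th j) (twr th j.+1 x).
Proof.
move=> dx; rewrite /twr derivnS.
exact: is_derive_add (is_derive_scale th dx)
  (is_derive_opp (is_derive_scale th0 (is_derive_poly _ _))).
Qed.

Lemma twr_r th x :
  twr th r.+1 x - th0 * Q`_r.+1 *+ (r.+1)`! =
  th * (d r.+1 x - Q^`(r.+1).[x]) + (th - th0) * Q^`(r.+1).[x].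
Proof. by rewrite /twr -mulrnAr -(derivn_hi_r x); ring. Qed.

Lemma twr_top th x : (r.+1 < (size Q).-1)%N ->
  twr th (size Q).-1 x = th * (d (size Q).-1 x - Q^`((size Q).-1).[x])
    + (th - th0) * Q^`((size Q).-1).[x].
Proof. by move=> rd; rewrite /twr derivn_hi_top//; ring. Qed.

Lemma irr_r : (r.+1 <= (size Q).-1)%N.
Proof.
rewrite leqNgt; apply/negP => sr; apply: (@irr 1%N 0) => //.
rewrite nth_default ?mulr0//; apply: leq_trans sr; exact: leqSpred.
Qed.

End PolynomialCase.

(* Either [x |-> (th - th0) * (hi Q r).[x]] oscillates on [0, M], and the derivative test of
   order [deg Q] applies, or it is negligible, and Weyl's test of order [r.+1] does. *)
Lemma poly_tower_sum (R : realType) (d : nat -> R -> R) (Q : {poly R}) (s : nat)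
    (C th0 : R) (r : nat) (ep : R) :
  (forall j, near_derive (d j) (d j.+1)) -> (size Q <= s.+1)%N -> 0 <= C ->
  (\forall x \near +oo, forall j, (0 < j <= s.+1)%N ->
    `|d j x - Q^`(j).[x]| * x ^+ j <= C) ->
  irrational_number (th0 * Q`_r.+1) ->
  (forall j, (r.+1 < j)%N -> exists p : rat, th0 * Q`_j = ratr p) ->
  0 < ep -> ep <= 1 ->
  exists2 delta : R, 0 < delta & \forall z \near +oo, forall (M : nat) (th : R),
    (z : R) < M%:R -> `|th - th0| <= delta ->
    normc (\sum_(0 <= n < M) expi (th * d 0 n%:R)) <= ep * M%:R.
Proof.
move=> hd sQ C0 hQ irr rat_above ep0 ep1; have [b b0 hb] := hi_progression rat_above.
have ep40 : 0 < ep / 4 by rewrite divr_gt0.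
have b0' : 0 < b%:R :> R by rewrite ltr0n.
pose D := (size Q).-1; have rD : (r.+1 <= D)%N := irr_r irr.
have Ds : (D <= s)%N by rewrite /D -ltnS (leq_trans _ sQ)// prednK// size_poly_gt0;
  apply/eqP => Q0; move: rD; rewrite /D Q0 size_poly0.
have [B B0 hB] : exists2 B, 0 <= B & forall x : R, 1 <= x -> `|Q^`(r.+1).[x]| <= B * x ^+ (D - r.+1).
  apply: horner_bound; apply/leq_sizeP => j jD; rewrite coef_derivn nth_default ?mul0rn//.
  by rewrite (leq_trans (leqSpred _))// -/D; move: jD rD; clear; lia.
pose T := `|th0| + 1; have T0 : 0 < T by rewrite ltr_pwDr.
have bk k : 0 < b%:R ^+ k :> R by rewrite exprn_gt0.
have irr2 : irrational_number ((b ^ r.+1 * (r.+1)`!)%N%:R * (th0 * Q`_r.+1)).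
  by apply: irrational_numberM => //; rewrite muln_gt0 expn_gt0 b0 fact_gt0.
have [N0 [zeta [zeta0 hweyl]]] := tower_weyl r ep40 irr2.
have ler13 : (1 : R) <= 3 by lra.
have [rho rho0 hder] := @tower_deriv_test R D.-1 (ep / 4) 3 ep40 ler13.
rewrite prednK in hder; last exact: leq_ltn_trans rD.
pose kap : R := `|Q^`(D).[0]|.
have kapE x : `|Q^`(D).[x]| = kap.
  by rewrite /kap !derivn_top ?hornerC// /D leqSpred.
have kap0 : 0 < kap.
  rewrite /kap derivn_top ?leqSpred// hornerC normr_gt0 mulrn_eq0 negb_or.
  rewrite -lt0n fact_gt0/= -lead_coefE lead_coef_eq0; apply/eqP => Q0.
  by move: rD; rewrite /D Q0 size_poly0.
pose E (k : nat) := T * C * (2 / ep) ^+ k.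
have E0 k : 0 <= E k by rewrite mulr_ge0 ?mulr_ge0 ?exprn_ge0 ?(ltW T0)// divr_ge0// ltW.
(* The threshold for [|th - th0| * M ^+ D]. Above it the derivative of order [D] of [(th - th0) * Q]
   is at least twice the error of the polynomial approximation, and it oscillates enough for the
   derivative test. *)
have [K1 [K10 K1a K1b K1c]] : exists K1, [/\ 0 < K1, 2 * E D <= K1 * kap, 2 * E D.+1 <= K1 * kap &
    2 * 4 ^+ D <= rho * (K1 * kap)].
  exists ((2 * E D + 2 * E D.+1 + 2 * 4 ^+ D / rho) / kap).
  have p4 : 0 < 2 * 4 ^+ D / rho :> R by rewrite divr_gt0// mulr_gt0// exprn_gt0.
  have eD := E0 D; have eD1 := E0 D.+1.
  rewrite divr_gt0//; last by lra.
  rewrite divfK ?gt_eqF//; split=> //; [lra|lra|].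
  rewrite [leRHS]mulrC -ler_pdivrMr//; lra.
pose delta := Num.min 1 (Num.min (2 * rho / (b%:R ^+ D * kap)) (zeta / (2 * (b%:R ^+ r.+1 * (B + 1))))).
have B10 : 0 < B + 1 by rewrite ltr_wpDl.
exists delta.
  by rewrite !lt_min ltr01 !divr_gt0 ?mulr_gt0.
have [M1 hM1] := progression_bound ep0 ep1 b0.
have hder0 : \forall x \near +oo, forall j, (j < D.+2)%N -> is_derive (x : R) (1 : R) (d j) (d j.+1 x).
  exact: near_forall_ltn.
pose X1 := 2 * (T * C * b%:R ^+ r.+1) / zeta.
have [x0 x0X hx0] := near_pinfty_pos (Num.max 1 X1) (filterI hder0 hQ).
move: x0X; rewrite gt_max => /andP[x01 x0X].
have x00 : 0 < x0 by exact: lt_trans x01.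
pose X2 := 2 * (B * 2 ^+ D * K1 * b%:R ^+ r.+1) / zeta.
have e2 : 0 < ep / 2 by rewrite divr_gt0.
apply: filterS3 (near_gt M1) (near_gt (x0 / (ep / 2)))
  (near_gt (Num.max (Num.max 1 X2) (Num.max (4 * (b%:R * N0%:R)) (b%:R * D.+3%:R)))) => z z1 z2.
rewrite !gt_max => /andP[/andP[z3 z4] /andP[z5 z6]] M th zM hth.
apply: hM1 => [|n|m i N ib hm hN hmN]; [by rewrite ltW// (lt_trans z1)|by rewrite normc_expi|].
pose y : R := (m + i)%N%:R.
have M0 : 1 < M%:R :> R by exact: lt_trans zM.
have M00 : 0 < M%:R :> R by exact: lt_trans M0.
(* Along the progression the removed part [th0 * hi] is constant modulo 1, so it only contributes a
   factor of modulus 1. *)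
have -> : normc (\sum_(0 <= t < N) expi (th * d 0%N (m + i + b * t)%N%:R)) =
    normc (\sum_(0 <= t < N) expi (twr d Q th0 r th 0 (y + b%:R * t%:R))).
  rewrite -[RHS]mul1r -[X in _ = X * _](normc_expi (th0 * (hi Q r).[y])) -normcM mulr_sumr; congr normc.
  apply: eq_bigr => t _; have [k kE] := hb (m + i)%N t.
  rewrite -expiD /y -natrM -natrD /twr derivn0 kE.
  rewrite -[RHS](expiD_int _ k); congr expi; ring.
have x0M : x0 < ep / 2 * M%:R by rewrite -ltr_pdivrMl// mulrC (lt_trans z2).
have ym : m%:R <= y by rewrite /y ler_nat leq_addr.
have x0y : x0 < y by rewrite (lt_le_trans x0M)// (le_trans hm).
have yle k : (k <= D.+1)%N -> y + b%:R * (N + k)%N%:R <= 2 * M%:R.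
  move=> kD; have e : y + b%:R * (N + k)%N%:R = (m + b * N + i + b * k)%N%:R.
    by rewrite /y -natrM -natrD; congr (_%:R); clear; lia.
  have h : (m + b * N + i + b * k <= M + b * D.+3)%N by move: hmN ib kD; clear; nia.
  have : b%:R * D.+3%:R < M%:R :> R by exact: lt_trans zM.
  rewrite e -natrM => h2; rewrite (@le_trans _ _ (M + b * D.+3)%N%:R) ?ler_nat//.
  by rewrite natrD; move: h2; clear; lra.
have aN : b%:R * N%:R <= M%:R :> R.
  by rewrite -natrM ler_nat (leq_trans _ hmN)// leq_addl.
have thT : `|th| <= T.
  have -> : th = th0 + (th - th0) by ring.
  by rewrite (le_trans (ler_normD _ _))// lerD2l (le_trans hth)// /delta ge_min lexx.
have err j x : (0 < j <= s.+1)%N -> y <= x ->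
    `|th * (d j x - Q^`(j).[x])| * x ^+ j <= T * C /\
    `|th * (d j x - Q^`(j).[x])| * M%:R ^+ j <= E j.
  move=> js yx; have xx : x0 < x by exact: lt_le_trans yx.
  have xp : 0 < x by exact: lt_trans xx.
  have h := (hx0 x xx).2 j js.
  have h1 : `|th * (d j x - Q^`(j).[x])| * x ^+ j <= T * C.
    by rewrite normrM -mulrA ler_pM// mulr_ge0// exprn_ge0// ltW.
  split=> //; have Mx : M%:R <= 2 / ep * x.
    have -> : 2 / ep * x = (ep / 2)^-1 * x by rewrite invf_div.
    by rewrite ler_pdivlMl// (le_trans hm)// (le_trans ym).
  have : M%:R ^+ j <= (2 / ep) ^+ j * x ^+ j.
    by rewrite -exprMn lerXn2r ?nnegrE ?mulr_ge0 ?invr_ge0 ?(ltW M00) ?(ltW xp) ?(ltW ep0).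
  move=> /(ler_wpM2l (normr_ge0 (th * (d j x - Q^`(j).[x])))) hh.
  rewrite (le_trans hh)// mulrCA /E mulrC ler_wpM2r// exprn_ge0// divr_ge0// ltW//.
have dertw j x : (j < D.+1)%N -> x0 < x -> is_derive (x : R) (1 : R) (twr d Q th0 r th j) (twr d Q th0 r th j.+1 x).
  by move=> jD xx; apply: twr_derive; apply: (hx0 x xx).1; exact: ltnW.
(* Above the threshold the top derivative of the phase is [2 * lam] in modulus up to an error [lam],
   which accounts for the constant 3 in [hder]. When [r.+1 = D] Weyl's test is used for every [th],
   as [delta] alone makes the perturbation negligible. *)
have [/andP[rD1 big]|small] := boolP ((r.+1 < D)%N && (K1 <= `|th - th0| * M%:R ^+ D)).
  have MD : 0 < M%:R ^+ D :> R by rewrite exprn_gt0.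
  have [lam [lam0 lamE]] : exists lam, 0 < lam /\ `|th - th0| * kap = 2 * lam.
    exists (`|th - th0| * kap / 2); split; last by rewrite [RHS]mulrC divfK.
    rewrite divr_gt0// mulr_gt0// -(@pmulr_lgt0 _ (M%:R ^+ D))//.
    exact: lt_le_trans big.
  have lamM : K1 * kap <= 2 * lam * M%:R ^+ D.
    by rewrite -lamE mulrAC ler_wpM2r// ltW.
  have e1 x : y <= x -> `|th * (d D x - Q^`(D).[x])| <= lam.
    move=> yx; have [|_ h] := err D x _ yx; first by rewrite (leq_trans _ rD)//= ltnW.
    rewrite -(@ler_pM2r _ (M%:R ^+ D))// (le_trans h)//.
    by move: K1a lamM; clear; lra.
  have e3 x : y <= x -> b%:R * N%:R * `|twr d Q th0 r th D.+1 x| <= lam.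
    move=> yx; have [|_ h] := err D.+1 x _ yx; first by rewrite ltnS.
    have -> : twr d Q th0 r th D.+1 x = th * (d D.+1 x - Q^`(D.+1).[x]).
      rewrite /twr !derivn_poly0 ?horner0 ?mulr0 ?subr0 ?leqSpred//.
      by rewrite (leq_trans (size_poly _ _))// leqSpred.
    rewrite (@le_trans _ _ (M%:R * `|th * (d D.+1 x - Q^`(D.+1).[x])|)) ?ler_wpM2r//.
    rewrite -(@ler_pM2r _ (M%:R ^+ D))// mulrAC -exprS mulrC (le_trans h)//.
    by move: K1b lamM; clear; lra.
  have vE x : `|(th - th0) * Q^`(D).[x]| = 2 * lam by rewrite normrM kapE.
  have vC x w : Q^`(D).[x] = Q^`(D).[w] by rewrite !derivn_top ?hornerC// leqSpred.
  apply: (hder (twr d Q th0 r th) x0 b%:R y lam N) => //.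
  - move=> x /andP[yx _]; have := e1 x yx; have := vE x; rewrite twr_top//.
    move: (th * _) ((th - th0) * _) => p q qE hp.
    have := ler_normD p q; have := ler_normB (p + q) p.
    by rewrite addrAC subrr add0r qE; move: hp lam0; clear; lra.
  - move=> x w /andP[yx _] /andP[yw _]; have := e1 x yx; have := e1 w yw; have := vE x.
    rewrite !twr_top// (vC w x).
    move: (th * _) (th * _) ((th - th0) * _) => p p' q qE.
    rewrite !ler_norml => /andP[h1 h2] /andP[h3 h4].
    move: qE; case: (leP 0 q) => [q0|q0].
      rewrite ger0_norm// => qE; apply: mulr_ge0; move: h1 h3 qE lam0; clear; lra.
    rewrite ltr0_norm// => qE; apply: mulr_le0; move: h2 h4 qE lam0; clear; lra.
  - move=> x /andP[yx _]; rewrite (le_trans (e3 x yx))// ler_peMl// ltW//.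
  - have : `|th - th0| <= 2 * rho / (b%:R ^+ D * kap).
      by rewrite (le_trans hth)// /delta !ge_min lexx !orbT.
    rewrite ler_pdivlMr ?mulr_gt0// mulrCA lamE; clear; lra.
  - have h4 : M%:R ^+ D <= 4 ^+ D * (b%:R * N%:R) ^+ D :> R.
      by rewrite -exprMn lerXn2r ?nnegrE ?mulr_ge0.
    have h40 : 0 < 4 ^+ D :> R by rewrite exprn_gt0.
    rewrite -(@ler_pM2l _ (2 * 4 ^+ D : R)) ?mulr_gt0// mulr1 (le_trans K1c)//.
    have -> : 2 * 4 ^+ D * (rho * (lam * (b%:R * N%:R) ^+ D)) =
      rho * (2 * lam * (4 ^+ D * (b%:R * N%:R) ^+ D)) by clear; ring.
    rewrite ler_pM2l// (le_trans lamM)// ler_wpM2l// mulr_ge0// ltW//.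
have zt : 0 <= `|th - th0| by [].
have rs1 : (0 < r.+1 <= s.+1)%N.
  by rewrite ltn0Sn; apply: leqW; exact: leq_trans Ds.
apply: (hweyl (twr d Q th0 r th) x0 b%:R y N) => //.
- rewrite -(ler_nat R) -(@ler_pM2l _ b%:R)//.
  have : 4 * (b%:R * N0%:R) < M%:R :> R by exact: lt_trans zM.
  by move: hN; clear; lra.
- by move=> j x jr; apply: dertw; rewrite ltnS ltnW// (leq_trans jr).
move=> x /andP[yx xy]; have xx : x0 < x by exact: lt_le_trans yx.
have x1 : 1 < x by exact: lt_trans xx.
have xp : 0 < x by exact: lt_trans x1.
have x2M : x <= 2 * M%:R by rewrite (le_trans xy)// yle// ltnS ltnW.
rewrite natrM natrX -mulrA mulr_natl -mulrBr twr_r normrM (gtr0_norm (bk _)).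
have [f1 _] := err r.+1 x rs1 yx.
have t1 : b%:R ^+ r.+1 * `|th * (d r.+1 x - Q^`(r.+1).[x])| <= zeta / 2.
  have f2 : `|th * (d r.+1 x - Q^`(r.+1).[x])| * x <= T * C.
    by rewrite (le_trans _ f1)// ler_wpM2l// exprS ler_peMr ?exprn_ege1// ltW.
  have X1x : X1 < x by exact: lt_trans xx.
  move: X1x; rewrite /X1 ltr_pdivrMr// => X1x.
  rewrite -(@ler_pM2r _ x)// -mulrA.
  rewrite (le_trans (ler_wpM2l (ltW (bk r.+1)) f2))//.
  by move: X1x; clear; lra.
have t2 : b%:R ^+ r.+1 * `|(th - th0) * Q^`(r.+1).[x]| <= zeta / 2.
  have q1 := hB x (ltW x1); rewrite normrM.
  move: small; rewrite negb_and -leqNgt -ltNge => /orP[Dr|small].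
    have e : (D - r.+1 = 0)%N by apply/eqP; rewrite subn_eq0.
    rewrite e expr0 mulr1 in q1.
    have q2 : `|th - th0| <= zeta / (2 * (b%:R ^+ r.+1 * (B + 1))).
      by rewrite (le_trans hth)// /delta !ge_min lexx !orbT.
    move: q2; rewrite ler_pdivlMr ?mulr_gt0// => q2.
    have q3 : `|Q^`(r.+1).[x]| <= B + 1 by rewrite (le_trans q1)// lerDl.
    have := ler_wpM2l (mulr_ge0 (ltW (bk r.+1)) zt) q3.
    by move: q2; rewrite -mulrA; clear; lra.
  have q2 : `|th - th0| * (B * x ^+ (D - r.+1)) <= B * 2 ^+ D * K1 / M%:R.
    have q3 : x ^+ (D - r.+1) <= 2 ^+ D * M%:R ^+ (D - r.+1).
      rewrite (@le_trans _ _ ((2 * M%:R) ^+ (D - r.+1)))//.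
        by rewrite lerXn2r ?nnegrE ?mulr_ge0 ?(ltW xp).
      rewrite exprMn ler_wpM2r ?exprn_ge0// ler_weXn2l ?leq_subr//; clear; lra.
    have q4 : `|th - th0| * M%:R ^+ (D - r.+1) * M%:R <= K1.
      rewrite (le_trans _ (ltW small))// -mulrA ler_wpM2l// -exprSr ler_weXn2l ?(ltW M0)//.
      by move: rD; clear; lia.
    rewrite ler_pdivlMr// (@le_trans _ _ (`|th - th0| * (B * (2 ^+ D * M%:R ^+ (D - r.+1))) * M%:R))//.
      by rewrite ler_wpM2r// ler_wpM2l// ler_wpM2l.
    have -> : `|th - th0| * (B * (2 ^+ D * M%:R ^+ (D - r.+1))) * M%:R =
       B * 2 ^+ D * (`|th - th0| * M%:R ^+ (D - r.+1) * M%:R) by clear; ring.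
    by rewrite ler_wpM2l// mulr_ge0// exprn_ge0.
  have q5 : X2 < M%:R by exact: lt_trans zM.
  rewrite (le_trans (ler_wpM2l (ltW (bk _)) (ler_wpM2l zt q1)))//.
  rewrite (le_trans (ler_wpM2l (ltW (bk _)) q2))//.
  move: q5; rewrite /X2 ltr_pdivrMr// => q5.
  rewrite mulrA ler_pdivrMr//; move: q5; clear; lra.
rewrite (le_trans (ler_wpM2l (ltW (bk _)) (ler_normD _ _)))// mulrDr.
by move: t1 t2; clear; lra.
Qed.

Lemma not_rat_irrational (R : realType) (nu : R) :
  ~ (exists p : rat, nu = ratr p) -> irrational_number nu.
Proof.
move=> nrat h m h0 E; apply: nrat; exists (m%:~R / h%:R).
by rewrite fmorph_div /= ratr_int ratr_nat -E mulrC mulKf// pnatr_eq0 -lt0n.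
Qed.

(** * Smallness of the sums, locally and uniformly in the frequency *)

Section LocalSums.
Variables (R : realType) (H : set (R -> R)).
Hypothesis hH : hardy_field H.
Variable alpha : R -> R.
Hypothesis Ha : H alpha.
Variable l0 : nat.
Hypothesis hl : \forall x \near +oo, `|alpha x| <= x ^+ l0.

Notation D := (dtower alpha).

Lemma unbounded_or_bounded j :
  (exists C, \forall x \near +oo, `|x ^+ j * D j x| <= C) \/
  (forall C, \forall x \near +oo, C <= `|x ^+ j * D j x|).
Proof.
case: (hardy_poly_trichotomy hH (hardy_polyXn j (dtower_poly hH Ha j))) => h.
- by left.
- by right => C; apply: filterS (h C) => x hx; rewrite (le_trans hx)// ler_norm.
- right => C; apply: filterS (h C) => x hx; rewrite (le_trans hx)//.
  by rewrite -normrN ler_norm.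
Qed.

Definition small_sum (ep th : R) (M : nat) :=
  normc (\sum_(0 <= n < M) expi (th * alpha n%:R)) <= ep * M%:R.

Lemma unbounded_small_sum j (ep : R) : 0 < ep -> ep <= 1 ->
  (forall C, \forall x \near +oo, C <= `|x ^+ j.+1 * D j.+1 x|) ->
  exists rho K : R, [/\ 0 < rho, 0 < K & \forall z \near +oo,
    forall (M : nat) (th : R), (z : R) < M%:R -> `|th * D j.+1 M%:R| <= rho ->
      K <= `|th * D j.+1 M%:R| * M%:R ^+ j.+1 -> small_sum ep th M].
Proof.
move=> ep0 ep1 hU.
have [rho [K [rho0 K0 hz]]] := tower_sum_small hH Ha hl ep0 ep1 hU.
exists rho, K; split => //.
have [M1 hM1] := progression_bound ep0 ep1 (ltn0Sn 0).
apply: filterS3 hz (near_gt M1) (near_gt j.+2%:R) => z hz z1 z2 M th zM h1 h2.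
apply: hM1 => [|n|m i N]; [by rewrite ltW// (lt_trans z1)|by rewrite normc_expi|].
rewrite ltnS leqn0 => /eqP -> hm hN hmN.
rewrite (eq_bigr (fun t : nat => expi (th * alpha (m%:R + 1 * t%:R)))); last first.
  by move=> t _; rewrite addn0 mul1n natrD mul1r.
apply: (hz M%:R) => //.
  rewrite mul1r -natrD (@le_trans _ _ (M + j.+2)%N%:R)//.
    by rewrite ler_nat addnA leq_add2r; move: hmN; rewrite mul1n.
  rewrite natrD; have : j.+2%:R <= M%:R :> R by rewrite ltW// (lt_trans z2).
  lra.
by rewrite expr1n mul1r.
Qed.

(** In the first alternative the derivative of order [j.+1] causes only bounded oscillation on
    [[0, M]]. Descending to [j = 0] leaves the one range of frequencies where the sum need not be
    small, namely where [th * alpha' M * M] is bounded. *)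
Definition dichotomy_at (ep : R) (j : nat) := exists K tau : R, [/\ 0 < K, 0 < tau &
  \forall z \near +oo, forall (M : nat) (th : R), (z : R) < M%:R -> `|th| <= tau ->
    `|th * D j.+1 M%:R| * M%:R ^+ j.+1 <= K \/ small_sum ep th M].

(** If the derivative of order [j.+1] times [x ^+ j.+1] is unbounded, the test of order [j.+1]
    applies unless [th] times that derivative exceeds [rho]. For a bounded derivative a small [tau]
    excludes this. Otherwise [hardy_derive_ge] bounds it by [rho / K' * x ^+ 2] times the next
    derivative, to which the dichotomy one level up applies. *)
Lemma dichotomy_step (ep : R) (j : nat) : 0 < ep -> ep <= 1 ->
  (exists C, \forall x \near +oo, `|D j.+1 x| <= C) \/ dichotomy_at ep j.+1 ->
  dichotomy_at ep j.
Proof.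
move=> ep0 ep1 hyp; case: (unbounded_or_bounded j.+1) => [[C hC]|hU].
  have [x0 x00 hx] := near_pinfty_pos 0 hC.
  exists (Num.max C 0 + 1), 1; split => //.
    by rewrite ltr_pwDr// le_max lexx orbT.
  apply: filterS (near_gt x0) => z z0 M th zM th1; left.
  have x0M : x0 < M%:R by exact: lt_trans zM.
  have M0 : 0 <= M%:R ^+ j.+1 :> R by rewrite exprn_ge0.
  have := hx _ x0M; rewrite normrM (ger0_norm M0) mulrC => h.
  rewrite normrM -mulrA (@le_trans _ _ (1 * C))//; first by rewrite ler_pM// mulr_ge0.
  by rewrite mul1r ler_wpDr// le_max lexx.
have [rho [K [rho0 K0 hs]]] := unbounded_small_sum ep0 ep1 hU.
have key : (exists C, \forall x \near +oo, `|D j.+1 x| <= C) -> dichotomy_at ep j.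
  move=> [C /(near_pinfty_pos 0)[x0 x00 hx]].
  pose C1 := Num.max C 0 + 1.
  have C10 : 0 < C1 by rewrite ltr_pwDr// le_max lexx orbT.
  have CC1 : C <= C1 by rewrite ler_wpDr// le_max lexx.
  exists K, (rho / C1); split => //; first by rewrite divr_gt0.
  apply: filterS2 hs (near_gt x0) => z hz z0 M th zM th1.
  have x0M : x0 < M%:R by exact: lt_trans zM.
  have [|/ltW big] := leP (`|th * D j.+1 M%:R| * M%:R ^+ j.+1) K; first by left.
  right; apply: hz => //; rewrite normrM.
  rewrite (@le_trans _ _ (rho / C1 * C1))//; last by rewrite divfK// gt_eqF.
  by rewrite ler_pM// (le_trans (hx _ x0M)).
case: hyp => // -[K' [tau [K'0 tau0 h']]].
have hN f : hardy_poly H f -> hardy_poly H (fun x => - f x).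
  move=> hf; have := hardy_polyZ (-1) hf.
  by congr hardy_poly; apply/funext => x; rewrite mulN1r.
have [hB|hD] : (exists C, \forall x \near +oo, `|D j.+1 x| <= C) \/
    \forall x \near +oo, `|D j.+1 x| <= rho / K' * x ^+ 2 * `|D j.+2 x|.
  have e0 : 0 < rho / K' by rewrite divr_gt0.
  have pos : \forall x \near +oo, 0 <= rho / K' * x ^+ 2.
    by near=> x; rewrite mulr_ge0 ?sqr_ge0// ltW.
  case: (hardy_poly_trichotomy hH (dtower_poly hH Ha j.+1)) => h; first by left.
    right; have h2 := hardy_derive_ge hH e0 (dtower_poly hH Ha j.+1) (dtower_poly hH Ha j.+2)
      (dtower_derive hH Ha j.+1) h.
    apply: filterS3 (h 0) h2 pos => x h1 h3 p; rewrite ger0_norm// (le_trans h3)//.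
    by rewrite ler_wpM2l// ler_norm.
  right; have h2 := hardy_derive_ge hH e0 (hN _ (dtower_poly hH Ha j.+1))
    (hN _ (dtower_poly hH Ha j.+2)) (dtower_opp_derive hH Ha j.+1) h.
  apply: filterS3 (h 0) h2 pos => x h1 h3 p; rewrite -normrN ger0_norm// (le_trans h3)//.
  by rewrite ler_wpM2l// -normrN ler_norm.
  exact: key.
have [x0 x00 hx] := near_pinfty_pos 1 hD.
exists K, tau; split => //; apply: filterS3 hs h' (near_gt x0) => z hz hz' z0 M th zM th1.
have x0M : x0 < M%:R by exact: lt_trans zM.
have M1 : 1 < M%:R :> R by exact: lt_trans x0M.
have [|/ltW big] := leP (`|th * D j.+1 M%:R| * M%:R ^+ j.+1) K; first by left.
right; have [le|//] := hz' M th zM th1; apply: hz => //.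
have h1 := hx _ x0M; rewrite normrM (le_trans (ler_wpM2l (normr_ge0 th) h1))//.
have -> : `|th| * (rho / K' * M%:R ^+ 2 * `|D j.+2 M%:R|) =
  rho / K' * (`|th * D j.+2 M%:R| * M%:R ^+ 2) by rewrite normrM; ring.
rewrite mulrAC ler_pdivrMr// ler_pM2l// (le_trans _ le)// ler_wpM2l//.
by rewrite ler_weXn2l// ltW.
Unshelve. all: by end_near. Qed.

Lemma dichotomy_near0 (ep : R) : 0 < ep -> ep <= 1 -> dichotomy_at ep 0.
Proof.
move=> ep0 ep1.
have : dichotomy_at ep l0.
  apply: dichotomy_step => //; left; exists 1; exact: (dtower_small hH Ha hl ltr01).
elim: l0 => // k IH h; apply: IH; apply: dichotomy_step => //; by right.
Qed.

Hypothesis hi1 : forall (p : {poly rat}) (c C : R),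
  \forall x \near +oo, C <= `|alpha x - c * (map_poly ratr p).[x]| / ln x.

Lemma irrational_coef (Q : {poly R}) (th0 C : R) : th0 != 0 ->
  (\forall x \near +oo, `|x * (D 1 x - Q^`().[x])| <= C) ->
  exists r, irrational_number (th0 * Q`_r.+1) /\
    forall j, (r.+1 < j)%N -> exists p : rat, th0 * Q`_j = ratr p.
Proof.
move=> th00 hC.
pose P j := (0 < j)%N && ~~ `[< exists p : rat, th0 * Q`_j = ratr p >].
have ub j : P j -> (j <= size Q)%N.
  move=> /andP[_]; apply: contraR; rewrite -ltnNge => sj; apply/asboolP.
  by exists 0; rewrite nth_default ?mulr0 ?rmorph0// ltnW.
case: (pselect (exists j, P j)) => [exP|nP].
  have [j Pj jmax] := ex_maxnP exP ub.
  have /andP[j0 /asboolPn nr] := Pj; case: j j0 nr {Pj} jmax => // r _ nr jmax.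
  exists r; split; first exact: not_rat_irrational.
  move=> j rj; apply: contrapT => nrj.
  have : (j <= r.+1)%N.
    by apply: jmax; rewrite /P (leq_trans _ rj)//=; apply/asboolPn.
  by rewrite leqNgt rj.
exfalso.
have hrat j : exists p : rat, (0 < j)%N -> th0 * Q`_j = ratr p.
  case: j => [|j]; first by exists 0.
  apply: contrapT => nr; apply: nP; exists j.+1; rewrite /P /=; apply/asboolPn => -[p pE].
  by apply: nr; exists p.
have [f hf] := choice hrat.
pose p : {poly rat} := \poly_(j < size Q) (if j == 0%N then 0 else f j).
have pE x : th0^-1 * (map_poly ratr p).[x] = Q.[x] - Q`_0.
  have -> : Q.[x] - Q`_0 = (Q - (Q`_0)%:P).[x] by rewrite hornerD hornerN hornerC.
  rewrite -hornerZ; congr horner; apply/polyP => j.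
  rewrite coefZ coef_map /= coefB coefC coef_poly.
  case: ltnP => js; last first.
    rewrite rmorph0 mulr0 [Q`_j]nth_default//; case: eqP => [j0|_]; last by rewrite subr0.
    have -> : Q`_0 = 0 by apply: nth_default; move: js; rewrite j0.
    by rewrite subr0.
  case: eqP => [->|/eqP j0]; first by rewrite rmorph0 mulr0 subrr.
  by rewrite -hf ?lt0n// mulKf// subr0.
pose g x := alpha x - Q.[x].
have dg : near_derive g (fun x => D 1 x - Q^`().[x]).
  apply: filterS (dtower_derive hH Ha 0) => x dx.
  exact: is_derive_add dx (is_derive_opp (is_derive_poly _ _)).
have [C' C'0 hg] := derive_bounded_log dg hC.
have := hi1 p th0^-1 (C' + `|Q`_0| + 1).
move=> h1; have : \forall x \near (+oo : set_system R), False; last first.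
  by case/near_pinftyP => a /(_ (a + 1)); apply; rewrite ltrDl.
apply: filterS3 h1 hg (near_ln_ge 1) => x h1 h2 h3.
have ln0 : 0 < ln x by exact: lt_le_trans h3.
move: h1; rewrite ler_pdivlMr// pE.
have -> : alpha x - (Q.[x] - Q`_0) = g x + Q`_0 by rewrite /g; ring.
move=> h1; have := le_trans h1 (ler_normD _ _).
have : `|Q`_0| <= `|Q`_0| * ln x by rewrite ler_peMr.
lra.
Qed.

(** The order [l0.+1] is decisive since that derivative tends to 0. If its product with [x ^+ l0.+1]
    is unbounded, the derivative test of this order covers a neighbourhood of [th0]; if it is
    bounded, [alpha] is close to a polynomial and Weyl's method takes over. *)
Lemma small_sum_near (th0 ep : R) : 0 < ep -> ep <= 1 -> th0 != 0 ->
  exists2 delta : R, 0 < delta & \forall z \near +oo, forall (M : nat) (th : R),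
    (z : R) < M%:R -> `|th - th0| <= delta -> small_sum ep th M.
Proof.
move=> ep0 ep1 th00; case: (unbounded_or_bounded l0.+1) => [[C hC]|hU].
  have hC' : \forall x \near +oo, `|D l0.+1 x| * x ^+ l0.+1 <= C.
    apply: filterS2 hC (near_gt 0) => x + x0.
    by rewrite normrM mulrC (ger0_norm (exprn_ge0 _ (ltW x0))).
  have [Q [C1 [sQ hQ]]] := tower_polynomial (dtower_derive hH Ha) hC'.
  have hQ2 : \forall x \near +oo, forall j, (0 < j <= l0.+1)%N ->
      `|D j x - Q^`(j).[x]| * x ^+ j <= Num.max C1 0.
    by apply: filterS hQ => x h j /h; rewrite le_max => ->.
  have [|r [irr hrat]] := @irrational_coef Q th0 C1 th00.
    apply: filterS2 hQ (near_gt 0) => x /(_ 1%N isT) + x0.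
    by rewrite expr1 derivn1 normrM mulrC (gtr0_norm x0).
  have m0 : 0 <= Num.max C1 0 by rewrite le_max lexx orbT.
  exact: (@poly_tower_sum R D Q l0 _ th0 r ep (dtower_derive hH Ha) sQ m0 hQ2 irr hrat ep0 ep1).
have [rho [K [rho0 K0 hs]]] := unbounded_small_sum ep0 ep1 hU.
have t0 : 0 < `|th0| by rewrite normr_gt0.
exists (`|th0| / 2); first by rewrite divr_gt0.
have r2 : 0 < rho / (2 * `|th0|) by rewrite divr_gt0// mulr_gt0.
have [x0 x00 hx0] := near_pinfty_pos 0 (dtower_small hH Ha hl r2).
have [x1 x01 hx1] := near_pinfty_pos x0 (hU (2 * K / `|th0|)).
apply: filterS2 hs (near_gt x1) => z hz z1 M th zM hth.
have x1M : x1 < M%:R by exact: lt_trans zM.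
have M0 : 0 < M%:R :> R by rewrite (lt_trans _ x1M)// (lt_trans x00).
have u1 : `|th| <= 2 * `|th0|.
  have -> : th = th0 + (th - th0) by ring.
  by rewrite (le_trans (ler_normD _ _))//; lra.
have u2 : `|th0| / 2 <= `|th|.
  have E : th0 = th - (th - th0) by ring.
  have := ler_normB th (th - th0); rewrite -E; lra.
apply: hz => //; rewrite normrM.
  rewrite (@le_trans _ _ (2 * `|th0| * (rho / (2 * `|th0|))))//.
    by rewrite ler_pM// hx0// (lt_trans x01).
  by rewrite mulrC divfK// gt_eqF// mulr_gt0.
have := hx1 _ x1M; rewrite normrM (ger0_norm (exprn_ge0 _ (ltW M0))) [leRHS]mulrC => h.
rewrite -mulrA (@le_trans _ _ (`|th0| / 2 * (2 * K / `|th0|)))//.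
  by rewrite le_eqVlt; apply/orP; left; apply/eqP; field; rewrite gt_eqF.
by rewrite ler_pM// divr_ge0// mulr_ge0// ltW.
Qed.

(** Every frequency has a neighbourhood on which the alternative holds for all large [M]: near 0 by
    the descent, elsewhere by [small_sum_near]. Compactness of [[-T, T]] makes the bound on [M]
    uniform, while [K] comes from the neighbourhood of 0 and does not depend on [T]. *)
Lemma dichotomy_uniform (ep : R) : 0 < ep -> ep <= 1 ->
  exists2 K : R, 0 < K & forall T : R, \forall M \near \oo, forall th : R, `|th| <= T ->
    `|th * D 1 M%:R| * M%:R <= K \/ small_sum ep th M.
Proof.
move=> ep0 ep1; have [K [tau [K0 tau0 h0]]] := dichotomy_near0 ep0 ep1.
exists K => // T.
pose P (M : nat) (th : R) := `|th * D 1 M%:R| * M%:R <= K \/ small_sum ep th M.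
have cover : near_covering `[- T, T].
  by apply/compact_near_coveringP; exact: segment_compact.
have key th0 : exists2 delta : R, 0 < delta & \forall z \near +oo, forall (M : nat) (th : R),
    (z : R) < M%:R -> `|th - th0| <= delta -> P M th.
  have [->|th00] := eqVneq th0 0.
    exists tau => //; apply: filterS h0 => z hz M th zM; rewrite subr0 => /(hz M th zM).
    by rewrite expr1.
  have [delta d0 h] := small_sum_near ep0 ep1 th00.
  by exists delta => //; apply: filterS h => z hz M th zM hth; right; exact: hz.
have := cover nat (nbhs \oo) P _ _; move=> /(_ _) h.
have {}h : \forall M \near \oo, `[- T, T]%classic `<=` P M.
  apply: cover => th0 _; have [delta d0 /near_pinftyP[z hz]] := key th0.
  have z1 : z < z + 1 by rewrite ltrDl.
  exists ([set th | `|th - th0| <= delta], [set M | z + 1 < M%:R]) => /=.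
    split.
      apply/nbhs_ballP; exists delta => // th; rewrite /ball /= distrC; exact: ltW.
    exact: nbhs_infty_gtr.
  by move=> [th M] /= [h1 h2]; apply: (hz _ z1).
apply: filterS h => M hM th thT; apply: hM; rewrite /= in_itv /=.
by rewrite -ler_norml.
Qed.

End LocalSums.

(** * Integer sampling against fine sampling *)

Section Comparison.
Variables (R : realType) (H : set (R -> R)).
Hypothesis hH : hardy_field H.
Variable alpha : R -> R.
Hypothesis Ha : H alpha.
Variable l0 : nat.
Hypothesis hl : \forall x \near +oo, `|alpha x| <= x ^+ l0.
Hypothesis hsup : forall C : R, \forall x \near +oo, C * x <= alpha x.

Notation D := (dtower alpha).

Lemma ln_le_id (x : R) : 0 < x -> ln x <= x.
Proof.
move=> x0; have := @le_ln1Dx R (x - 1) _.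
rewrite ltrBrDl subrr => /(_ x0); rewrite addrC subrK => h; lra.
Qed.

Lemma unbounded_derive C : \forall x \near +oo, C <= `|x ^+ 1 * D 1 x|.
Proof.
case: (unbounded_or_bounded hH Ha 1) => [[B hB]|//]; exfalso.
have [B' B'0 hB'] : exists2 B' : R, 0 < B' & \forall x \near +oo, `|alpha x| <= B' * ln x.
  exact: (derive_bounded_log (dtower_derive hH Ha 0) hB).
have : \forall x \near (+oo : set_system R), False; last first.
  by case/near_pinftyP => a /(_ (a + 1)); apply; rewrite ltrDl.
apply: filterS3 hB' (hsup (B' + 1)) (near_gt 0) => x h1 h2 x0.
have h3 := le_trans (ler_norm _) h1.
have : B' * ln x <= B' * x by rewrite ler_wpM2l ?ln_le_id// ltW.
lra.
Qed.

(** The first-order test on the grid of step [1 / L]: refining the grid makes the phase increment as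
    small as desired, and the total oscillation [th * alpha' M * M] does not change. No higher
    derivative is needed, but [L0] depends on [M]. *)
Lemma fine_sum (ep : R) : 0 < ep -> ep <= 1 ->
  exists2 K : R, 0 < K & forall T : R, \forall z \near +oo, forall M : nat, (z : R) < M%:R ->
    exists L0 : nat, forall (L : nat) (th : R), (L0 < L)%N -> `|th| <= T ->
      K <= `|th * D 1 M%:R| * M%:R ->
      normc (\sum_(0 <= k < L * M) expi (th * alpha (k%:R / L%:R))) <= ep * (L%:R * M%:R).
Proof.
move=> ep0 ep1; have [rho [K [rho0 K0 hz]]] := tower_sum_small hH Ha hl ep0 ep1 unbounded_derive.
exists K => // T.
apply: filterS2 hz (near_gt (8 / ep)) => z hz z1 M zM.
pose L0 := (Num.truncn (T * `|D 1 M%:R| / rho)).+1.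
exists L0 => L th LL thT hK.
have L0' : 0 < L%:R :> R by rewrite ltr0n (leq_ltn_trans _ LL).
have M8 : 8 < M%:R * ep by rewrite -ltr_pdivrMr// (lt_trans z1).
have eM : M%:R * ep <= M%:R by rewrite ler_piMr.
pose m := (Num.truncn (ep / 2 * M%:R)).+1.
have x0 : 0 <= ep / 2 * M%:R by rewrite mulr_ge0// divr_ge0// ltW.
have /andP[m1 m2] := truncn_itv x0.
have hm1 : ep / 2 * M%:R <= m%:R by rewrite ltW.
have hm2 : m%:R <= ep / 2 * M%:R + 1 by rewrite /m -natr1 lerD2r.
have mM : (m <= M)%N by rewrite -(ler_nat R); lra.
have mML : (L * m <= L * M)%N by rewrite leq_mul2l mM orbT.
rewrite (le_trans (sum_tail_le mML (fun n => normc_expi_le1 _)))//.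
have hN : (L * M - L * m = L * (M - m))%N by rewrite mulnBr.
rewrite hN.
have natMm : (M - m)%:R = M%:R - m%:R :> R by rewrite natrB.
have s1 : normc (\sum_(0 <= n < L * (M - m)) expi (th * alpha ((L * m + n)%N%:R / L%:R))) <=
    ep / 4 * (L * (M - m))%N%:R.
  rewrite (eq_bigr (fun n : nat => expi (th * alpha (m%:R + L%:R^-1 * n%:R)))); last first.
    move=> n _; congr (expi (th * alpha _)).
    by rewrite natrD natrM mulrDl mulrAC divff ?gt_eqF// mul1r [in RHS]mulrC.
  apply: (hz M%:R) => //.
  - by rewrite invr_gt0.
  - by rewrite natrM mulKf ?gt_eqF// natMm; lra.
  - have L1 : 1 <= L%:R :> R by rewrite ler1n (leq_ltn_trans _ LL).
    have : L%:R^-1 <= 1 :> R by rewrite invf_le1.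
    rewrite natrD natrM mulrDr mulKf ?gt_eqF// natMm; lra.
  - rewrite expr1 normrM ler_pdivrMl// (@le_trans _ _ (T * `|D 1 M%:R|))//.
      by rewrite ler_wpM2r.
    rewrite -ler_pdivrMr// (@le_trans _ _ L0%:R)//; first by rewrite ltW// truncnS_gt.
    by rewrite ler_nat ltnW.
have s2 : ep / 4 * (L%:R * (M - m)%:R) <= ep / 4 * (L%:R * M%:R).
  by rewrite ler_wpM2l ?divr_ge0 ?(ltW ep0)// ler_pM2l// ler_nat leq_subr.
have s3 : L%:R * m%:R <= L%:R * (ep / 2 * M%:R + 1) by rewrite ler_pM2l.
have s4 : L%:R * 8 <= L%:R * (M%:R * ep) by rewrite ler_pM2l// ltW.
rewrite (le_trans (lerD (lexx _) s1))// !natrM.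
lra.
Qed.

(** When [th * alpha' M * M] is at most [K], regularity gives [th * alpha'] size O(K / M) on
    [[ep * M, M]], so the phase moves by O(K / M) over a unit interval. *)
Lemma expi_diff_small (ep K : R) : 0 < ep -> ep <= 1 ->
  \forall z \near +oo, forall (M : nat) (th u : R) (n : nat), (z : R) < M%:R ->
    `|th * D 1 M%:R| * M%:R <= K -> 0 <= u <= 1 -> ep * M%:R <= n%:R -> (n < M)%N ->
    normc (expi (th * alpha n%:R) - expi (th * alpha (n%:R + u))) <= ep.
Proof.
move=> ep0 ep1; have [K0 hK0] := dtower_ratio hH Ha hl unbounded_derive.
have [L [L1 L2 L3]] : exists L : R, [/\ 1 <= L, ep^-1 <= L & 2 <= L].
  exists (ep^-1 + 1); have h1 : 1 <= ep^-1 by rewrite invf_ge1.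
  split; lra.
have hder : \forall x \near +oo, is_derive (x : R) (1 : R) alpha (D 1 x) := dtower_derive hH Ha 0.
have [x0 x00 hx0] := near_pinfty_pos 1 hder.
have [b bx0 hb] := near_pinfty_pos x0 (hK0 L L1).
have b1 : b < b + 1 by rewrite ltrDl.
have {}hb := hb _ b1.
have pi0 := pi_gt0 R.
have pi40 : 0 < 4 * pi :> R by rewrite mulr_gt0.
have LK0 : 0 < L ^+ K0 by rewrite exprn_gt0// (lt_le_trans ltr01).
apply: filterS3 (near_gt (b + 1)) (near_gt ((b + 1) / ep)) (near_gt (4 * pi * (L ^+ K0 * K) / ep))
  => z z1 z2 z3 M th u n zM hK /andP[u0 u1] hn nM.
have bM : b + 1 < M%:R by exact: lt_trans zM.
have bn : b + 1 < n%:R.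
  by apply: lt_le_trans hn; rewrite -ltr_pdivrMl// mulrC (lt_trans z2).
have M0 : 0 < M%:R :> R by rewrite (lt_trans _ bM)// (lt_trans _ b1)// (lt_trans _ bx0)// (lt_trans ltr01).
rewrite (le_trans (expi_lip _ _))// -mulrBr.
have key : `|th * (alpha n%:R - alpha (n%:R + u))| <= L ^+ K0 * K / M%:R.
  move: u0; rewrite le_eqVlt => /orP[/eqP <-|u0].
    rewrite addr0 subrr mulr0 normr0 divr_ge0 ?(ltW M0)// mulr_ge0 ?(ltW LK0)//.
    by rewrite (le_trans _ hK)// mulr_ge0// ltW.
  have nu : n%:R < n%:R + u by rewrite ltrDl.
  have [xi /andP[xi1 xi2] E] : exists2 c, n%:R < c < n%:R + u &
      alpha (n%:R + u) - alpha n%:R = D 1 c * (n%:R + u - n%:R).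
    apply: mean_value nu _ => x /andP[nx _]; apply: hx0.
    by rewrite (lt_le_trans _ nx)// (lt_trans _ bn)// (lt_trans bx0).
  have bxi : b + 1 < xi by exact: lt_trans xi1.
  have xM : xi <= M%:R.
    rewrite (le_trans (ltW xi2))// (@le_trans _ _ (n%:R + 1))// ?lerD2l//.
    by rewrite natr1 ler_nat.
  have [_ [_ [_ h]]] := hb xi M%:R bxi bM.
  have {}h : `|D 1 xi| <= L ^+ K0 * `|D 1 M%:R|.
    apply: h; first by rewrite (le_trans xM)// ler_peMl// ltW.
    rewrite (@le_trans _ _ (ep^-1 * xi))//.
      by rewrite ler_pdivlMl// (le_trans hn)// ltW.
    by rewrite ler_wpM2r// (le_trans _ (ltW xi1)).
  rewrite normrM distrC E [n%:R + u]addrC addrK normrM (gtr0_norm u0).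
  rewrite ler_pdivlMr// (@le_trans _ _ (`|th| * (L ^+ K0 * `|D 1 M%:R|) * M%:R))//.
    rewrite ler_wpM2r ?(ltW M0)// ler_wpM2l// -[leRHS]mulr1 ler_pM ?(ltW u0)//.
  have -> : `|th| * (L ^+ K0 * `|D 1 M%:R|) * M%:R = L ^+ K0 * (`|th * D 1 M%:R| * M%:R).
    by rewrite normrM; ring.
  by rewrite ler_pM2l.
have z4 : 4 * pi * (L ^+ K0 * K) / ep < M%:R by exact: lt_trans zM.
rewrite (le_trans (ler_wpM2l (ltW pi40) key))//.
by rewrite mulrA ler_pdivrMr// [leRHS]mulrC -ler_pdivrMr// ltW.
Qed.

Hypothesis hi1 : forall (p : {poly rat}) (c C : R),
  \forall x \near +oo, C <= `|alpha x - c * (map_poly ratr p).[x]| / ln x.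

(** If [th * alpha' M * M] is large, both sums are small separately. If it is bounded, the term at
    [n] is compared with each of the [L] samples between [n] and [n.+1], the first [ep / 8 * M]
    integers being counted trivially. *)
Lemma sum_comparison (T ep : R) : 0 < ep -> ep <= 1 ->
  \forall M \near \oo, exists L0 : nat, forall (L : nat) (th : R), (L0 < L)%N -> `|th| <= T ->
    normc (L%:R * \sum_(0 <= n < M) expi (th * alpha n%:R)
           - \sum_(0 <= k < L * M) expi (th * alpha (k%:R / L%:R))) <= ep * (L%:R * M%:R).
Proof.
move=> ep0 ep1.
have e20 : 0 < ep / 2 by rewrite divr_gt0.
have e21 : ep / 2 <= 1 by lra.
have [K1 K10 hK1] := dichotomy_uniform hH Ha hl hi1 e20 e21.
have [K2 K20 hK2] := fine_sum e20 e21.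
have e40 : 0 < ep / 8 by rewrite divr_gt0.
have e41 : ep / 8 <= 1 by lra.
have hd := expi_diff_small (Num.max K1 K2) e40 e41.
have [z1 hz1] := iffLR (near_pinftyP _) (hK2 T).
have z11 : z1 < z1 + 1 by rewrite ltrDl.
have {}hz1 := hz1 _ z11.
have [z2 hz2] := iffLR (near_pinftyP _) hd.
have z21 : z2 < z2 + 1 by rewrite ltrDl.
have {}hz2 := hz2 _ z21.
have n1 : \forall M \near \oo, z1 + 1 < M%:R :> R by exact: nbhs_infty_gtr.
have n2 : \forall M \near \oo, Num.max (z2 + 1) (8 / ep) < M%:R :> R by exact: nbhs_infty_gtr.
apply: filterS3 (hK1 T) n1 n2 => M h1 m1; rewrite gt_max => /andP[m2 m3].
have [L0 hL0] := hz1 M m1.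
exists L0 => L th LL thT.
have nL : normc (L%:R : R[i]) = L%:R.
  by rewrite -(rmorph_nat (real_complex R)) normc_real ger0_norm.
have L0' : 0 < L%:R :> R by rewrite ltr0n (leq_ltn_trans _ LL).
have [small|big] := leP (`|th * D 1 M%:R| * M%:R) (Num.max K1 K2).
  have -> : \sum_(0 <= k < L * M) expi (th * alpha (k%:R / L%:R)) =
      \sum_(0 <= i < L) \sum_(0 <= t < M) expi (th * alpha (t%:R + i%:R / L%:R)).
    rewrite sum_progressions; apply: eq_bigr => i _; apply: eq_bigr => t _.
    congr (expi (th * alpha _)).
    by rewrite natrD natrM mulrDl addrC mulrAC divff ?gt_eqF// mul1r.
  have -> : L%:R * \sum_(0 <= n < M) expi (th * alpha n%:R) =
      \sum_(0 <= i < L) \sum_(0 <= n < M) expi (th * alpha n%:R).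
    by rewrite sumr_const_nat subn0 mulr_natl.
  rewrite -sumrB (le_trans (normc_sum _ _ _))//.
  rewrite (_ : ep * (L%:R * M%:R) = \sum_(0 <= i < L) (ep * M%:R)); last first.
    by rewrite sumr_const_nat subn0 -[RHS]mulr_natl mulrCA.
  apply: ler_sum_nat => i /andP[_ iL].
  rewrite -sumrB (le_trans (normc_sum _ _ _))//.
  pose m := (Num.truncn (ep / 8 * M%:R)).+1.
  have x0 : 0 <= ep / 8 * M%:R by rewrite mulr_ge0// divr_ge0// ltW.
  have /andP[t1 t2] := truncn_itv x0.
  have hm1 : ep / 8 * M%:R <= m%:R by rewrite ltW.
  have hm2 : m%:R <= ep / 8 * M%:R + 1 by rewrite /m -natr1 lerD2r.
  have M8 : 8 < M%:R * ep by rewrite -ltr_pdivrMr.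
  have bnd t : (0 <= t < M)%N ->
     normc (expi (th * alpha t%:R) - expi (th * alpha (t%:R + i%:R / L%:R))) <=
       (if (t < m)%N then 2 else 0) + ep / 8.
    move=> /andP[_ tM]; case: ltnP => tm.
      rewrite (le_trans (normcB_le _ _))// !normc_expi lerDl ltW//.
    rewrite add0r; apply: (hz2 M) => //.
      by rewrite divr_ge0// ler_pdivrMr// mul1r ler_nat ltnW.
    by rewrite (le_trans hm1)// ler_nat.
  rewrite (le_trans (ler_sum_nat bnd))// big_split /= sumr_const_nat subn0.
  have := @sum_indic_le R 2 m M (ler0n _ 2).
  rewrite -[X in _ + X]mulr_natr.
  lra.
have bK1 : K1 < `|th * D 1 M%:R| * M%:R by rewrite (le_lt_trans _ big)// le_max lexx.
have bK2 : K2 <= `|th * D 1 M%:R| * M%:R.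
  by rewrite ltW// (le_lt_trans _ big)// le_max lexx orbT.
have s2 := hL0 L th LL thT bK2.
have [|s1] := h1 th thT; first by rewrite leNgt bK1.
rewrite /small_sum in s1.
rewrite (le_trans (normcB_le _ _))// normcM nL.
have s3 := ler_wpM2l (ltW L0') s1.
rewrite (le_trans (lerD s3 s2))// le_eqVlt; apply/orP; left; apply/eqP.
by field.
Qed.

End Comparison.

(** * The Fejer kernel *)

Section Fejer.
Variable R : realType.
Implicit Types (s : seq nat) (T Q : nat) (t y : R).

Definition dirichlet (J : nat) t : R[i] := \sum_(0 <= j < J) expi (j%:R * t).

(** An unnormalised Fejer kernel. With [J = T * Q] it has frequencies in (-T, T), period [Q], and a
    peak of height [J ^+ 2] and width about [1 / T]. Its frequencies are multiples of [1 / Q], so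
    that Parseval's identity is a finite sum. *)
Definition fejer (J Q : nat) t : R := normc (dirichlet J (t / Q%:R)) ^+ 2.

Definition spectrum s t : R[i] := \sum_(x <- s) expi (t * x%:R).

Lemma spectrum_conj s t : (spectrum s t)^* = \sum_(x <- s) expi (- (t * x%:R)).
Proof. by rewrite /spectrum rmorph_sum /=; apply: eq_bigr => x _; rewrite expiN. Qed.

Lemma fejer_ge0 J Q t : 0 <= fejer J Q t.
Proof. exact: sqr_ge0. Qed.

Lemma fejer_le J Q t : fejer J Q t <= J%:R ^+ 2.
Proof.
rewrite /fejer ler_sqr ?nnegrE ?normc_ge0//.
exact: (normc_sum_expi_le (fun j => j%:R * (t / Q%:R))).
Qed.

Lemma fejer_expansion J Q t : (fejer J Q t)%:C =
  \sum_(0 <= j < J) \sum_(0 <= k < J) expi ((j%:R - k%:R) / Q%:R * t).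
Proof.
rewrite /fejer normc_sqr_sumE; apply: eq_bigr => j _; apply: eq_bigr => k _.
by rewrite -expiB; congr expi; ring.
Qed.

Lemma dirichlet_orthogonal (J : nat) t : expi t != 1 -> expi (J%:R * t) = 1 ->
  dirichlet J t = 0.
Proof.
move=> t1 Jt; have : dirichlet J t * (expi t - 1) = expi (J%:R * t) - expi (0%:R * t).
  rewrite /dirichlet mulr_suml -(telescope_sumr (fun j => expi (j%:R * t)))//.
  apply: eq_bigr => j _; rewrite mulrBr mulr1 -expiD -natr1 mulrDl mul1r//.
rewrite Jt mul0r expi0 subrr => /eqP; rewrite mulf_eq0 subr_eq0 (negPf t1) orbF.
by move/eqP.
Qed.

(** The elements of [s] lie below [Q], so distinct ones are distinct modulo [Q] and their characters
    are orthogonal over [T] full periods. The shift [c] is needed because the kernel has the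
    frequencies [(j - k) / Q]. *)
Lemma spectrum_parseval s T Q c : (0 < Q)%N -> uniq s -> (forall x, x \in s -> (x < Q)%N) ->
  \sum_(0 <= j < T * Q) normc (spectrum s ((j%:R - c) / Q%:R)) ^+ 2 =
  (T * Q * size s)%N%:R :> R.
Proof.
move=> Q0 us hs; have Qn : Q%:R != 0 :> R by rewrite pnatr_eq0 -lt0n.
apply: (@complexI R); rewrite rmorph_sum /=.
have E (j : nat) : (normc (spectrum s ((j%:R - c) / Q%:R)) ^+ 2)%:C =
   \sum_(x <- s) \sum_(y <- s) expi ((j%:R - c) / Q%:R * (x%:R - y%:R)).
  rewrite normc_sqrE /spectrum rmorph_sum /= mulr_suml; apply: eq_bigr => x _.
  rewrite mulr_sumr; apply: eq_bigr => y _.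
  by rewrite -expiB; congr expi; ring.
rewrite (eq_bigr _ (fun j _ => E j)) exchange_big /=.
rewrite (eq_big_seq (fun=> (T * Q)%N%:R)); last first.
  move=> x xs; rewrite exchange_big /= (bigD1_seq x)//= [X in _ + X]big1_seq ?addr0.
    rewrite (eq_bigr (fun=> 1)); last by move=> j _; rewrite subrr mulr0 expi0.
    by rewrite sumr_const_nat subn0.
  move=> y /andP[yx ys].
  rewrite (eq_bigr (fun j : nat => expi (j%:R * ((x%:R - y%:R) / Q%:R)) *
    expi (- c / Q%:R * (x%:R - y%:R)))); last first.
    by move=> j _; rewrite -expiD; congr expi; ring.
  rewrite -mulr_suml [X in X * _](dirichlet_orthogonal _ _) ?mul0r//.
    apply/eqP => /expi_eq1[m mE].
    have e : (x%:Z - y%:Z)%:~R = (m * Q%:Z)%:~R :> R.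
      by rewrite rmorphB rmorphM /= -mE divfK.
    have {}e : x%:Z - y%:Z = m * Q%:Z by move/eqP: e; rewrite eqr_int => /eqP.
    have xQ := hs x xs; have yQ := hs y ys.
    move/negP: yx; apply; apply/eqP; move: e xQ yQ; clear => e xQ yQ.
    have : m = 0 by nia.
    by move=> m0; move: e; rewrite m0 mul0r => /eqP; rewrite subr_eq0 => /eqP[].
  have -> : (T * Q)%N%:R * ((x%:R - y%:R) / Q%:R) = (T%:Z * (x%:Z - y%:Z))%:~R :> R.
    by rewrite natrM rmorphM rmorphB /=; field.
  exact: expi_int.
rewrite big_const_seq count_predT iter_addr_0.
by rewrite -[LHS]mulr_natr -natrM -(rmorph_nat (real_complex R)).
Qed.

Definition fejer_sum (J Q : nat) s y : R :=
  \sum_(x <- s) \sum_(x' <- s) fejer J Q (y - x%:R - x'%:R).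

Lemma fejer_sum_expansion (J Q : nat) s (I : Type) (r : seq I) (y : I -> R) :
  (\sum_(n <- r) fejer_sum J Q s (y n))%:C =
  \sum_(0 <= j < J) \sum_(0 <= k < J)
    (conjc (spectrum s ((j%:R - k%:R) / Q%:R))) ^+ 2 * \sum_(n <- r) expi ((j%:R - k%:R) / Q%:R * y n).
Proof.
rewrite rmorph_sum /=.
have E n : (fejer_sum J Q s (y n))%:C = \sum_(0 <= j < J) \sum_(0 <= k < J)
   (conjc (spectrum s ((j%:R - k%:R) / Q%:R))) ^+ 2 * expi ((j%:R - k%:R) / Q%:R * y n).
  rewrite /fejer_sum rmorph_sum /=.
  under eq_bigr do rewrite rmorph_sum /=.
  under eq_bigr do under eq_bigr do rewrite fejer_expansion.
  under eq_bigr do rewrite exchange_big /=.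
  rewrite exchange_big /=; apply: eq_bigr => j _.
  under eq_bigr do rewrite exchange_big /=.
  rewrite exchange_big /=; apply: eq_bigr => k _.
  rewrite spectrum_conj expr2 -mulrA !mulr_suml.
  apply: eq_bigr => x _; rewrite mulr_sumr; apply: eq_bigr => x' _.
  by rewrite -!expiD; congr expi; ring.
rewrite (eq_bigr _ (fun n _ => E n)) exchange_big /=; apply: eq_bigr => j _.
by rewrite exchange_big /=; apply: eq_bigr => k _; rewrite mulr_sumr.
Qed.

(** Both sides expand with the same weights, squares of conjugated values of the spectrum, so [B]
    factors out. For each fixed [k], Parseval's identity gives the weights total mass
    [T * Q * size s]. *)
Lemma fejer_sum_comparison s T Q (c B : R) (I I' : Type) (r : seq I) (r' : seq I')
    (y : I -> R) (z : I' -> R) :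
  (0 < Q)%N -> uniq s -> (forall x, x \in s -> (x < Q)%N) ->
  (forall th : R, `|th| <= T%:R ->
     normc (c%:C * \sum_(n <- r) expi (th * y n) - \sum_(n <- r') expi (th * z n)) <= B) ->
  `|c * \sum_(n <- r) fejer_sum (T * Q) Q s (y n) - \sum_(n <- r') fejer_sum (T * Q) Q s (z n)|
    <= B * ((T * Q) * (T * Q * size s))%N%:R.
Proof.
move=> Q0 us hs hB; have Q0' : 0 < Q%:R :> R by rewrite ltr0n.
rewrite -normc_real.
have -> (a b : R) : (c * a - b)%:C = c%:C * a%:C - b%:C by rewrite rmorphB rmorphM.
rewrite !fejer_sum_expansion mulr_sumr -sumrB.
rewrite (le_trans (normc_sum _ _ _))//.
apply: (@le_trans _ _ (\sum_(0 <= j < T * Q) \sum_(0 <= k < T * Q)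
   normc (spectrum s ((j%:R - k%:R) / Q%:R)) ^+ 2 * B)).
  apply: ler_sum_nat => j /andP[_ jJ]; rewrite mulr_sumr -sumrB (le_trans (normc_sum _ _ _))//.
  apply: ler_sum_nat => k /andP[_ kJ].
  rewrite mulrCA -mulrBr normcM expr2 normcM normc_conj -expr2 ler_wpM2l ?sqr_ge0//.
  apply: hB; rewrite normrM normfV (gtr0_norm Q0') ler_pdivrMr// -natrM ler_norml.
  have : j%:R <= (T * Q)%N%:R :> R by rewrite ler_nat ltnW.
  have : k%:R <= (T * Q)%N%:R :> R by rewrite ler_nat ltnW.
  have : 0 <= j%:R :> R by []. have : 0 <= k%:R :> R by [].
  by move: (_%:R) (_%:R) (_%:R) => a b c'; clear; lra.
rewrite exchange_big_nat /=.
have E (k : nat) : \sum_(0 <= j < T * Q) normc (spectrum s ((j%:R - k%:R) / Q%:R)) ^+ 2 * B =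
    (T * Q * size s)%N%:R * B.
  by rewrite -mulr_suml spectrum_parseval.
rewrite (eq_bigr _ (fun k _ => E k)) sumr_const_nat subn0 -mulr_natl.
by rewrite le_eqVlt; apply/orP; left; apply/eqP; rewrite [in RHS]natrM; ring.
Qed.

Lemma sum_inv_sqr (n : nat) : \sum_(1 <= k < n.+1) (k%:R ^+ 2)^-1 <= 2 :> R.
Proof.
suff h : \sum_(1 <= k < n.+2) (k%:R ^+ 2)^-1 <= 2 - n.+1%:R^-1 :> R.
  have p : 0 <= n.+1%:R^-1 :> R by rewrite invr_ge0.
  move: h; rewrite big_nat_recr//=; have : 0 <= (n.+1%:R ^+ 2)^-1 :> R.
    by rewrite invr_ge0 sqr_ge0.
  by move: p; move: (n.+1%:R ^- 2) (n.+1%:R^-1) (\sum_(_ <= _ < _) _) => a b c; lra.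
elim: n => [|n IH]; first by rewrite big_nat1 expr1n invr1; lra.
rewrite big_nat_recr//= (le_trans (lerD IH (lexx _)))//.
have n0 : 0 < n.+1%:R :> R by [].
have -> : n.+2%:R = n.+1%:R + 1 :> R by rewrite natr1.
move: (n.+1%:R : R) n0 => a a0.
have a1 : 0 < a + 1 by lra.
have : ((a + 1) ^+ 2)^-1 <= a^-1 - (a + 1)^-1.
  have -> : a^-1 - (a + 1)^-1 = (a * (a + 1))^-1 by field; rewrite !gt_eqF.
  by rewrite lef_pV2 ?posrE ?exprn_gt0 ?mulr_gt0// expr2 ler_pM2r//; lra.
lra.
Qed.

Lemma sum_inv_sqr_uniq s : uniq s -> 0%N \notin s -> \sum_(k <- s) (k%:R ^+ 2)^-1 <= 2 :> R.
Proof.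
move=> us s0; pose n := \max_(k <- s) k.
apply: le_trans (sum_inv_sqr n).
have sub : {subset s <= index_iota 1 n.+1}.
  move=> k ks; rewrite mem_index_iota ltnS leq_bigmax_seq// andbT lt0n.
  by apply: contraNneq s0 => <-.
have uI : uniq (index_iota 1 n.+1) by exact: iota_uniq.
have e : perm_eq s [seq i <- index_iota 1 n.+1 | i \in s].
  apply: uniq_perm; rewrite ?filter_uniq//.
  by move=> k; rewrite mem_filter andb_idr// => /sub.
rewrite (perm_big _ e) /= big_filter [leRHS](bigID (fun k => k \in s)) /=.
by rewrite lerDl sumr_ge0// => i _; rewrite invr_ge0 sqr_ge0.
Qed.

Lemma sum_inv_sqr_dist s (f : int) : uniq s ->
  \sum_(x <- s | x%:Z != f) ((f - x%:Z)%:~R ^+ 2)^-1 <= 4 :> R.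
Proof.
move=> us; rewrite (bigID (fun x : nat => x%:Z < f)) /=.
have part (P : pred nat) : (forall x y : nat, P x -> P y -> `|f - x%:Z|%N = `|f - y%:Z|%N -> x = y) ->
    (forall x : nat, P x -> x%:Z != f) ->
    \sum_(x <- s | P x) ((f - x%:Z)%:~R ^+ 2)^-1 <= 2 :> R.
  move=> inj nf.
  rewrite (eq_bigr (fun x : nat => ((`|f - x%:Z|%N)%:R ^+ 2)^-1)); last first.
    move=> x _; congr (_^-1); rewrite -[_%:R]/((`|f - x%:Z|%N)%:Z%:~R) abszE intr_norm.
    by rewrite real_normK ?num_real.
  rewrite -big_filter -(big_map (fun x : nat => `|f - x%:Z|%N) predT (fun k => (k%:R ^+ 2)^-1)).
  apply: sum_inv_sqr_uniq.
    rewrite map_inj_in_uniq ?filter_uniq// => x y.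
    by rewrite !mem_filter => /andP[Px _] /andP[Py _]; exact: inj.
  apply/mapP => -[x]; rewrite mem_filter => /andP[/nf nx _] /esym/eqP.
  by rewrite absz_eq0 subr_eq0 eq_sym (negPf nx).
have -> : 4 = 2 + 2 :> R by lra.
apply: lerD; apply: part => x.
- by move=> y /andP[_ a] /andP[_ b]; lia.
- by case/andP.
- by move=> y /andP[a a'] /andP[b b']; lia.
- by case/andP.
Qed.

(** The tail bound is that of a geometric sum with [|expi (t / Q) - 1| >= |t| / Q]. For
    [T * |t| <= t0] every one of the [T * Q] terms has real part at least 1/2, hence a quarter of
    the peak. *)
Lemma fejer_bounds : exists2 t0 : R, 0 < t0 & forall T Q, (0 < Q)%N ->
  (forall t, 0 < `|t| -> `|t| <= t0 * Q%:R -> fejer (T * Q) Q t <= 4 * Q%:R ^+ 2 / t ^+ 2) /\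
  (forall t, T%:R * `|t| <= t0 -> (T * Q)%N%:R ^+ 2 / 4 <= fejer (T * Q) Q t).
Proof.
have [t0 t00 h] := expi_small R; exists t0 => // T Q Q0.
have Q0' : 0 < Q%:R :> R by rewrite ltr0n.
split=> t.
  move=> tp tQ; have nt : `|t / Q%:R| = `|t| / Q%:R by rewrite normrM normfV (gtr0_norm Q0').
  have [|e1 _] := h (t / Q%:R); first by rewrite nt ler_pdivrMr.
  have tq0 : 0 < `|t| / Q%:R by rewrite divr_gt0.
  have n1 : expi (t / Q%:R) != 1.
    apply/eqP => E; move: e1; rewrite E subrr normc0 nt leNgt => /negP; apply.
    exact: tq0.
  have := @geometric_sum R (T * Q) 0 (t / Q%:R) n1.
  under eq_bigr do rewrite add0r.
  rewrite -/(dirichlet _ _) => g.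
  have g2 : normc (dirichlet (T * Q) (t / Q%:R)) <= 2 * Q%:R / `|t|.
    rewrite (le_trans g)// -mulrA ler_pM2l// -[leRHS]invf_div lef_pV2 ?posrE -?nt//.
      by rewrite (lt_le_trans _ e1)// nt.
    by rewrite nt.
  rewrite /fejer (_ : 4 * Q%:R ^+ 2 / t ^+ 2 = (2 * Q%:R / `|t|) ^+ 2); last first.
    rewrite -(real_normK (num_real t)); move: tp; move: (`|t|) => u u0.
    by field; rewrite gt_eqF.
  by rewrite ler_sqr ?nnegrE ?normc_ge0// (le_trans _ g2)// normc_ge0.
move=> tT; have hre : (T * Q)%N%:R / 2 <= complex.Re (dirichlet (T * Q) (t / Q%:R)).
  have -> : complex.Re (dirichlet (T * Q) (t / Q%:R)) =
      \sum_(0 <= j < T * Q) complex.Re (expi (j%:R * (t / Q%:R))).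
    rewrite /dirichlet.
    by apply: (big_ind2 (fun (a : R[i]) b => complex.Re a = b)) => // -[a1 b1] _ [a2 b2] _ <- <-.
  rewrite (_ : (T * Q)%N%:R / 2 = \sum_(0 <= j < T * Q) 1 / 2 :> R); last first.
    by rewrite sumr_const_nat subn0 -[RHS]mulr_natl mul1r.
  apply: ler_sum_nat => j /andP[_ jJ]; apply: (h _ _).2.
  rewrite mulrCA normrM (le_trans _ tT)// mulrC ler_wpM2r// ger0_norm ?divr_ge0//.
  by rewrite ler_pdivrMr// -natrM ler_nat ltnW.
have [h1 _] := normc_ge_ReIm (dirichlet (T * Q) (t / Q%:R)).
rewrite /fejer (_ : _ / 4 = ((T * Q)%N%:R / 2) ^+ 2); last by field.
rewrite ler_sqr ?nnegrE ?normc_ge0 ?divr_ge0//.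
by rewrite (le_trans hre)// (le_trans _ h1)// ler_norm.
Qed.

(** As [y] is within 1/2 of the integer [f], any other integer [x] satisfies
    [|y - x| >= |f - x| / 2], and the tails sum like inverse squares: 64 is 4 from the kernel, 4
    from the halved distance and 4 from [sum_inv_sqr_dist]. *)
Lemma fejer_row_bound (t0 : R) (T Q : nat) s y (f : int) : (0 < Q)%N -> uniq s ->
  (forall t, 0 < `|t| -> `|t| <= t0 * Q%:R -> fejer (T * Q) Q t <= 4 * Q%:R ^+ 2 / t ^+ 2) ->
  `|y - f%:~R| <= 1 / 2 -> (forall x, x \in s -> `|y - x%:R| <= t0 * Q%:R) ->
  \sum_(x <- s | x%:Z != f) fejer (T * Q) Q (y - x%:R) <= 64 * Q%:R ^+ 2.
Proof.
move=> Q0 us hf yf hs; have Q0' : 0 < Q%:R :> R by rewrite ltr0n.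
apply: (@le_trans _ _ (\sum_(x <- s | x%:Z != f) 16 * Q%:R ^+ 2 * ((f - x%:Z)%:~R ^+ 2)^-1)).
  rewrite big_seq_cond [leRHS]big_seq_cond; apply: ler_sum => x /andP[xs xf].
  have g1 : 1 <= `|(f - x%:Z)%:~R : R|.
    rewrite -intr_norm (ler_int R 1) -gtz0_ge1 normr_gt0 subr_eq0 eq_sym//.
  have d : `|(f - x%:Z)%:~R| / 2 <= `|y - x%:R|.
    have e : (f - x%:Z)%:~R = (y - x%:R) - (y - f%:~R) :> R by rewrite rmorphB /=; ring.
    have := ler_normB (y - x%:R) (y - f%:~R); rewrite -e; lra.
  have p : 0 < `|y - x%:R| by lra.
  rewrite (le_trans (hf _ p (hs x xs)))// ler_pdivrMr; last by rewrite -(real_normK (num_real _)) exprn_gt0.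
  have w0 : 0 < `|(f - x%:Z)%:~R : R| by lra.
  rewrite -[(f - x%:Z)%:~R ^+ 2](real_normK (num_real _)) -[(y - x%:R) ^+ 2](real_normK (num_real _)).
  move: d w0; move: (`|y - x%:R|) (`|_|) => u w d w0.
  have w2 : 0 < w ^+ 2 by rewrite exprn_gt0.
  have q2 : 0 <= Q%:R ^+ 2 :> R by rewrite sqr_ge0.
  have h4 : w ^+ 2 <= 4 * u ^+ 2.
    by have := @lerXn2r R 2 (w / 2) u; rewrite !nnegrE exprMn exprVn; lra.
  rewrite mulrAC ler_pdivlMr//.
  have := ler_wpM2l q2 h4; lra.
rewrite -mulr_sumr.
have := sum_inv_sqr_dist f us => h.
have q2 : 0 <= 16 * Q%:R ^+ 2 :> R by rewrite mulr_ge0// sqr_ge0.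
have := ler_wpM2l q2 h; lra.
Qed.

(** The point [p] may be close to an end of [[a, b]], so only the half window of length [h] on a
    side with enough room is used. It holds more than [L * h - 2] grid points, which is at least
    [L * h / 2]. *)
Lemma grid_count (a b L : nat) (p h : R) : a%:R <= p <= b%:R -> 2 * h <= b%:R - a%:R ->
  4 <= L%:R * h -> 0 < h ->
  L%:R * h / 2 <= \sum_(L * a <= k < L * b) (if `|k%:R / L%:R - p| <= h then 1 else 0) :> R.
Proof.
move=> /andP[ap pb] hab Lh h0.
have L0 : 0 < L%:R :> R by rewrite -(@pmulr_lgt0 _ h)//; lra.
pose cnt k0 n := \sum_(k0 <= k < k0 + n) (if `|k%:R / L%:R - p| <= h then 1 else 0) : R.
have sub k0 n : (L * a <= k0)%N -> (k0 + n <= L * b)%N ->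
    cnt k0 n <= \sum_(L * a <= k < L * b) (if `|k%:R / L%:R - p| <= h then 1 else 0) :> R.
  move=> h1 h2; rewrite [leRHS](@big_cat_nat _ _ _ k0)//=; last by rewrite (leq_trans _ h2)// leq_addr.
  rewrite [X in _ + X](@big_cat_nat _ _ _ (k0 + n))//= ?leq_addr//.
  have : 0 <= \sum_(L * a <= k < k0) (if `|k%:R / L%:R - p| <= h then 1 else 0) :> R.
    by apply: sumr_ge0 => k _; case: ifP.
  have : 0 <= \sum_(k0 + n <= k < L * b) (if `|k%:R / L%:R - p| <= h then 1 else 0) :> R.
    by apply: sumr_ge0 => k _; case: ifP.
  rewrite -/(cnt k0 n); lra.
pose n := Num.truncn (L%:R * h - 1).
have x0 : 0 <= L%:R * h - 1 by clear -Lh; lra.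
have /andP[n1 n2] := truncn_itv x0; rewrite -/n -natr1 in n1 n2.
have full k0 : (forall k, (k0 <= k < k0 + n)%N -> `|k%:R / L%:R - p| <= h) -> cnt k0 n = n%:R.
  move=> hk; rewrite /cnt (eq_big_nat _ _ (F2 := fun=> 1)) ?sumr_const_nat ?addKn//.
  by move=> k /hk ->.
have pL0 : 0 <= p * L%:R by rewrite mulr_ge0 ?(ltW L0)// (le_trans _ ap).
have pa : a%:R * L%:R <= p * L%:R by rewrite ler_pM2r.
have pbL : p * L%:R <= b%:R * L%:R by rewrite ler_pM2r.
have hL : 2 * (L%:R * h) <= b%:R * L%:R - a%:R * L%:R.
  have := ler_wpM2r (ltW L0) hab; lra.
have absE k : - (L%:R * h) <= k%:R - p * L%:R -> k%:R - p * L%:R <= L%:R * h -> `|k%:R / L%:R - p| <= h.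
  move=> l1 l2; have -> : k%:R / L%:R - p = (k%:R - p * L%:R) / L%:R by field; rewrite gt_eqF.
  by rewrite normrM normfV (gtr0_norm L0) ler_pdivrMr// [leRHS]mulrC ler_norml l1 l2.
case: (leP (p * L%:R + L%:R * h) (b%:R * L%:R)) => side.
  pose k0 := (Num.truncn (p * L%:R)).+1.
  have /andP[k1 k2] := truncn_itv pL0.
  have k3 : k0%:R <= p * L%:R + 1 by rewrite /k0 -natr1 lerD2r.
  rewrite -/k0 in k2.
  have nn : n%:R <= \sum_(L * a <= k < L * b) (if `|k%:R / L%:R - p| <= h then 1 else 0) :> R.
    rewrite -(full k0) ?sub//.
    - by rewrite -(ler_nat R) natrM; clear -k2 pa; lra.
    - by rewrite -(ler_nat R) natrD natrM; clear -k3 n1 side; lra.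
    - move=> k /andP[kk kn]; apply: absE.
        have : k0%:R <= k%:R :> R by rewrite ler_nat. by clear -k2 h0 Lh; lra.
      have : k%:R + 1 <= k0%:R + n%:R :> R by rewrite natr1 -natrD ler_nat. by clear -k3 n1; lra.
  by clear -nn n2 Lh; lra.
pose k0 := (Num.truncn (p * L%:R - L%:R * h)).+1.
have y0 : 0 <= p * L%:R - L%:R * h.
  have : 0 <= a%:R * L%:R :> R by rewrite mulr_ge0 ?(ltW L0). by clear -hL side; lra.
have /andP[k1 k2] := truncn_itv y0.
have k3 : k0%:R <= p * L%:R - L%:R * h + 1 by rewrite /k0 -natr1 lerD2r.
rewrite -/k0 in k2.
have nn : n%:R <= \sum_(L * a <= k < L * b) (if `|k%:R / L%:R - p| <= h then 1 else 0) :> R.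
  rewrite -(full k0) ?sub//.
  - by rewrite -(ler_nat R) natrM; clear -k2 hL side; lra.
  - by rewrite -(ler_nat R) natrD natrM; clear -k3 n1 pbL; lra.
  - move=> k /andP[kk kn]; apply: absE.
      have : k0%:R <= k%:R :> R by rewrite ler_nat. by clear -k2; lra.
    have : k%:R + 1 <= k0%:R + n%:R :> R by rewrite natr1 -natrD ler_nat.
    by clear -k3 n1 Lh; lra.
by clear -nn n2 Lh; lra.
Qed.

End Fejer.

(** * Solutions in a set of positive upper density *)

Section Regular.
Variables (R : realType) (H : set (R -> R)).
Hypothesis hH : hardy_field H.
Variable alpha : R -> R.
Hypothesis Ha : H alpha.
Variable l0 : nat.
Hypothesis hl : \forall x \near +oo, `|alpha x| <= x ^+ l0.
Hypothesis hsup : forall C : R, \forall x \near +oo, C * x <= alpha x.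

Notation D := (dtower alpha).

(** The sign of [x * alpha' x - alpha x] is eventually fixed; were it negative, [alpha x / x] would
    be nonincreasing and so bounded. *)
Lemma superlinear_div_homo : exists2 a : R, 0 < a &
  forall x y, a < x -> x <= y -> alpha x * x^-1 <= alpha y * y^-1.
Proof.
have hd := dtower_derive hH Ha 0.
have hp : hardy_poly H (fun x => x * D 1 x - alpha x).
  apply: hardy_polyB; first exact: hardy_polyX (dtower_poly hH Ha 1).
  exact: hardy_polyH Ha.
have pos (h : \forall x \near +oo, alpha x <= x * D 1 x) : exists2 a : R, 0 < a &
    forall x y, a < x -> x <= y -> alpha x * x^-1 <= alpha y * y^-1.
  have [a a0 ha] := near_pinfty_pos 0 (filterI hd h); exists a => // x y ax xy.
  apply: (@log_derive_homo R alpha (D 1) a 1) => //; first exact: ltW.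
    by move=> z /ha[].
  by move=> z /ha[_]; rewrite mul1r.
case: (hardy_poly_sign hH hp) => h; [apply: pos|apply: pos|exfalso].
- by apply: filterS h => x; rewrite subr_gt0 => /ltW.
- by apply: filterS h => x /eqP; rewrite subr_eq0 => /eqP ->.
have [a a0 ha] := near_pinfty_pos 0 (filterI (dtower_opp_derive hH Ha 0) h).
have hm x y : a < x -> x <= y -> - alpha x * x^-1 <= - alpha y * y^-1.
  move=> ax xy; apply: (@log_derive_homo R (fun x => - alpha x) (fun x => - D 1 x) a 1) => //.
  - exact: ltW.
  - by move=> z /ha[].
  - by move=> z /ha[_]; lra.
have [b ab hb] := near_pinfty_pos (a + 1) (hsup (alpha (a + 1) * (a + 1)^-1 + 1)).
have aa : a < a + 1 by rewrite ltrDl.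
have h1 : _ <= _ := hb (b + 1) _; rewrite ltrDl ltr01 in h1; have {}h1 := h1 isT.
have h2 : _ <= _ := hm (a + 1) (b + 1) aa _; have {}h2 := h2 ltac:(lra).
have b0 : 0 < b + 1 by lra.
move: h2; rewrite mulNr mulNr lerN2 ler_pdivrMr// => h2.
have := le_trans h1 h2; rewrite mulrDl; lra.
Qed.

(** The facts about [alpha] that the counting uses, with one constant. The Lipschitz bound on
    [[n0, z]] follows from [alpha' t <= K * alpha t / t] and the monotonicity of [alpha t / t]. *)
Lemma superlinear_regular : exists (n0 : nat) (K : R), [/\ (0 < n0)%N, 1 <= K,
  forall x, n0%:R <= x -> {for x, continuous alpha},
  forall x, n0%:R <= x -> 0 < alpha x &
  [/\ forall x y, n0%:R <= x -> x <= y -> alpha x * y <= alpha y * x,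
      forall x y z, n0%:R <= x -> x <= y -> y <= z ->
        alpha y - alpha x <= K * alpha z / z * (y - x) &
      forall x, n0%:R <= x -> alpha (x + 1) <= K * alpha x]].
Proof.
have [a a0 ha] := superlinear_div_homo.
have hunb C : \forall x \near +oo, C <= `|x ^+ 0 * D 0 x|.
  apply: filterS2 (hsup `|C|) (near_gt 1) => x hx x1.
  rewrite expr0 mul1r (le_trans _ (ler_norm _))// (le_trans _ hx)//.
  by rewrite (le_trans (ler_norm C))// ler_peMr// ltW.
have [K hK] := dtower_ratio hH Ha hl hunb.
have [b bD hb] := near_pinfty_pos a (hK 2 (ler1n _ 2)).
have [c cb hc] := near_pinfty_pos (b + 1) (filterI (filterI (dtower_derive hH Ha 0)
   (hardy_continuous hH Ha)) (hsup 1)).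
have c0 : 0 <= c by lra.
pose n0 := (Num.truncn c).+1.
have cn0 : c < n0%:R by have /andP[] := truncn_itv c0.
exists n0, (2 ^+ K + K%:R).
have hr := hb (b + 1) (ltr_pwDr ltr01 (lexx b)).
have hpos x : n0%:R <= x -> 0 < alpha x.
  move=> nx; have cx := lt_le_trans cn0 nx; have [_ h] := hc x cx.
  rewrite (lt_le_trans _ h)// mul1r (lt_trans _ cx)// (lt_trans _ cb)//.
  by rewrite addr_gt0// (lt_trans a0).
have p2 : 1 <= 2 ^+ K :> R by rewrite exprn_ege1// ler1n.
have K0 : 0 <= K%:R :> R by [].
have nb x : n0%:R <= x -> [/\ 0 < x, a < x & b + 1 < x].
  move=> nx; have bx := lt_trans cb (lt_le_trans cn0 nx).
  have ax := lt_trans bD (lt_trans (ltr_pwDr ltr01 (lexx b)) bx).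
  by split=> //; exact: lt_trans ax.
have rat x y : n0%:R <= x -> n0%:R <= y -> `|x * D 1 x| <= K%:R * `|alpha x| /\
    (x <= 2 * y -> y <= 2 * x -> `|alpha x| <= 2 ^+ K * `|alpha y|).
  move=> /nb[_ _ bx1] /nb[_ _ by1].
  by have [_ [h1 [_ h2]]] := hr x y bx1 by1.
have hdiv x y : n0%:R <= x -> x <= y -> alpha x * y <= alpha y * x.
  move=> /nb[x0 ax _] xy; have y0 := lt_le_trans x0 xy.
  have := ha x y ax xy; rewrite ler_pdivrMr// mulrAC ler_pdivlMr//.
split=> //; first by rewrite (le_trans p2)// lerDl.
  by move=> x nx; have [[]] := hc x (lt_le_trans cn0 nx).
split=> //.
  move=> x y z nx xy yz; have nz := le_trans nx (le_trans xy yz).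
  have [z0 _ _] := nb z nz; have az0 := hpos z nz.
  have [->|nxy] := eqVneq x y; first by rewrite !subrr mulr0.
  have {}xy : x < y by rewrite lt_neqAle nxy.
  have [|t /andP[xt ty] ->] := mean_value (f := alpha) (F := D 1) xy.
    move=> t /andP[xt _]; by have [[]] := hc t (lt_le_trans cn0 (le_trans nx xt)).
  rewrite ler_wpM2r ?subr_ge0 ?(ltW xy)//.
  have nt : n0%:R <= t by exact: le_trans (ltW xt).
  have [t0 _ _] := nb t nt.
  have [h1 _] := rat t t nt nt.
  rewrite ler_pdivlMr// -(ler_pM2l t0).
  have h2 : t * D 1 t <= K%:R * alpha t.
    by rewrite (le_trans (ler_norm _))// (le_trans h1)// gtr0_norm ?hpos.
  have h3 := hdiv t z nt (le_trans (ltW ty) yz).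
  rewrite mulrA (@le_trans _ _ (K%:R * alpha t * z))// ?ler_pM2r//.
  rewrite -mulrA (le_trans (ler_wpM2l K0 h3))//.
  rewrite [leRHS]mulrCA [t * _]mulrC ler_wpM2r ?mulr_ge0 ?(ltW az0) ?(ltW t0)//.
  by rewrite lerDr (le_trans ler01).
move=> x nx; have x1 : 1 <= x.
  by rewrite (le_trans _ nx)// ler1n.
have nx1 : n0%:R <= x + 1 by rewrite (le_trans nx)// lerDl.
have [_ h] := rat (x + 1) x nx1 nx.
have := h _ _; rewrite !gtr0_norm ?hpos// => h'.
have ax := hpos x nx.
rewrite (le_trans (h' _ _))//.
- by rewrite mulr_natl mulr2n lerD2l.
- by rewrite mulr_natl mulr2n -addrA lerDl !addr_ge0// (le_trans ler01).
by rewrite ler_wpM2r ?(ltW ax)// lerDl.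
Qed.

End Regular.

Lemma superlinear_homo (R : realType) (alpha : R -> R) (n0 : nat) : (0 < n0)%N ->
  (forall x, n0%:R <= x -> 0 < alpha x) ->
  (forall x y, n0%:R <= x -> x <= y -> alpha x * y <= alpha y * x) ->
  forall x y, n0%:R <= x -> x <= y -> alpha x <= alpha y.
Proof.
move=> n00 hpos hdiv x y nx xy; have y0 : 0 < y.
  by rewrite (lt_le_trans _ xy)// (lt_le_trans _ nx)// ltr0n.
rewrite -(ler_pM2r y0) (le_trans (hdiv _ _ nx xy))// ler_wpM2l// ltW// hpos//.
exact: le_trans xy.
Qed.

Lemma upper_density_gt0 (R : realType) (A : set nat) : (0 < upper_density R A)%E ->
  exists2 d : R, 0 < d & forall N0, exists2 N, (N0 <= N)%N &
    d * N%:R <= (\sum_(1 <= k < N.+1) (k \in A))%N%:R.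
Proof.
rewrite /upper_density; set u := (fun N : nat => _) => h.
have [d d0 hd] : exists2 d : R, 0 < d & (d%:E < limn_esup u)%E.
  case: (limn_esup u) h => [r||]//=.
    by rewrite lte_fin => r0; exists (r / 2); rewrite ?lte_fin; lra.
  by move=> _; exists 1 => //; rewrite ltry.
exists d => // N0.
have : (d%:E < esups u N0)%E.
  apply: lt_le_trans hd _; rewrite limn_esup_lim.
  rewrite (cvg_lim _ (ereal_nonincreasing_cvgn (@nonincreasing_esups _ u)))//.
  by apply: ereal_inf_lbound; exists N0.
move=> /ereal_sup_gt[_ [N /= N0N <-]].
rewrite /u lte_fin => hN.
case: N N0N hN => [|N] N0N hN.
  by exists 0%N => //; rewrite mulr0.
exists N.+1 => //; apply/ltW; move: hN; rewrite ltr_pdivlMr//.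
Qed.

(** * Upper and lower bounds for sums of Fejer kernels *)

Section Counting.
Variable R : realType.
Implicit Types (s : seq nat) (T Q : nat) (t y : R).

Lemma sum_unique_le s (P : pred nat) (c : R) : uniq s -> 0 <= c ->
  (forall x x' : nat, x \in s -> x' \in s -> P x -> P x' -> x = x') -> \sum_(x <- s | P x) c <= c.
Proof.
move=> us c0 hP; rewrite -big_filter big_const_seq count_predT iter_addr_0.
have : (size [seq i <- s | P i] <= 1)%N.
  case E : [seq i <- s | P i] => [//|x l].
  have hx : x \in [seq i <- s | P i] by rewrite E mem_head.
  move: hx; rewrite mem_filter => /andP[Px xs].
  apply: (@uniq_leq_size _ _ [:: x]); first by rewrite -E filter_uniq.
  move=> z; rewrite -E mem_filter => /andP[Pz zs].
  by rewrite mem_seq1; apply/eqP; exact: hP.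
by case: size => [|[|]]//; rewrite mulr1n.
Qed.

(** When [f] is not a sum of two distinct elements, every row contributes only a tail, except for a
    pair [x = x'] with [2 * x = f]. There is at most one such pair, and it costs at most the peak
    value. *)
Lemma fejer_sum_upper (t0 : R) T Q s y (f : int) : (0 < Q)%N -> uniq s ->
  (forall t, 0 < `|t| -> `|t| <= t0 * Q%:R -> fejer (T * Q) Q t <= 4 * Q%:R ^+ 2 / t ^+ 2) ->
  `|y - f%:~R| <= 1 / 2 ->
  (forall x x', x \in s -> x' \in s -> `|y - x%:R - x'%:R| <= t0 * Q%:R) ->
  (forall x x', x \in s -> x' \in s -> x <> x' -> (x + x')%N%:Z <> f) ->
  fejer_sum (T * Q) Q s y <= (size s)%:R * (64 * Q%:R ^+ 2) + (T * Q)%N%:R ^+ 2.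
Proof.
move=> Q0 us hf yf hs hn; rewrite /fejer_sum.
have E x : \sum_(x' <- s) fejer (T * Q) Q (y - x%:R - x'%:R) =
    \sum_(x' <- s | x'%:Z != f - x%:Z) fejer (T * Q) Q (y - x%:R - x'%:R) +
    \sum_(x' <- s | x'%:Z == f - x%:Z) fejer (T * Q) Q (y - x%:R - x'%:R).
  by rewrite [RHS]addrC [LHS](bigID (fun x' : nat => x'%:Z == f - x%:Z)).
rewrite (eq_bigr _ (fun x _ => E x)) big_split /=; apply: lerD.
  apply: (@le_trans _ _ (\sum_(x <- s) 64 * Q%:R ^+ 2)); last first.
    by rewrite big_const_seq count_predT iter_addr_0 [leRHS]mulr_natl.
  rewrite big_seq [leRHS]big_seq; apply: ler_sum => x xs.
  apply: (fejer_row_bound Q0 us hf) => [|x' x's]; last exact: hs.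
  by rewrite rmorphB /= (_ : _ - _ = y - f%:~R)//; ring.
have J0 : 0 <= (T * Q)%N%:R ^+ 2 :> R by rewrite sqr_ge0.
apply: (@le_trans _ _ (\sum_(x <- s | (x + x)%N%:Z == f) (T * Q)%N%:R ^+ 2)); last first.
  by apply: sum_unique_le => // x x' _ _ /eqP h1 /eqP h2; lia.
rewrite [leRHS]big_mkcond big_seq [leRHS]big_seq; apply: ler_sum => x xs.
case: ifPn => [/eqP xf|/eqP xf].
  apply: (@le_trans _ _ (\sum_(x' <- s | x'%:Z == f - x%:Z) (T * Q)%N%:R ^+ 2)).
    by apply: ler_sum => x' _; exact: fejer_le.
  by apply: sum_unique_le => // x1 x2 _ _ /eqP h1 /eqP h2; lia.
rewrite big_seq_cond big_pred0// => x'; apply/negP => /andP[x's /eqP x'f].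
have nx : x <> x' by move=> xx; apply: xf; move: x'f; rewrite -xx; lia.
by apply: (hn x x' xs x's nx); lia.
Qed.

(** Each pair has a crossing point [p]; at the grid points within [h] of it the kernel is at least a
    quarter of its peak, and [grid_count] provides [L * h / 2] of them. *)
Lemma fejer_sum_lower (t0 h : R) T Q s (L a b : nat) (z : nat -> R) :
  (forall t, T%:R * `|t| <= t0 -> (T * Q)%N%:R ^+ 2 / 4 <= fejer (T * Q) Q t) ->
  0 < h -> 4 <= L%:R * h -> 2 * h <= b%:R - a%:R ->
  (forall x x', x \in s -> x' \in s -> exists2 p : R, a%:R <= p <= b%:R &
     forall k, (L * a <= k < L * b)%N -> `|k%:R / L%:R - p| <= h ->
       T%:R * `|z k - x%:R - x'%:R| <= t0) ->
  (size s)%:R ^+ 2 * ((T * Q)%N%:R ^+ 2 / 4 * (L%:R * h / 2)) <=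
    \sum_(L * a <= k < L * b) fejer_sum (T * Q) Q s (z k).
Proof.
move=> hf h0 Lh hab hp; rewrite /fejer_sum exchange_big /=.
have cst (c : R) : (size s)%:R * c = \sum_(x <- s) c.
  by rewrite big_const_seq count_predT iter_addr_0 mulr_natl.
rewrite expr2 -mulrA cst big_seq [leRHS]big_seq.
apply: ler_sum => x xs; rewrite exchange_big /=.
rewrite cst big_seq [leRHS]big_seq.
apply: ler_sum => x' x's.
have [p pab hk] := hp x x' xs x's.
have J0 : 0 <= (T * Q)%N%:R ^+ 2 / 4 :> R by rewrite divr_ge0// sqr_ge0.
rewrite (le_trans (ler_wpM2l J0 (grid_count pab hab Lh h0)))// mulr_sumr.
apply: ler_sum_nat => k kk; case: ifPn => kp; last by rewrite mulr0 fejer_ge0.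
by rewrite mulr1; apply: hf; exact: hk.
Qed.

End Counting.

Section Comparison.
Variables (R : realType) (H : set (R -> R)).
Hypothesis hH : hardy_field H.
Variable alpha : R -> R.
Hypothesis Ha : H alpha.
Variable l0 : nat.
Hypothesis hl : \forall x \near +oo, `|alpha x| <= x ^+ l0.
Hypothesis hsup : forall C : R, \forall x \near +oo, C * x <= alpha x.
Hypothesis hi1 : forall (p : {poly rat}) (c C : R),
  \forall x \near +oo, C <= `|alpha x - c * (map_poly ratr p).[x]| / ln x.

(** Arguments below [n0], where [alpha] is not controlled, are dropped at the cost of a second [ep].
    The shift by 1/2 is a factor of modulus 1; it brings [alpha n] within 1/2 of its integer
    part. *)
Lemma shifted_sum_comparison (T ep : R) (n0 : nat) : 0 < ep -> ep <= 1 ->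
  \forall M \near \oo, exists L0 : nat, forall (L : nat) (th : R), (L0 < L)%N -> `|th| <= T ->
    normc ((L%:R)%:C * \sum_(n0 <= n < M) expi (th * (alpha n%:R - 1 / 2))
           - \sum_(L * n0 <= k < L * M) expi (th * (alpha (k%:R / L%:R) - 1 / 2)))
      <= 2 * ep * (L%:R * M%:R).
Proof.
move=> ep0 ep1; have [N1 _ h1] := sum_comparison hH Ha hl hsup hi1 T ep0 ep1.
exists (maxn N1 (n0 + Num.truncn (2 * n0%:R / ep)).+1) => // M /=.
rewrite geq_max => /andP[/h1 [L0 hL0] MM]; exists L0 => L th LL thT.
have nM : (n0 <= M)%N by lia.
have e0 : 0 <= 2 * n0%:R / ep by rewrite divr_ge0 ?mulr_ge0// ltW.
have /andP[_ t2] := truncn_itv e0.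
have epM : 2 * n0%:R <= ep * M%:R.
  rewrite [leRHS]mulrC -ler_pdivrMr// (le_trans (ltW t2))// ler_nat; lia.
have {}hL0 := hL0 L th LL thT.
have sh (I : Type) (r : seq I) (f : I -> R) :
    \sum_(i <- r) expi (th * (f i - 1 / 2)) = expi (- (th / 2)) * \sum_(i <- r) expi (th * f i).
  by rewrite mulr_sumr; apply: eq_bigr => i _; rewrite -expiD; congr expi; ring.
rewrite !sh mulrCA -mulrBr normcM normc_expi mul1r (rmorph_nat (real_complex R)).
have c1 := @big_cat_nat _ _ _ n0 0 M xpredT (fun n : nat => expi (th * alpha n%:R)) (leq0n _) nM.
have nLM : (L * n0 <= L * M)%N by rewrite leq_mul2l nM orbT.
have c2 := @big_cat_nat _ _ _ (L * n0) 0 (L * M) xpredT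
  (fun k : nat => expi (th * alpha (k%:R / L%:R))) (leq0n _) nLM.
move: hL0; rewrite c1 c2 /=.
set S1 := \sum_(0 <= i < n0) _; set S2 := \sum_(n0 <= i < M) _.
set S3 := \sum_(0 <= i < L * n0) _; set S4 := \sum_(L * n0 <= i < L * M) _ => hL0.
have b1 : normc (L%:R * S1) <= L%:R * n0%:R.
  rewrite normcM -(rmorph_nat (real_complex R)) normc_real ger0_norm// ler_wpM2l//.
  exact: (normc_sum_expi_le (fun n => th * alpha n%:R)).
have b3 : normc S3 <= L%:R * n0%:R.
  rewrite -natrM; exact: (normc_sum_expi_le (fun k => th * alpha (k%:R / L%:R))).
have -> : L%:R * S2 - S4 = (L%:R * (S1 + S2) - (S3 + S4)) - (L%:R * S1 - S3) by ring.
rewrite (le_trans (normcB_le _ _))// (le_trans (lerD hL0 (normcB_le _ _)))//.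
have := ler_wpM2l (ler0n R L) epM; lra.
Qed.

End Comparison.

(** In units of [L * M * Q2 * S], the coarse side is at most 66: 64 from the tails, 1 from equal
    pairs since [T ^+ 2 <= S], and 1 from the comparison. The fine side is of order [S * T / N], at
    least a constant times [d * T], because [h] is of order [M / (T * N)]. *)
Lemma counting_contradiction (R : realType) (S T K t0 N d L M Q2 h aM fine coarse : R) :
  0 < S -> 0 < T -> 0 < K -> 0 < t0 -> 0 < N -> 0 < d -> 0 < L -> 0 < M -> 0 < Q2 -> 0 < aM ->
  h = t0 / (T * (K * aM / M)) -> aM <= 4 * K * N -> T ^+ 2 <= S -> d * N / 2 <= S ->
  66 * 64 * K ^+ 2 < d * t0 * T ->
  S ^+ 2 * (T ^+ 2 * Q2 / 4 * (L * h / 2)) <= fine ->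
  fine <= L * coarse + (T ^+ 2)^-1 * (L * M) * (T ^+ 2 * Q2 * S) ->
  coarse <= M * (S * (64 * Q2) + T ^+ 2 * Q2) -> False.
Proof.
move=> S0 T0 K0 t00 N0 d0 L0 M0 Q0 a0 hE aN TS dS hT h1 h2 h3.
have hge : t0 * M / (4 * T * K ^+ 2 * N) <= h.
  have p1 : 0 < 4 * K * N by rewrite !mulr_gt0.
  have -> : t0 * M / (4 * T * K ^+ 2 * N) = t0 * M / (T * K) * (4 * K * N)^-1.
    by field; rewrite !gt_eqF.
  have -> : h = t0 * M / (T * K) * aM^-1 by rewrite hE; field; rewrite !gt_eqF.
  by rewrite ler_wpM2l ?lef_pV2 ?posrE// !(mulr_ge0, invr_ge0)// ltW.
have {}h2 : fine <= L * M * Q2 * (66 * S).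
  have e1 : (T ^+ 2)^-1 * (L * M) * (T ^+ 2 * Q2 * S) = L * M * Q2 * S.
    by field; rewrite gt_eqF.
  have LM : 0 <= L * M * Q2 by rewrite !mulr_ge0 ?(ltW L0) ?(ltW M0) ?(ltW Q0).
  have e2 := ler_wpM2l (ltW L0) h3; have e3 := ler_wpM2l LM TS; lra.
have c0 : 0 <= S ^+ 2 * (T ^+ 2 * Q2 / 4) * (L / 2).
  by rewrite ltW// !mulr_gt0 ?invr_gt0 ?exprn_gt0.
have {}h1 : S ^+ 2 * T * t0 * (L * M * Q2) <= 32 * K ^+ 2 * N * fine.
  have e := ler_wpM2l c0 hge.
  have p : 0 < 32 * K ^+ 2 * N by rewrite !mulr_gt0.
  rewrite [leRHS]mulrC -ler_pdivrMr//; apply: le_trans h1.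
  rewrite (_ : S ^+ 2 * (T ^+ 2 * Q2 / 4 * (L * h / 2)) =
     S ^+ 2 * (T ^+ 2 * Q2 / 4) * (L / 2) * h); last by ring.
  apply: le_trans e; rewrite le_eqVlt; apply/orP; left; apply/eqP.
  by field; rewrite !gt_eqF.
have p : 0 < L * M * Q2 * S by rewrite !mulr_gt0.
have {}h1 : S * T * t0 <= 66 * 32 * K ^+ 2 * N.
  have q : 0 <= 32 * K ^+ 2 * N by rewrite ltW// !mulr_gt0 ?exprn_gt0.
  have e := le_trans h1 (ler_wpM2l q h2); rewrite -(ler_pM2r p); lra.
have e : d * N / 2 * (T * t0) <= S * (T * t0) by rewrite ler_wpM2r ?mulr_ge0 ?(ltW T0) ?(ltW t00).
move: hT; rewrite -(ltr_pM2r N0); lra.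
Qed.

(** The first argument with value at least [C] is taken; its predecessor has a value below [C], and
    a unit step multiplies by at most [K]. *)
Lemma minimal_argument (R : realType) (alpha : R -> R) (n0 M0 : nat) (K C : R) :
  (forall C : R, \forall x \near +oo, C * x <= alpha x) -> (n0 <= M0)%N ->
  (forall x y, n0%:R <= x -> x <= y -> alpha x <= alpha y) ->
  (forall x, n0%:R <= x -> alpha (x + 1) <= K * alpha x) -> 0 <= K ->
  alpha M0%:R < C ->
  exists2 M, (M0 < M)%N & C <= alpha M%:R /\ alpha M%:R <= K * C.
Proof.
move=> hsup nM0 mono hK K0 aC.
have exM : exists m, (M0 <= m)%N && (C <= alpha m%:R).
  have [b b0 hb] := near_pinfty_pos (Num.max 1 C) (hsup (Num.max 1 C)).
  have b1 : 0 <= b by move: b0; rewrite gt_max => /andP[]; lra.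
  exists (M0 + (Num.truncn b).+1)%N; rewrite leq_addr /=.
  have /andP[_ h] := truncn_itv b1.
  have bm : b < (M0 + (Num.truncn b).+1)%N%:R.
    by rewrite (lt_le_trans h)// ler_nat leq_addl.
  apply: le_trans (hb _ bm); move: bm b0; rewrite gt_max; move: (_%:R) => m bm /andP[b2 b3].
  have : 1 <= Num.max 1 C by rewrite le_max lexx.
  have : C <= Num.max 1 C by rewrite le_max lexx orbT.
  move: (Num.max 1 C) => Z z1 z2.
  have : Z * 1 <= Z * m by apply: ler_wpM2l; lra.
  lra.
case: (ex_minnP exM) => M /andP[MM CM] hmin.
have MM0 : (M0 < M)%N.
  rewrite ltn_neqAle MM andbT; apply/eqP => E; move: CM; rewrite -E; lra.
exists M => //; split=> //.
case: M MM CM hmin MM0 => // M _ CM hmin MM0.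
have a1 : alpha M%:R < C.
  rewrite ltNge; apply/negP => h; have := hmin M; rewrite -ltnS MM0 h => /(_ isT).
  by rewrite ltnn.
have nM : n0%:R <= M%:R :> R by rewrite ler_nat; lia.
by rewrite -natr1 (le_trans (hK _ nM))// ler_wpM2l// ltW.
Qed.

Lemma floor_half_dist (R : realType) (x : R) : `|x - 1 / 2 - (Num.floor x)%:~R| <= 1 / 2.
Proof.
have := floor_itv x; rewrite intrD1 => /andP[f1 f2]; rewrite ler_norml; lra.
Qed.

Lemma window_dist_le (R : realType) (v c N : R) (x y : nat) : 0 < v -> v <= c ->
  x%:R <= N -> y%:R <= N -> `|v - 1 / 2 - x%:R - y%:R| <= c + 2 * N + 1.
Proof.
move=> v0 vc; have : 0 <= x%:R :> R by []. have : 0 <= y%:R :> R by [].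
by move: (x%:R) (y%:R) => u w u0 w0 uN wN; rewrite ler_norml; lra.
Qed.

Lemma half_sum_between (R : realType) (a b x y N X : R) : X + 1 <= x -> 0 <= y -> x <= N ->
  y <= N -> a <= X + 1 -> 2 * N + 2 <= b ->
  Num.min a b <= x + y + 1 / 2 <= Num.max a b.
Proof.
by move=> *; rewrite ge_min le_max; apply/andP; split; apply/orP; [left|right]; lra.
Qed.

Lemma radius_le (R : realType) (t0 T K a M : R) : 1 <= T -> 1 <= K -> 4 * t0 <= a ->
  0 < a -> 0 < M -> t0 / (T * (K * a / M)) * 4 <= M.
Proof.
move=> T1 K1 ta a0 M0; have [T0 K0] : 0 < T /\ 0 < K by split; lra.
rewrite -ler_pdivlMr// ler_pdivrMr ?mulr_gt0 ?invr_gt0//.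
have -> : M / 4 * (T * (K * a / M)) = (T * K) * (a / 4) :> R by field; rewrite gt_eqF.
have TK : 1 <= T * K by rewrite mulr_ege1.
have a4 : 0 <= a / 4 by lra.
have := ler_wpM2r a4 TK; lra.
Qed.

(** The order of choices matters: [T] depends on the density [d] and on constants of [alpha] and the
    kernel only, the precision of the comparison on [T], then [N] is taken from the density, [M]
    from [N], and finally [L] and [Q]. *)
Lemma density_solution (R : realType) (H : set (R -> R)) (alpha : R -> R) (l0 : nat)
    (A : set nat) :
  hardy_field H -> H alpha -> (\forall x \near +oo, `|alpha x| <= x ^+ l0) ->
  (forall C : R, \forall x \near +oo, C * x <= alpha x) ->
  (forall (p : {poly rat}) (c C : R),
    \forall x \near +oo, C <= `|alpha x - c * (map_poly ratr p).[x]| / ln x) ->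
(0 < upper_density R A)%E ->
  exists x y n : nat, [/\ A x, A y, x <> y, (0 < n)%N &
    (x + y)%N%:Z = Num.floor (alpha n%:R)].
Proof.
have split5 (a b c d e n : nat) : (1 + a + b + c + d + e <= n)%N ->
    [/\ (0 < n)%N, (a <= n)%N, (b < n)%N, (c < n)%N & (d < n)%N /\ (e < n)%N].
  by clear => h; do ?split; lia.
have split2 (a b n : nat) : (a + 2 * b < n)%N -> [/\ (a <= n)%N & (2 * b <= n)%N].
  by clear => h; split; lia.
move=> hH Ha hl hsup hi1 /upper_density_gt0 [d d0 hA]; apply: contrapT => no.
have {}no x y n : A x -> A y -> x <> y -> (0 < n)%N ->
    (x + y)%N%:Z <> Num.floor (alpha n%:R).
  by move=> Ax Ay xy n0 E; apply: no; exists x, y, n.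
have [n0 [K [n00 K1 hc hpos [hdiv hlip hstep]]]] := superlinear_regular hH Ha hl hsup.
have [t0 t00 hfej] := fejer_bounds R.
have K0 : 0 < K := lt_le_trans ltr01 K1.
have mono := superlinear_homo n00 hpos hdiv.
have c1 : 0 <= 66 * 64 * K ^+ 2 / (d * t0) by rewrite !mulr_ge0 ?invr_ge0 ?sqr_ge0 ?mulr_ge0 ?ltW.
pose T := (Num.truncn (66 * 64 * K ^+ 2 / (d * t0))).+1.
have T1 : 1 <= T%:R :> R by rewrite ler1n.
have T0 : 0 < T%:R :> R by rewrite ltr0n.
have hT : 66 * 64 * K ^+ 2 < d * t0 * T%:R.
  by rewrite [ltRHS]mulrC -ltr_pdivrMr ?mulr_gt0//; have /andP[] := truncn_itv c1.
have ep0 : 0 < (T%:R ^+ 2)^-1 / 2 :> R by rewrite divr_gt0// invr_gt0 exprn_gt0.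
have ep1 : (T%:R ^+ 2)^-1 / 2 <= 1 :> R.
  have : (T%:R ^+ 2)^-1 <= 1 :> R by rewrite invf_le1 ?exprn_gt0// exprn_ege1.
  by clear; lra.
have [M0 _ hM0] := shifted_sum_comparison hH Ha hl hsup hi1 T%:R n0 ep0 ep1.
pose X0 := Num.truncn (alpha n0%:R).
have aX0 : alpha n0%:R <= X0%:R + 1.
  have /andP[_ /ltW] := truncn_itv (ltW (hpos _ (lexx n0%:R))).
  by rewrite -natr1.
pose M1 := (M0 + 2 * n0)%N.
(* Thresholds for [N]: discarding the elements up to [X0] costs at most half of the density, the
   rest still has at least [T ^ 2] elements, and both [alpha M1] and [4 * t0] are below [N]. *)
pose N0 := (1 + X0 + Num.truncn (2 * X0%:R / d) + Num.truncn (2 * T%:R ^+ 2 / d)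
   + Num.truncn `|alpha M1%:R| + Num.truncn (4 * t0))%N.
have [N NN0 hN] := hA N0.
have big (c : R) m : (Num.truncn c < m)%N -> c <= m%:R.
  move=> h; case: (leP 0 c) => c0; last by rewrite (le_trans (ltW c0)).
  have /andP[_ /ltW h'] := truncn_itv c0.
  by rewrite (le_trans h')// ler_nat.
have [N0' X0N i1 i2 [i3 i4]] := split5 _ _ _ _ _ _ NN0.
have N1 : 1 <= N%:R :> R by rewrite ler1n.
have hX : X0%:R <= d * N%:R / 2.
  have : 2 * X0%:R / d <= N%:R by exact: big.
  by rewrite ler_pdivrMr//; clear; lra.
have hS0 : T%:R ^+ 2 <= d * N%:R / 2.
  have : 2 * T%:R ^+ 2 / d <= N%:R by exact: big.
  by rewrite ler_pdivrMr//; clear; lra.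
have hM1 : alpha M1%:R <= N%:R.
  by rewrite (le_trans (ler_norm _))//; exact: big.
have ht0 : 4 * t0 <= N%:R by exact: big.
have nM1 : (n0 <= M1)%N by rewrite /M1 mul2n -addnn addnA leq_addl.
have hM2 : alpha M1%:R < 2 * N%:R + 2.
  by rewrite (le_lt_trans hM1)//; clear -N1; lra.
have [M MM1 [aM1 aM2]] := minimal_argument hsup nM1 mono hstep (ltW K0) hM2.
have {}aM2 : alpha M%:R <= 4 * K * N%:R.
  rewrite (le_trans aM2)// -mulrA mulrCA ler_wpM2l ?(ltW K0)//; clear -N1; lra.
have aM0 : 0 < alpha M%:R by clear -aM1 N1; lra.
have [MM0 M2n] := split2 _ _ _ MM1.
have M2 : 2 * n0%:R <= M%:R :> R by rewrite -natrM ler_nat.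
have n0R : 0 < n0%:R :> R by rewrite ltr0n.
have MR : 0 < M%:R :> R by clear -M2 n0R; lra.
have [L0 hL0] := hM0 M MM0.
(* The radius on which, by the Lipschitz bound on [[n0, M]], [alpha] moves by at most [t0 / T], the
   width of the peak. *)
have [h [hE h0]] : exists h : R, h = t0 / (T%:R * (K * alpha M%:R / M%:R)) /\ 0 < h.
  eexists; split; first by [].
  by rewrite divr_gt0 ?mulr_gt0 ?invr_gt0.
have hh : 2 * h <= M%:R - n0%:R.
  have : h * 4 <= M%:R.
    by rewrite hE; apply: radius_le => //; clear -ht0 aM1 N1; lra.
  by clear -M2; lra.
pose L := (L0 + (Num.truncn (4 / h)).+1)%N.
have L0' : (L0 < L)%N by rewrite /L addnS ltnS leq_addr.
have Lh : 4 <= L%:R * h by rewrite -ler_pdivrMr//; apply: big; rewrite leq_addl.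
have LR : 0 < L%:R :> R by rewrite ltr0n (leq_ltn_trans _ L0').
(* The period exceeds [N], as Parseval's identity requires, and is so long that all the distances
   met stay in the range of the tail bound. *)
pose Q := (N + (Num.truncn ((4 * K * N%:R + 2 * N%:R + 1) / t0)).+1)%N.
have NQ : (N < Q)%N by rewrite /Q addnS ltnS leq_addr.
have hQ : 4 * K * N%:R + 2 * N%:R + 1 <= t0 * Q%:R.
  by rewrite [leRHS]mulrC -ler_pdivrMr//; apply: big; rewrite leq_addl.
have Q0 : (0 < Q)%N by exact: leq_ltn_trans NQ.
have [hf1 hf2] := hfej T Q Q0.
(* Elements up to [X0] are left out so that [x + x' + 1 / 2] exceeds [alpha n0] and is therefore
   attained by [alpha] on [[n0, M]]. *)
pose s := [seq k <- index_iota X0.+1 N.+1 | k \in A].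
have us : uniq s by rewrite filter_uniq// iota_uniq.
have hs x : x \in s -> [/\ A x, (X0 < x)%N & (x <= N)%N].
  by rewrite mem_filter mem_index_iota ltnS => /andP[/set_mem ? /andP[]].
have hsize : d * N%:R / 2 <= (size s)%:R.
  suff : (\sum_(1 <= k < N.+1) (k \in A) <= X0 + size s)%N.
    by rewrite -(ler_nat R) natrD => hc1; clear -hN hX hc1; lra.
  rewrite (@big_cat_nat _ _ _ X0.+1)//=; apply: leq_add.
    rewrite (leq_trans (leq_sum _ (_ : forall k, _ -> _ <= 1)%N))//.
      by move=> k _; case: (_ \in _).
    by rewrite sum_nat_const_nat muln1 subn1.
  by rewrite size_filter -sum1_count [leqRHS]big_mkcond /= leq_sum// => k _; case: (_ \in _).
have hB := fejer_sum_comparison (c := L%:R) (r := index_iota n0 M)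
   (r' := index_iota (L * n0) (L * M)) (y := fun n => alpha n%:R - 1 / 2)
   (z := fun k => alpha (k%:R / L%:R) - 1 / 2) Q0 us
   (fun x xs => leq_ltn_trans (let: And3 _ _ h := hs x xs in h) NQ) (hL0 L ^~ L0').
have nle n : (n0 <= n)%N -> n0%:R <= n%:R :> R by rewrite ler_nat.
have coarse : \sum_(n0 <= n < M) fejer_sum (T * Q) Q s (alpha n%:R - 1 / 2) <=
    M%:R * ((size s)%:R * (64 * Q%:R ^+ 2) + T%:R ^+ 2 * Q%:R ^+ 2) :> R.
  apply: (@le_trans _ _ (\sum_(n0 <= n < M)
     ((size s)%:R * (64 * Q%:R ^+ 2) + T%:R ^+ 2 * Q%:R ^+ 2))); last first.
    rewrite sumr_const_nat [leRHS]mulr_natl ler_wpMn2l ?leq_subr//.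
  apply: ler_sum_nat => n /andP[nn nM]; rewrite -exprMn -natrM.
  have an0 := hpos _ (nle n nn).
  have anM : alpha n%:R <= alpha M%:R by apply: mono (nle n nn) _; rewrite ler_nat ltnW.
  apply: (fejer_sum_upper (f := Num.floor (alpha n%:R)) Q0 us hf1).
  - exact: floor_half_dist.
  - move=> x x' /hs[_ _ xN] /hs[_ _ x'N].
    apply: le_trans hQ; apply: window_dist_le; rewrite ?ler_nat//; exact: le_trans aM2.
  - move=> x x' /hs[Ax _ _] /hs[Ax' _ _] xx'; apply: no => //; exact: leq_trans nn.
have fine : (size s)%:R ^+ 2 * ((T * Q)%N%:R ^+ 2 / 4 * (L%:R * h / 2)) <=
    \sum_(L * n0 <= k < L * M) fejer_sum (T * Q) Q s (alpha (k%:R / L%:R) - 1 / 2).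
  apply: (fejer_sum_lower hf2 h0 Lh hh) => x x' /hs[Ax xX xN] /hs[Ax' x'X x'N].
  have nM : n0%:R <= M%:R :> R by rewrite ler_nat (leq_trans _ M2n)// leq_pmull.
  have [||p pI pE] := @IVT R alpha n0%:R M%:R (x%:R + x'%:R + 1 / 2) nM.
  - apply: continuous_in_subspaceT => z; rewrite inE /= in_itv /= => /andP[nz _].
    exact: hc.
  - by apply: (half_sum_between (N := N%:R) (X := X0%:R)) => //; rewrite ?natr1 ?ler_nat.
  move: pI; rewrite in_itv /= => pI; exists p => // k /andP[k1 k2] kp.
  have lip u v : n0%:R <= u -> u <= v -> v <= M%:R -> v - u <= h ->
      T%:R * (alpha v - alpha u) <= t0.
    move=> nu uv vM vu; have V0 : 0 < T%:R * (K * alpha M%:R / M%:R).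
      by rewrite !mulr_gt0// invr_gt0.
    rewrite (le_trans (ler_wpM2l (ltW T0) (hlip u v M%:R nu uv vM)))// mulrA.
    by rewrite mulrC -ler_pdivlMr// -hE.
  have -> : alpha (k%:R / L%:R) - 1 / 2 - x%:R - x'%:R = alpha (k%:R / L%:R) - alpha p.
    by rewrite pE; ring.
  have u1 : n0%:R <= k%:R / L%:R :> R by rewrite ler_pdivlMr// -natrM ler_nat mulnC.
  have u2 : k%:R / L%:R <= M%:R :> R by rewrite ler_pdivrMr// -natrM ler_nat mulnC ltnW.
  move/andP: pI => [p1 p2].
  case: (leP p (k%:R / L%:R)) => pk.
    rewrite ger0_norm ?subr_ge0 ?mono//; apply: lip => //.
    by rewrite (le_trans (ler_norm _)).
  rewrite distrC ger0_norm ?subr_ge0 ?mono ?(ltW pk)//; apply: lip => //; first exact: ltW.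
  by rewrite (le_trans (ler_norm _))// distrC.
have S0 : 0 < (size s)%:R :> R.
  by rewrite (lt_le_trans _ hsize)// (lt_le_trans _ hS0)// exprn_gt0.
have Q20 : 0 < Q%:R ^+ 2 :> R by rewrite exprn_gt0// ltr0n.
apply: (counting_contradiction S0 T0 K0 t00 _ d0 LR MR Q20 aM0 hE aM2 _ hsize hT _ _ coarse).
- exact: lt_le_trans N1.
- exact: le_trans hsize.
- by rewrite -exprMn -natrM; exact: fine.
rewrite -lerBlDl (le_trans (ler_norm _))// distrC (le_trans hB)//.
rewrite le_eqVlt; apply/orP; left; apply/eqP.
by rewrite !natrM; field; rewrite gt_eqF.
Qed.

(** * Residues missed by integer polynomials *)

Section Congruence.

Lemma horner_taylor2 (A : comNzRingType) (P : {poly A}) (a h : A) :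
  exists w, P.[a + h] = P.[a] + h * P^`().[a] + h ^+ 2 * w.
Proof.
elim/poly_ind: P => [|P c [w IH]]; first by exists 0; rewrite deriv0 !horner0; ring.
exists (w * (a + h) + P^`().[a]).
rewrite derivD derivM derivX derivC !hornerE IH; ring.
Qed.

Lemma horner_eqmod (P : {poly int}) (m a b : int) :
  (m %| a - b)%Z -> (m %| P.[a] - P.[b])%Z.
Proof.
move=> mab; have [w E] := horner_taylor2 P b (a - b).
rewrite addrC subrK in E; rewrite E (_ : _ - _ = (a - b) * (P^`().[b] + (a - b) * w)); last by ring.
exact: dvdz_mulr.
Qed.

(** Euclid's argument for polynomial values. With [c = F.[0]] nonzero, the value at [c * N! * t] is
    [c * v] with [v] congruent to 1 modulo [N!], so prime factors of [v] exceed [N]. If [F.[0] = 0],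
    every prime divides that value. *)
Lemma prime_divisor_value (F : {poly int}) (N : nat) : (1 < size F)%N ->
  exists l (a : int), [/\ prime l, (N < l)%N & (l%:Z %| F.[a])%Z].
Proof.
move=> F1; have [F0|F0] := eqVneq F.[0] 0.
  exists (pdiv (N`!.+1)), 0; rewrite F0 dvdz0 pdiv_prime ?ltnS ?fact_gt0//; split=> //.
  rewrite ltnNge; apply/negP => h; have p1 := pdiv_prime (n := N`!.+1).
  rewrite ltnS fact_gt0 in p1; have {}p1 := p1 isT.
  have d1 : (pdiv N`!.+1 %| N`!)%N by rewrite dvdn_fact// prime_gt0.
  have := pdiv_dvd N`!.+1; rewrite -[X in (_ %| X)%N]addn1 dvdn_addr// dvdn1 => /eqP E.
  by move: p1; rewrite E.
pose c := F.[0]; pose u : int := c * (N`!)%:Z.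
have u0 : u != 0 by rewrite mulf_neq0// -lt0n fact_gt0.
(* Away from the roots of [Q] the value is neither 0 nor [c] nor [- c], so that [v] is not 0, 1 or
   -1 and has a prime factor. *)
pose Q := F * (F ^+ 2 - (c ^+ 2)%:P).
have Fn0 : F != 0 by rewrite -size_poly_gt0 ltnW.
have Q0 : Q != 0.
  rewrite mulf_neq0//; apply/eqP => /eqP; rewrite subr_eq0 => /eqP E.
  have := size_polyC_leq1 (c ^+ 2); rewrite -E expr2 size_mul//; move: F1; case: (size F) => [|[|n]]//.
  by rewrite addSn addnS.
have [t rt] : exists t : nat, ~~ root Q (u * t%:Z).
  apply: contrapT => no; have := @max_poly_roots _ Q [seq u * t%:Z | t <- iota 0 (size Q)] Q0.
  rewrite size_map size_iota ltnn => h; suff : false by []; apply: h.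
  - apply/allP => _ /mapP[t _ ->]; apply: contrapT => /negP nr.
    by apply: no; exists t.
  - by rewrite map_inj_uniq ?iota_uniq// => x y /(mulfI u0)[].
have [w E] := horner_taylor2 F 0 (u * t%:Z); rewrite add0r -/c in E.
have [v [vE v1]] : exists v : int, F.[u * t%:Z] = c * v /\ (N`!%:Z %| v - 1)%Z.
  pose z := t%:Z * (F^`().[0] + u * t%:Z * w).
  exists (1 + N`!%:Z * z); split.
    have e (f t' d w' : int) : c + c * f * t' * d + (c * f * t') ^+ 2 * w' =
        c * (1 + f * (t' * (d + c * f * t' * w'))) by ring.
    by rewrite E /u /z e.
  by rewrite addrAC subrr add0r dvdz_mulr.
have v2 : (1 < `|v|)%N.
  have v0 : v != 0 by apply: contraNneq rt => v0; rewrite rootE !hornerE vE v0 mulr0 mul0r.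
  have : `|v|%N != 1%N; last by move: v0; rewrite -absz_eq0; lia.
  apply: contraNneq rt => v1'; rewrite rootE !hornerE vE exprMn.
  have -> : v ^+ 2 = 1 by apply/eqP; rewrite sqr_norm_eq1 -abszE v1'.
  by rewrite mulr1 subrr mulr0.
exists (pdiv `|v|), (u * t%:Z); rewrite pdiv_prime//; split=> //; last first.
  by rewrite vE dvdz_mull// dvdzE /= pdiv_dvd.
rewrite ltnNge; apply/negP => h.
have d1 : (pdiv `|v| %| N`!)%N by rewrite dvdn_fact// prime_gt0// pdiv_prime.
have d2 : ((pdiv `|v|)%:Z %| v - 1)%Z by apply: dvdz_trans v1; rewrite dvdzE.
have d3 : ((pdiv `|v|)%:Z %| v)%Z by rewrite dvdzE /= pdiv_dvd.
have : ((pdiv `|v|)%:Z %| v - (v - 1))%Z by rewrite rpredB.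
rewrite opprB addrC subrK dvdz1 => /eqP E1; have := pdiv_prime v2.
by rewrite (E1 : pdiv `|v| = 1%N).
Qed.

(** By Taylor expansion [P.[a + l]] and [P.[a]] agree modulo [l ^ 2], so [P] is not injective on the
    residues modulo [l ^ 2], and a map of a finite set to itself that is not injective is not
    onto. *)
Lemma missed_residue (P : {poly int}) (l : nat) (a : int) : (1 < l)%N ->
  (l%:Z %| P^`().[a])%Z ->
  exists r : int, forall n : int, ~~ ((l ^ 2)%N%:Z %| P.[n] - r)%Z.
Proof.
move=> l1 la; pose m := (l ^ 2).-1.
have mE : m.+1 = (l ^ 2)%N by rewrite /m prednK// expn_gt0 ltnW.
rewrite -mE.
pose red (z : int) : 'I_m.+1 := inord `|(z %% m.+1)%Z|%N.
have m0 : m.+1%:Z != 0 by [].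
have redE z : (red z)%:Z = (z %% m.+1)%Z.
  have h := ltz_mod z m0; have h' := modz_ge0 z m0.
  by rewrite /red inordK ?gez0_abs// -ltz_nat gez0_abs.
have redP z : (m.+1 %| (red z)%:Z - z)%Z.
  by rewrite -eqz_mod_dvd redE modz_mod.
have red_eq z z' : (m.+1 %| z - z')%Z -> red z = red z'.
  by rewrite -eqz_mod_dvd => /eqP E; rewrite /red E.
have redK (r : 'I_m.+1) : red r%:Z = r.
  apply: val_inj; have := redE r%:Z; rewrite modz_small => [[]//|].
  by rewrite ltz_nat ltn_ord.
pose f (x : 'I_m.+1) := red P.[x%:Z].
have : ~ (forall r, exists x, f x = r).
  move=> onto; have [g gK] := choice onto.
  have fi : injective f := can_inj (canF_sym gK).
  have al : red (a + l%:Z) = red a.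
    apply: fi; apply: red_eq.
    have h1 := horner_eqmod P (redP (a + l%:Z)); have h2 := horner_eqmod P (redP a).
    have h3 : (m.+1 %| P.[a + l%:Z] - P.[a])%Z.
      have [w ->] := horner_taylor2 P a l%:Z.
      rewrite (_ : _ - _ = l%:Z * P^`().[a] + l%:Z ^+ 2 * w); last by ring.
      rewrite mE expnS expn1 rpredD//.
        by rewrite PoszM dvdz_mul.
      by rewrite PoszM expr2 dvdz_mulr.
    rewrite (_ : _ - _ = (P.[(red (a + l%:Z))%:Z] - P.[a + l%:Z]) + (P.[a + l%:Z] - P.[a])
        - (P.[(red a)%:Z] - P.[a])); last by ring.
    by rewrite rpredB// rpredD.
  have : (m.+1 %| a + l%:Z - a)%Z.
    have h1 := redP (a + l%:Z); have h2 := redP a; rewrite al in h1.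
    have := rpredB h2 h1; congr (_ %| _)%Z; ring.
  rewrite addrC addKr dvdzE /= mE => /dvdn_leq; rewrite ltnW// => /(_ isT).
  by rewrite leqNgt -[X in (X < _)%N]expn1 ltn_exp2l.
move=> /existsNP[r hr]; exists r%:Z => n; apply/negP => h; apply: hr.
exists (red n); rewrite -(redK r); apply: red_eq.
have h1 := horner_eqmod P (redP n); have := rpredD h1 h; congr (_ %| _)%Z; ring.
Qed.

(** The window grows by one: a prime [l > q] dividing a value of the derivative gives a residue
    missed modulo [l ^ 2], and the Chinese remainder theorem moves it to the position next to the
    window. The choice [l > q] ensures coprimality, and degree at least 2 makes the derivative
    nonconstant. *)
Lemma missed_window (P : {poly int}) (G : nat) : (2 < size P)%N ->
  exists (q : nat) (r0 : int), (0 < q)%N /\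
    forall (n : int) (i : nat), (1 <= i <= G)%N -> ~~ (q%:Z %| P.[n] - (r0 + i%:Z))%Z.
Proof.
move=> P2; elim: G => [|G [q [r0 [q0 IH]]]].
  by exists 1%N, 0; split=> // n i /andP[i1 i0]; lia.
have [|l [a [pl ql la]]] := prime_divisor_value (F := P^`()) q.
  rewrite ltnNge; apply/negP => h; case E : (size P) P2 => [|[|[|k]]]// _.
  have : P^`()`_k.+1 = 0 by rewrite nth_default// (leq_trans h).
  rewrite coef_deriv => /eqP; rewrite mulrn_eq0 /= => /eqP P0.
  have : lead_coef P = 0 by rewrite lead_coefE E.
  by move=> /eqP; rewrite lead_coef_eq0 => /eqP Pz; rewrite Pz size_poly0 in E.
have l2 := prime_gt1 pl.
have [r hr] := missed_residue l2 la.
have co : coprimez q%:Z (l ^ 2)%N%:Z.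
  rewrite coprimezE /= coprimeXr// coprime_sym prime_coprime//.
  by apply/negP => /dvdn_leq; lia.
exists (q * l ^ 2)%N, (zchinese q%:Z (l ^ 2)%N%:Z r0 (r - G.+1%:Z)).
split; first by rewrite muln_gt0 q0 expn_gt0 ltnW.
move=> n i /andP[i1]; rewrite leq_eqVlt => /orP[/eqP->|iG].
  apply: contra (hr n) => h.
  have h1 : ((l ^ 2)%N%:Z %| P.[n] - (zchinese q%:Z (l ^ 2)%N%:Z r0 (r - G.+1%:Z) + G.+1%:Z))%Z.
    by apply: dvdz_trans h; rewrite dvdzE /= dvdn_mull.
  have := zchinese_modr co r0 (r - G.+1%:Z) => /eqP; rewrite eqz_mod_dvd => h2.
  have := rpredD h1 h2; congr (_ %| _)%Z; ring.
have := IH n i; rewrite i1 -ltnS iG => /(_ isT); apply: contra => h.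
have h1 : (q%:Z %| P.[n] - (zchinese q%:Z (l ^ 2)%N%:Z r0 (r - G.+1%:Z) + i%:Z))%Z.
  by apply: dvdz_trans h; rewrite dvdzE /= dvdn_mulr.
have := zchinese_modl co r0 (r - G.+1%:Z) => /eqP; rewrite eqz_mod_dvd => h2.
have := rpredD h1 h2; congr (_ %| _)%Z; ring.
Qed.
End Congruence.

(** * A set of positive upper density without solutions *)

Section LogClose.
Variables (R : realType) (H : set (R -> R)).
Hypothesis hH : hardy_field H.
Variable alpha : R -> R.
Hypothesis Ha : H alpha.
Hypothesis hsup : forall C : R, \forall x \near +oo, C * x <= alpha x.

(** The failure of divergence alone bounds [g x / ln x] only along some sequence. But [x * G x] is
    bounded or tends to an infinity, and in the latter case integration makes the quotient
    diverge. *)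
Lemma log_close_derive (g : R -> R) : hardy_poly H g ->
  ~ (`|g x| / ln x @[x --> +oo] --> +oo) ->
  exists (G : R -> R) (C : R), near_derive g G /\ \forall x \near +oo, `|x * G x| <= C.
Proof.
move=> [d hg] ncv; have [G hG dG] := poly_span_derive hH hg.
have lower (A : R) (f : R -> R) : (forall x, f x <= `|g x|) ->
    (\forall x \near +oo, (2 * `|A| + 1) / 2 * ln x <= f x) ->
    \forall x \near +oo, A <= `|g x| / ln x.
  move=> fg; apply: filterS2 (near_gt 1) => x x1 h.
  have l0 : 0 < ln x by exact: ln_gt0.
  rewrite ler_pdivlMr// (le_trans _ (fg x))// (le_trans _ h)// ler_pM2r//.
  have := ler_norm A; lra.
have c0 (A : R) : 0 < 2 * `|A| + 1 by have := normr_ge0 A; lra.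
have hX : hardy_poly H (fun x => x * G x) by apply: hardy_polyX; exists d.
case: (hardy_poly_trichotomy hH hX) => [[C hC]|h|h]; first by exists G, C.
  exfalso; apply: ncv; apply/cvgryPge => A.
  apply: (lower A g) => [x|]; first exact: ler_norm.
  exact: derive_ge_log (c0 A) dG (h _).
exfalso; apply: ncv; apply/cvgryPge => A.
apply: (lower A (fun x => - g x)) => [x|]; first by rewrite -normrN ler_norm.
apply: (derive_ge_log (c0 A) (F := fun x => - G x)).
  by apply: filterS dG => x; exact: is_derive_opp.
by apply: filterS (h (2 * `|A| + 1)) => x; rewrite mulrN.
Qed.

(** Superlinear growth excludes [c = 0] and polynomials of degree at most 1. Clearing denominators
    and moving a sign [e] into the polynomial gives integer coefficients and [0 < kappa]. *)
Lemma log_close_decomposition (p : {poly rat}) (c : R) :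
  ~ (`|alpha x - c * (map_poly ratr p).[x]| / ln x @[x --> +oo] --> +oo) ->
  exists (P : {poly int}) (kappa C b : R), [/\ (2 < size P)%N, 0 < kappa, 0 < C, 0 < b &
    forall x y, b < x -> x <= y -> y <= 8 * x ->
      `|(alpha y - kappa * (map_poly intr P).[y]) - (alpha x - kappa * (map_poly intr P).[x])|
        <= C].
Proof.
set g := fun x => alpha x - c * (map_poly ratr p).[x] => ncv.
have hg : hardy_poly H g.
  apply: hardy_polyB; first exact: hardy_polyH Ha.
  by apply: hardy_polyZ; exact: hardy_poly_horner.
have [G [C0 [dG hG]]] := log_close_derive hg ncv.
have [B B0 hB] := derive_bounded_log dG hG.
have c0 : c != 0.
  apply/eqP => c0; have : \forall x \near (+oo : set_system R), False; last first.
    by case/near_pinftyP => a /(_ (a + 1)); apply; rewrite ltrDl.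
  apply: filterS3 hB (hsup (B + 1)) (near_gt 0) => x h1 h2 x0.
  rewrite /g c0 mul0r subr0 in h1.
  have h3 := le_trans (ler_norm _) h1.
  have : B * ln x <= B * x by rewrite ler_wpM2l ?ln_le_id// ltW.
  lra.
have p2 : (2 < size p)%N.
  rewrite ltnNge; apply/negP => p2.
  have : \forall x \near (+oo : set_system R), False; last first.
    by case/near_pinftyP => a /(_ (a + 1)); apply; rewrite ltrDl.
  have pE x : (map_poly ratr p).[x] = ratr p`_0 + ratr p`_1 * x :> R.
    rewrite (@horner_coef_wide _ 2) ?size_map_poly//.
    by rewrite big_ord_recr big_ord1 /= !coef_map /= expr0 expr1 mulr1.
  apply: filterS3 hB (hsup (B + `|c * ratr p`_0| + `|c * ratr p`_1| + 1)) (near_gt 1) => x h1 h2 x1.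
  rewrite /g pE in h1.
  have x0 : 0 < x by lra.
  have h3 := le_trans (ler_norm _) h1.
  have : B * ln x <= B * x by rewrite ler_wpM2l ?ln_le_id// ltW.
  have := ler_wpM2r (ltW x0) (ler_norm (c * ratr p`_1)).
  have := ler_wpM2l (normr_ge0 (c * ratr p`_0)) (ltW x1).
  have := ler_norm (c * ratr p`_0).
  lra.
have [q [a a0 pE]] := rat_poly_scale p.
have [e [e1 ke]] : exists e : int, (e = 1 \/ e = -1) /\ 0 < c / a%:~R * e%:~R.
  have ka : c / a%:~R != 0 by rewrite mulf_neq0// invr_eq0 intr_eq0.
  case: (ltgtP (c / a%:~R) 0) ka => // h _; first by exists (-1); split; [right|lra].
  by exists 1; split; [left|lra].
pose k := c / a%:~R * e%:~R.
have gE x : alpha x - k * (map_poly intr (e *: q)).[x] = g x.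
  rewrite /g pE; congr (_ - _).
  have -> : map_poly ratr (a%:~R^-1 *: map_poly intr q) = a%:~R^-1 *: map_poly intr q :> {poly R}.
    rewrite map_polyZ /= fmorphV /= ratr_int; congr (_ *: _).
    by rewrite -map_poly_comp; apply: eq_map_poly => z /=; rewrite ratr_int.
  rewrite map_polyZ /= !hornerZ /k.
  have ee : e%:~R * e%:~R = 1 :> R by rewrite -rmorphM; case: e1 => ->.
  by rewrite mulrA -[c / _ * _ * _]mulrA ee mulr1 mulrA.
have [b b0 hb] := near_pinfty_pos 0 (filterI dG hG).
have C0' : 0 <= C0.
  by have [_ h] := hb (b + 1) (ltr_pwDr ltr01 (lexx b)); exact: le_trans h.
(* From [x] to [y <= 8 * x] the mean value theorem gives at most [C0 / x] times [7 * x]; the added 1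
   makes the constant positive. *)
exists (e *: q), k, (7 * C0 + 1), b; split=> //; last 2 first.
- lra.
- move=> x y bx xy y8; rewrite !gE.
  have [->|nxy] := eqVneq x y; first by rewrite subrr normr0; lra.
  have {}xy : x < y by rewrite lt_neqAle nxy.
  have [|t /andP[xt ty] ->] := mean_value (f := g) (F := G) xy.
    by move=> t /andP[xt _]; have [] := hb t (lt_le_trans bx xt).
  have [_ h] := hb t (lt_trans bx xt).
  have x0 : 0 < x by lra. have t0 : 0 < t by lra.
  rewrite normrM [X in _ * X]gtr0_norm ?subr_gt0//.
  have h1 : `|G t| * x <= C0.
    rewrite normrM (gtr0_norm t0) mulrC in h; apply: le_trans h.
    by rewrite ler_wpM2l// ltW.
  have : `|G t| * (y - x) <= `|G t| * (7 * x) by rewrite ler_wpM2l//; lra.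
  lra.
have en : e != 0 by case: e1 => ->.
rewrite size_scale//; move: p2; rewrite pE size_scale ?invr_eq0 ?intr_eq0//.
by rewrite size_map_inj_poly//; exact: intr_inj.
Qed.

End LogClose.

Lemma upper_density_gt0I (R : realType) (A : set nat) (d : R) : 0 < d ->
  (forall N0, exists2 N, (N0 < N)%N &
    d * N%:R <= (\sum_(1 <= k < N.+1) (k \in A))%N%:R) -> (0 < upper_density R A)%E.
Proof.
move=> d0 hA; rewrite /upper_density; set u := (fun N : nat => _).
apply: (@lt_le_trans _ _ d%:E); first by rewrite lte_fin.
rewrite limn_esup_lim (cvg_lim _ (ereal_nonincreasing_cvgn (@nonincreasing_esups _ u)))//.
apply: le_ereal_inf_tmp => _ [n _ <-]; have [N nN hN] := hA n.
apply: (@le_trans _ _ (u N)).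
  by rewrite /u lee_fin ler_pdivlMr// ltr0n (leq_ltn_trans _ nN).
by apply: ereal_sup_ubound; exists N => //=; exact: ltnW.
Qed.

Lemma count_injection_le (A : set nat) (f : nat -> nat) (J M : nat) :
  {in iota 0 J &, injective f} ->
  (forall j, (j < J)%N -> [/\ (0 < f j)%N, (f j <= M)%N & A (f j)]) ->
  (J <= \sum_(1 <= k < M.+1) (k \in A))%N.
Proof.
move=> fi hf.
have -> : (\sum_(1 <= k < M.+1) (k \in A))%N = size [seq k <- index_iota 1 M.+1 | k \in A].
  rewrite size_filter -sum1_count [RHS]big_mkcond /=; apply: eq_bigr => k _.
  by case: (k \in A).
rewrite -[X in (X <= _)%N](size_iota 0) -(size_map f); apply: uniq_leq_size.
  by rewrite map_inj_in_uniq ?iota_uniq.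
move=> _ /mapP[j + ->]; rewrite mem_iota add0n => /= jJ; have [f0 fM Af] := hf j jJ.
by rewrite mem_filter mem_index_iota f0 ltnS fM andbT mem_set.
Qed.

Lemma infinite_residue (f : nat -> int) (q : nat) : (0 < q)%N ->
  exists a : int, forall M, exists2 m, (M <= m)%N & (q%:Z %| f m - a)%Z.
Proof.
move=> q0; apply: contrapT => no.
have h (i : 'I_q) : exists M, forall m, (M <= m)%N -> ~~ (q%:Z %| f m - i%:Z)%Z.
  apply: contrapT => hi; apply: no; exists i%:Z => M; apply: contrapT => hM.
  apply: hi; exists M => m Mm; apply/negP => qm; apply: hM; by exists m.
have [g hg] := choice h.
pose M := \max_i g i.
have q0' : q%:Z != 0 by rewrite eqz_nat -lt0n.
have r0 := modz_ge0 (f M) q0'; have r1 := ltz_mod (f M) q0'.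
have rq : (`|(f M %% q)%Z| < q)%N by rewrite -ltz_nat gez0_abs.
have := hg (Ordinal rq) M (leq_bigmax _) => /negP; apply => /=.
by rewrite gez0_abs// -eqz_mod_dvd modz_mod.
Qed.

(** * Integer parts of progressions at selected scales *)

Section Construction.
Variable R : realType.

(** About [N / (2 * v)] consecutive terms, starting with the first one at or above [N], stay below
    [2 * N]; [1 <= v] makes their integer parts distinct. *)
Lemma floor_progression_count (u v : R) (A : set nat) (N : nat) : 1 <= v -> 4 * v <= N%:R ->
  (forall (x : nat) (k : int), (N <= x)%N -> (x <= 2 * N)%N ->
     x%:Z = Num.floor (u + v * k%:~R) -> A x) ->
  (8 * v)^-1 * (2 * N)%N%:R <= (\sum_(1 <= k < (2 * N).+1) (k \in A))%N%:R :> R.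
Proof.
move=> v1 vN hA; have v0 : 0 < v by lra.
have N0 : 0 < N%:R :> R by lra.
pose J := Num.truncn (N%:R / (2 * v)).
have x0 : 0 <= N%:R / (2 * v) by rewrite divr_ge0//; lra.
have /andP[J1 J2] := truncn_itv x0; rewrite -/J -[J.+1%:R]natr1 in J1 J2; move: J J1 J2 => J J1 J2.
apply: (@le_trans _ _ J%:R).
  have e1 : N%:R / (2 * v) = 2 * ((8 * v)^-1 * (2 * N)%N%:R) by rewrite natrM; field; rewrite gt_eqF.
  have : 2 <= N%:R / (2 * v) by rewrite ler_pdivlMr; lra.
  lra.
rewrite ler_nat.
pose k0 := Num.ceil ((N%:R - u) / v).
have /andP[k1 k2] := ceil_itv ((N%:R - u) / v); rewrite -/k0 in k1 k2; move: k0 k1 k2 => k0 k1 k2.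
have {}k2 : N%:R <= u + v * k0%:~R by move: k2; rewrite ler_pdivrMr//; lra.
have {}k1 : u + v * k0%:~R < N%:R + v.
  by move: k1; rewrite intrB /= ltr_pdivlMr//; lra.
have vJ : v * J%:R <= N%:R / 2.
  by move: J1; rewrite ler_pdivlMr; lra.
pose w j : R := u + v * (k0 + j%:Z)%:~R.
have wE j : w j = u + v * k0%:~R + v * j%:R by rewrite /w rmorphD /=; ring.
have wN j : N%:R <= w j by rewrite wE ler_wpDr// mulr_ge0// ltW.
have wJ j : (j < J)%N -> w j < (2 * N)%N%:R.
  move=> jJ; rewrite wE natrM.
  have h : v * j%:R <= v * J%:R by apply: (ler_wpM2l (ltW v0)); rewrite ler_nat; exact: ltnW.
  lra.
pose f j := Num.truncn (w j).
have w0 j : 0 <= w j by exact: le_trans (wN j).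
have Nf j : (N <= f j)%N by rewrite /f truncn_ge_nat.
have fJ j : (j < J)%N -> (f j <= 2 * N)%N.
  move=> /wJ h; have /andP[h1 _] := truncn_itv (w0 j).
  by rewrite -(ler_nat R) (le_trans h1)// ltW.
apply: (count_injection_le (f := f)).
  have lt i j : (i < j)%N -> (f i < f j)%N.
    move=> ij; rewrite /f truncn_ge_nat// -[X in X <= _]natr1.
    have /andP[h1 _] := truncn_itv (w0 i); apply: le_trans (lerD h1 (lexx 1)) _.
    rewrite !wE -addrA lerD2l (le_trans (lerD (lexx _) v1))//.
    by rewrite -{2}[v]mulr1 -mulrDr ler_wpM2l ?(ltW v0)// natr1 ler_nat.
  by move=> i j _ _ E; case: (ltngtP i j) => // /lt; rewrite E ltnn.
move=> j jJ; split; [|exact: fJ|].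
  by apply: leq_trans (Nf j); rewrite -(ltr_nat R).
apply: (hA _ (k0 + j%:Z)); [exact: Nf|exact: fJ|].
by have := truncn_floor (w j); rewrite w0 -/(f j) => ->; rewrite gez0_abs// floor_ge0.
Qed.

(** The number [b] is chosen so that [2 * b - a] is [r0 + (G + 1) / 2], the centre of the missed
    window. If [x + y] is the integer part of [an], dividing by [kappa] puts [Pn] modulo [q] near
    this centre; integer parts and the deviation of [g] cost less than [(2 + C) / kappa + 1], which
    half the window absorbs. *)
Lemma sum_residue (kappa C an : R) (Pn r0 k k' j a : int) (q G x y : nat) : 0 < kappa ->
  (2 + C) / kappa + 1 <= (G%:R - 1) / 2 -> 
  let b := (r0%:~R + (G%:R + 1) / 2 + a%:~R) / 2 in
  x%:Z = Num.floor (kappa * (b + q%:R * k%:~R)) ->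
  y%:Z = Num.floor (kappa * (b + q%:R * k'%:~R)) ->
  (x + y)%N%:Z = Num.floor an ->
  `|an - kappa * Pn%:~R - kappa * (a%:~R + q%:R * j%:~R)| <= C + kappa ->
  exists2 i : nat, (1 <= i <= G)%N & (q%:Z %| Pn - (r0 + i%:Z))%Z.
Proof.
move=> k0 hG b hx hy hxy hn.
have hx1 := floor_itv (kappa * (b + q%:R * k%:~R)).
have hy1 := floor_itv (kappa * (b + q%:R * k'%:~R)).
have hn1 := floor_itv an.
rewrite -hx intrD1 in hx1; rewrite -hy intrD1 in hy1; rewrite -hxy intrD1 in hn1.
pose z := Pn - r0 - q%:Z * (k + k' - j).
have zE : z%:~R = Pn%:~R - r0%:~R - q%:R * (k%:~R + k'%:~R - j%:~R) :> R.
  by rewrite /z !(rmorphB, rmorphD, rmorphM).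
have hz : `|kappa * (z%:~R - (G%:R + 1) / 2)| < kappa * ((G%:R - 1) / 2).
  have h : 2 + C + kappa <= kappa * ((G%:R - 1) / 2).
    have := ler_wpM2l (ltW k0) hG; rewrite mulrDr mulr1.
    by rewrite (_ : kappa * ((2 + C) / kappa) = 2 + C)//; field; rewrite gt_eqF.
  apply: lt_le_trans h.
  move: hx1 hy1 hn1 hn => /andP[a1 a2] /andP[b1 b2] /andP[c1 c2].
  rewrite zE /b PoszD rmorphD /= in a1 a2 b1 b2 c1 c2 *; rewrite ler_norml ltr_norml => /andP[d1 d2].
  apply/andP; split; lra.
rewrite normrM gtr0_norm// ltr_pM2l// ltr_norml in hz; move/andP: hz => [z1 z2].
have z1' : 1 < z by rewrite -(ltr_int R); lra.
have z2' : z < G%:Z by rewrite -(ltr_int R); lra.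
have zq : Pn - (r0 + z) = q%:Z * (k + k' - j) by rewrite /z; ring.
have zi : z = `|z|%N%:Z by rewrite gez0_abs// (le_trans _ (ltW z1')).
rewrite zi in z1' z2' zq; exists `|z|%N; last by rewrite zq dvdz_mulr.
by rewrite (ltnW z1') ltnW.
Qed.

Variables (alpha : R -> R) (n0 : nat) (P : {poly int}) (kappa C b0 : R).
Hypothesis n00 : (0 < n0)%N.
Hypothesis hpos : forall x, n0%:R <= x -> 0 < alpha x.
Hypothesis hdiv : forall x y, n0%:R <= x -> x <= y -> alpha x * y <= alpha y * x.
Hypothesis hsup : forall C : R, \forall x \near +oo, C * x <= alpha x.
Hypothesis hP : (2 < size P)%N.
Hypothesis hk : 0 < kappa.
Hypothesis hC : 0 < C.

Let g x := alpha x - kappa * (map_poly intr P).[x].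

Hypothesis hg : forall x y, b0 < x -> x <= y -> y <= 8 * x -> `|g y - g x| <= C.

(** Since [alpha x / x] is nondecreasing, [alpha (8 * m) >= 8 * alpha m], which is at least
    [4 * N + 1] because [N <= alpha m + 1] and [2 <= alpha m]. This is the origin of the factor 8 in
    the oscillation bound. *)
Lemma comparable_argument (m n N : nat) : (n0 <= m)%N -> 2 <= alpha m%:R ->
  (forall i, (i < n0)%N -> alpha i%:R <= alpha m%:R) ->
  alpha m%:R < N%:R -> N%:R <= alpha m%:R + 1 ->
  N%:R <= alpha n%:R -> alpha n%:R < 4 * N%:R + 1 -> (m <= n)%N /\ n%:R <= 8 * m%:R :> R.
Proof.
move=> nm am hsmall mN Nm Nn nN; have mn : alpha m%:R < alpha n%:R by lra.
have n0n : (n0 <= n)%N.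
  by rewrite leqNgt; apply/negP => /hsmall; rewrite leNgt mn.
split.
  rewrite leqNgt; apply/negP => nm'; move: mn; apply/negP; rewrite -leNgt.
  by apply: (superlinear_homo n00 hpos hdiv); rewrite ler_nat// ltnW.
rewrite leNgt; apply/negP => mn8.
have m0 : 0 < m%:R :> R by rewrite ltr0n; exact: leq_trans nm.
have nmR : n0%:R <= m%:R :> R by rewrite ler_nat.
have m8 : m%:R <= 8 * m%:R :> R by lra.
have h1 := hdiv nmR m8.
have h2 : alpha (8 * m%:R) <= alpha n%:R.
  by apply: (superlinear_homo n00 hpos hdiv); [exact: le_trans m8|exact: ltW].
have : 8 * alpha m%:R <= alpha (8 * m%:R).
  by rewrite -(ler_pM2r m0); lra.
lra.
Qed.

(** The set lives on blocks [[N m, 2 * N m]] with [N m] just above [alpha m], for the infinitely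
    many [m] at which the integer part of [g m / kappa] is [a] modulo [q]. A solution at such a
    scale has its argument in [[m, 8 * m]], where [g] is still within [C] of [g m]. *)
Lemma avoiding_set : exists A : set nat, [/\ A `<=` [set k | (0 < k)%N],
  (0 < upper_density R A)%E &
  forall x y n : nat, A x -> A y -> (x + y)%N%:Z <> Num.floor (alpha n%:R)].
Proof.
have W0 : 0 <= (2 + C) / kappa + 1.
  by rewrite addr_ge0// divr_ge0 ?(ltW hk)//; move: hC; lra.
have [G hG] : exists G : nat, (2 + C) / kappa + 1 <= (G%:R - 1) / 2.
  have /andP[_ h] := truncn_itv W0; exists (2 * (Num.truncn ((2 + C) / kappa + 1)).+1 + 1)%N.
  rewrite natrD natrM; lra.
have [q0 [r0 [q00 hq0]]] := missed_window G hP.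
(* A multiple of the modulus misses the same window; it is taken large enough for the progression of
   ratio [kappa * q] to have distinct integer parts. *)
have [q [q_gt0 hq kq]] : exists q : nat, [/\ (0 < q)%N,
    forall (n : int) (i : nat), (1 <= i <= G)%N -> ~~ (q%:Z %| P.[n] - (r0 + i%:Z))%Z &
    1 <= kappa * q%:R].
  have k0 : 0 <= kappa^-1 by rewrite invr_ge0 ltW.
  have /andP[_ h] := truncn_itv k0; exists (q0 * (Num.truncn kappa^-1).+1)%N; split.
  - by rewrite muln_gt0 q00.
  - move=> n i /(hq0 n); apply: contra; apply: dvdz_trans.
    by rewrite dvdzE /= dvdn_mulr.
  - rewrite mulrC -ler_pdivrMr// mul1r (le_trans (ltW h))// ler_nat.
    by rewrite leq_pmull.
have [a ha] := infinite_residue (fun m : nat => Num.floor (g m%:R / kappa)) q_gt0.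
pose b : R := (r0%:~R + (G%:R + 1) / 2 + a%:~R) / 2.
pose C2 : R := 2 + \sum_(0 <= i < n0) `|alpha i%:R|.
have [m0 [nm0 bm0 hm0]] : exists m0 : nat, [/\ (n0 <= m0)%N, b0 < m0%:R &
    forall m, (m0 <= m)%N -> C2 <= alpha m%:R /\ m%:R <= alpha m%:R].
  have [c c0 hc] := near_pinfty_pos (Num.max 0 b0) (filterI (hsup 1) (hsup `|C2|)).
  rewrite gt_max in c0; move/andP: c0 => [c0 bc].
  have /andP[_ h] := truncn_itv (ltW c0).
  exists (n0 + (Num.truncn c).+1)%N; split; first exact: leq_addr.
    by rewrite (lt_trans bc)// (lt_le_trans h)// ler_nat leq_addl.
  move=> m hm; have cm : c < m%:R.
    by rewrite (lt_le_trans h)// ler_nat (leq_trans _ hm)// leq_addl.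
  have [h1 h2] := hc _ cm; rewrite mul1r in h1; split=> //.
  rewrite (le_trans (ler_norm _))// (le_trans _ h2)// ler_peMr// ler1n.
  by rewrite (leq_trans _ hm)// addnS.
have small m : (m0 <= m)%N -> forall i, (i < n0)%N -> alpha i%:R <= alpha m%:R.
  move=> /hm0[h _] i ni; rewrite (le_trans _ h)// (le_trans (ler_norm _))//.
  rewrite /C2 big_mkord (bigD1 (Ordinal ni))//= addrCA lerDl addr_ge0// sumr_ge0//.
pose N m := (Num.truncn (alpha m%:R)).+1.
have NP m : (m0 <= m)%N -> [/\ 2 <= alpha m%:R, alpha m%:R < (N m)%:R & (N m)%:R <= alpha m%:R + 1].
  move=> /hm0[h _]; have a2 : 2 <= alpha m%:R.
    by rewrite (le_trans _ h)// lerDl sumr_ge0.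
  have a0 : 0 <= alpha m%:R by rewrite (le_trans _ a2).
  have /andP[h1 h2] := truncn_itv a0; split=> //.
  by rewrite /N -natr1 lerD2r.
pose M m := (m0 <= m)%N /\ (q%:Z %| Num.floor (g m%:R / kappa) - a)%Z.
pose form (x : nat) := exists k : int, x%:Z = Num.floor (kappa * (b + q%:R * k%:~R)).
have key m x y n : M m -> form x -> form y -> (N m <= x + y)%N -> (x + y <= 4 * N m)%N ->
    (x + y)%N%:Z <> Num.floor (alpha n%:R).
  move=> [mm qm] [k hx] [k' hy] h1 h2 E.
  have [a2 aN Na] := NP m mm.
  have := floor_itv (alpha n%:R); rewrite -E intrD1 => /andP[e1 e2].
  have Nn : (N m)%:R <= alpha n%:R by rewrite (le_trans _ e1)// ler_nat.
  have nN : alpha n%:R < 4 * (N m)%:R + 1.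
    by rewrite (lt_le_trans e2)// lerD2r -natrM ler_nat.
  have nm : (n0 <= m)%N by exact: leq_trans mm.
  have [mn n8] := comparable_argument nm a2 (small m mm) aN Na Nn nN.
  have bm : b0 < m%:R by rewrite (lt_le_trans bm0)// ler_nat.
  have mnR : m%:R <= n%:R :> R by rewrite ler_nat.
  have gmn := hg bm mnR n8.
  have [j jE] := dvdzP qm.
  have [i iG] : exists2 i : nat, (1 <= i <= G)%N & (q%:Z %| P.[n%:Z] - (r0 + i%:Z))%Z.
    apply: (@sum_residue kappa C (alpha n%:R) P.[n%:Z] r0 k k' j a q G x y hk hG hx hy E).
    have PE : (P.[n%:Z])%:~R = (map_poly intr P).[n%:R] :> R.
      by rewrite -[n%:R]/(n%:Z%:~R) horner_map.
    rewrite PE; have := floor_itv (g m%:R / kappa); rewrite intrD1.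
    have -> : Num.floor (g m%:R / kappa) = a + q%:Z * j by rewrite [q%:Z * j]mulrC -jE addrC subrK.
    rewrite rmorphD rmorphM /= ler_pdivlMr// ltr_pdivrMr// => /andP[f1 f2].
    rewrite -/(g n%:R); move: gmn f1 f2 hk; move: (g n%:R) (g m%:R) => gn gm.
    rewrite !ler_norml => /andP[g1 g2] f1 f2 k0; apply/andP; split; lra.
  by apply/negP; apply: hq.
pose A : set nat := [set x | exists2 m, M m & [/\ (N m <= x)%N, (x <= 2 * N m)%N & form x]].
exists A; split.
- by move=> x [m _ [h _ _]] /=; apply: leq_trans h.
- have v0 : 0 < 8 * (kappa * q%:R) by rewrite mulr_gt0// (lt_le_trans _ kq).
  apply: (@upper_density_gt0I _ _ (8 * (kappa * q%:R))^-1); first by rewrite invr_gt0.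
  move=> N0; pose t := (Num.truncn (4 * (kappa * q%:R))).+1.
  have [m mm qm] := ha (m0 + N0 + t)%N.
  have m0m : (m0 <= m)%N by rewrite (leq_trans _ mm)// -addnA leq_addr.
  have N0m : (N0 <= m)%N by rewrite (leq_trans _ mm)// addnAC leq_addl.
  have tm : (t <= m)%N by rewrite (leq_trans _ mm)// leq_addl.
  have [_ aN _] := NP m m0m; have [_ ma] := hm0 m m0m.
  have mN : (m < N m)%N by rewrite -(ltr_nat R) (le_lt_trans ma).
  exists (2 * N m)%N; first by rewrite (leq_ltn_trans N0m)// (leq_trans mN)// leq_pmull.
  apply: (floor_progression_count (u := kappa * b) kq).
    have t0 : 0 <= 4 * (kappa * q%:R) by rewrite mulr_ge0// (le_trans _ kq).
    have /andP[_ h] := truncn_itv t0.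
    by rewrite (le_trans (ltW h))// ler_nat (leq_trans tm)// ltnW.
  move=> x k h1 h2 E; exists m; split=> //; exists k; rewrite E; congr Num.floor; ring.
- move=> x y n [m Mm [x1 x2 fx]] [m' Mm' [y1 y2 fy]].
  (* The two elements may come from different blocks. The larger scale decides: the sum lies between
     its [N] and four times it. *)
  case: (leqP (N m) (N m')) => NN.
    apply: (key m' x y n Mm' fx fy); first by rewrite (leq_trans y1)// leq_addl.
    by rewrite (_ : 4 = 2 + 2)%N// mulnDl leq_add// (leq_trans x2)// leq_mul2l.
  apply: (key m x y n Mm fx fy); first by rewrite (leq_trans x1)// leq_addr.
  by rewrite (_ : 4 = 2 + 2)%N// mulnDl leq_add// (leq_trans y2)// leq_mul2l ltnW.
Qed.

End Construction.

Lemma sub_polynomial_bound (R : realType) (f : R -> R) (l : R) : 0 < l ->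
  f x / (x `^ l) @[x --> +oo] --> (0 : R) ->
  exists n : nat, \forall x \near +oo, `|f x| <= x ^+ n.
Proof.
move=> l0 /cvgr0Pnorm_le h; exists (Num.truncn l).+1.
have /andP[_ hl] := truncn_itv (ltW l0).
apply: filterS2 (h 1 ltr01) (near_gt 1) => x + x1.
have x0 : 0 < x by lra.
rewrite normrM normfV [`|x `^ l|]gtr0_norm ?powR_gt0// ler_pdivrMr ?powR_gt0// mul1r => h1.
rewrite (le_trans h1)// -powR_mulrn ?(ltW x0)//.
by apply: ler_powR; [exact: ltW|exact: ltW].
Qed.

Theorem theorem1p8 (R : realType) (alpha : R -> R)
    (halpha : sub_polynomial alpha)
    (hsuper : alpha x / x @[x --> +oo] --> +oo) :
  (forall (p : {poly rat}) (c : R),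
     `|alpha x - c * (map_poly ratr p).[x]| / ln x @[x --> +oo] --> +oo)
  <->
  (forall A : set nat,
     A `<=` [set k | (0 < k)%N] ->
     (0 < upper_density R A)%E ->
     exists x y n : nat,
       [/\ A x, A y, x <> y, (0 < n)%N &
           (x + y)%N%:Z = Num.floor (alpha n%:R)]).
Proof.
have [[H hH Ha] [l l_gt0 hl']] := halpha.
have [l0 hl] := sub_polynomial_bound l_gt0 hl'.
have hsup (C : R) : \forall x \near +oo, C * x <= alpha x.
  move/cvgryPge: hsuper => /(_ C) h.
  by apply: filterS2 h (near_gt 0) => x h x0; rewrite -ler_pdivlMr.
split=> [hi A _|hii p c].
  apply: (density_solution hH Ha hl hsup) => p c C.
  by have /cvgryPge := hi p c; exact.
apply: contrapT => /(log_close_decomposition hH Ha hsup) [P [kappa [C [b [hP hk hC b0 hg]]]]].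
have [n0 [K [n00 K1 hc hpos [hdiv _ _]]]] := superlinear_regular hH Ha hl hsup.
have [A [A0 Ad nA]] := avoiding_set n00 hpos hdiv hsup hP hk hC hg.
by have [x [y [n [Ax Ay _ _ E]]]] := hii A A0 Ad; exact: nA x y n Ax Ay E.
Qed.
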